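(* Let $G$ be a separable parameter for the $J$-method on $[0,1]$, and let the operator $Rf(t):=f(\sqrt t)$ be bounded on $G$. Suppose that $\vec A=(A_0,A_1)$ is an ordered pair such that $A_1$ is dense in $A_0$ and $A_0^\ast$ is dense in the space $\langle A_1^\ast,A_0^\ast\rangle_{G'}^K$. Then, for each $q\in[1,\infty]$, we have, with equivalence of norms, $$\langle\vec A\rangle_G^J=\vec A_{\xi,q,G}^J .$$
   Context: A Banach pair $\vec A=(A_0,A_1)$ consists of two Banach spaces continuously embedded in a common Hausdorff topological vector space; it is ordered if $A_1\subset A_0$ with embedding of norm at most $1$. $K(t,x;\vec A)=\inf\{\Vert a_0\Vert_{A_0}+t\Vert a_1\Vert_{A_1}: x=a_0+a_1\}$ for $x\in A_0+A_1$, and $J(t,x;\vec A)=\max\{\Vert x\Vert_{A_0},t\Vert x\Vert_{A_1}\}$ for $x\in A_0\cap A_1$, $t>0$. If $A_1$ is dense in $A_0$, then $A_0^\ast$ embeds in $A_1^\ast$ by restriction, so $(A_1^\ast,A_0^\ast)$ is an ordered pair. $L^1$ denotes $L^1((0,1),\frac{dt}{t})$ and $\Vert f\Vert_{L^1(1/t)}=\Vert f(t)/t\Vert_{L^1}$. A parameter for the $J$-method on $[0,1]$ is a Banach lattice $G$ of functions on $((0,1],\frac{dt}{t})$ with continuous embeddings $L^1(1/t)\subset G\subset L^1$. $\langle\vec A\rangle_G^J$ is the space of $x\in A_0+A_1$ representable as $x=\int_0^1u(t)\frac{dt}{t}$ (convergence in $A_0+A_1$) with $u:(0,1)\to A_0\cap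 A_1$ strongly measurable, normed by $\inf_u\Vert J(s,u(s);\vec A)\Vert_G<\infty$. $G'$ is the Köthe dual of $G$ with respect to the bilinear form $(f,g)=\int_0^1f(t)g(t)\frac{dt}{t^2}$, and for a pair $\vec B$, $\langle\vec B\rangle_{G'}^K$ is the space of $x\in B_0+B_1$ with norm $\Vert K(\cdot,x;\vec B)\Vert_{G'}<\infty$ (function on $(0,1)$). For $0<\theta<1$, $1\le q\le\infty$, $1/q+1/q'=1$: $\langle\vec A\rangle_{\theta,q}^{J\blacktriangleleft}$ is the space of $x=\int_0^1u(t)\frac{dt}{t}$, $u:(0,1)\to A_0\cap A_1$ strongly measurable, with norm $(q'\theta(1-\theta))^{-1/q'}\inf_u\left(\int_0^1(s^{-\theta}J(s,u(s);\vec A))^q\frac{ds}{s}\right)^{1/q}$ (supremum if $q=\infty$; the factor $(q'\theta(1-\theta))^{-1/q'}$ is $1$ if $q=1$). Let $\xi(t)=\frac{1}{2\log(e/t)}$, $0<t\le1$. $\vec A_{\xi,q,G}^J$ is the space of all $a\in A_0$ that admit a representation $a=\int_0^1u(t)\frac{dt}{t}$ with $u:(0,1]\to A_1$ strongly measurable such that the function $t\mapsto\Vert u(t)\Vert_{\langle\vec A\rangle_{\xi(t),q}^{J\blacktriangleleft}}$ belongs to $G$, with norm $\inf_u\big\Vert\,\Vert u(t)\Vert_{\langle\vec A\rangle_{\xi(t),q}^{J\blacktriangleleft}}\big\Vert_G$. *)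

(* Defs.v *)
From HB Require Import structures.
From mathcomp Require Import all_boot all_order all_algebra.
From mathcomp Require Import all_classical all_reals all_analysis.

Set Implicit Arguments.
Unset Strict Implicit.
Unset Printing Implicit Defensive.

Import Order.TTheory GRing.Theory Num.Theory.
Import numFieldNormedType.Exports.

Local Open Scope classical_set_scope.
Local Open Scope ring_scope.

Section DualSpace.
Context {R : realType} (V : normedModType R).

Definition dual_pred : {pred V -> R^o} :=
  [pred f : V -> R^o | `[< linear f /\ continuous f >]].

Record dual := Dual { dual_fun :> V -> R^o; _ : dual_fun \in dual_pred }.

HB.instance Definition _ := [isSub for dual_fun].
HB.instance Definition _ := [Choice of dual by <:].

Lemma dual_predP (f : V -> R^o) : reflect (linear f /\ continuous f) (f \in dual_pred).
Proof. exact: asboolP. Qed.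

Lemma dual_submod_closed : submod_closed dual_pred.
Proof.
split.
  apply/dual_predP; split; first by move=> a x y /=; rewrite scaler0 addr0.
  by move=> x; exact: cvg_cst.
move=> a f g /dual_predP[lf cf] /dual_predP[lg cg].
apply/dual_predP; split.
  move=> b x y; have -> (z : V) : (a *: f + g) z = a *: f z + g z by [].
  by rewrite lf lg !scalerDr !scalerA [b * a]mulrC addrACA.
by move=> x; apply: (@cvgD _ R^o); [apply: (@cvgZr _ R^o); exact: cf|exact: cg].
Qed.

HB.instance Definition _ :=
  GRing.isSubmodClosed.Build R (V -> R^o) dual_pred dual_submod_closed.
HB.instance Definition _ := [SubChoice_isSubLmodule of dual by <:].

Definition dual_norm (f : dual) : R :=
  sup [set `|f x| | x in [set x : V | `|x| <= 1]].

Lemma dual_linear (f : dual) : linear f.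
Proof. by have /dual_predP[] := valP f. Qed.

Lemma dual_continuous (f : dual) : continuous f.
Proof. by have /dual_predP[] := valP f. Qed.

HB.instance Definition _ (f : dual) :=
  GRing.isLinear.Build R V R^o *:%R f (@dual_linear f).

Lemma dual_bounded (f : dual) :
  exists2 M : R, 0 < M & forall x, `|f x| <= M * `|x|.
Proof.
have /linear_boundedP[M [Mr HM]] :=
  continuous_linear_bounded 0 (@dual_continuous f 0).
exists (Num.max M 0 + 1).
  by rewrite ltr_wpDl// le_max lexx orbT.
by apply: HM; rewrite (@le_lt_trans _ _ (Num.max M 0)) ?le_max ?lexx// ltrDl.
Qed.

Lemma dual_has_sup (f : dual) :
  has_sup [set `|f x| | x in [set x : V | `|x| <= 1]].
Proof.
split; first by exists `|f 0|, 0; rewrite //= normr0.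
have [M M0 fM] := dual_bounded f; exists M => _ [x /= x1 <-].
by rewrite (le_trans (fM x))// -[leRHS]mulr1 ler_wpM2l// ltW.
Qed.

Lemma dual_norm_ge (f : dual) x : `|f x| <= dual_norm f * `|x|.
Proof.
have [->|x0] := eqVneq x 0; first by rewrite linear0 !normr0 mulr0.
have nx : 0 < `|x| by rewrite normr_gt0.
rewrite -ler_pdivrMr//; apply: (ub_le_sup (proj2 (dual_has_sup f))).
exists (`|x|^-1 *: x).
  by rewrite /= normrZ normfV normr_id mulVf ?gt_eqF.
by rewrite linearZ/= normrM normfV normr_id mulrC.
Qed.

Lemma dual_norm_le (f : dual) M : 0 <= M ->
  (forall x, `|f x| <= M * `|x|) -> dual_norm f <= M.
Proof.
move=> M0 fM; apply: ge_sup; first by case: (dual_has_sup f).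
move=> _ [x /= x1 <-].
by rewrite (le_trans (fM x))// -[leRHS]mulr1 ler_wpM2l.
Qed.

Lemma dual_norm_ge0 f : 0 <= dual_norm f.
Proof.
apply: (ub_le_sup (proj2 (dual_has_sup f))).
by exists 0; rewrite /= ?normr0// linear0 normr0.
Qed.

Lemma dual_normD f g : dual_norm (f + g) <= dual_norm f + dual_norm g.
Proof.
apply: dual_norm_le => [|x]; first by rewrite addr_ge0 ?dual_norm_ge0.
by rewrite mulrDl (le_trans (ler_normD _ _))// lerD ?dual_norm_ge.
Qed.

Lemma dual_normZ_le (l : R) f : dual_norm (l *: f) <= `|l| * dual_norm f.
Proof.
apply: dual_norm_le => [|x]; first by rewrite mulr_ge0 ?dual_norm_ge0.
by rewrite normrM -mulrA ler_wpM2l// dual_norm_ge.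
Qed.

Lemma dual_normZ (l : R) f : dual_norm (l *: f) = `|l| * dual_norm f.
Proof.
apply/eqP; rewrite eq_le dual_normZ_le/=.
have [->|l0] := eqVneq l 0; first by rewrite normr0 mul0r dual_norm_ge0.
rewrite mulrC -ler_pdivlMr ?normr_gt0// mulrC -normfV.
by rewrite (le_trans _ (dual_normZ_le _ _))// scalerA mulVf// scale1r.
Qed.

Lemma dual_norm0_eq0 f : dual_norm f = 0 -> f = 0.
Proof.
move=> f0; apply/val_inj/funext => x; apply/eqP.
by rewrite -normr_le0 (le_trans (dual_norm_ge f x))// f0 mul0r.
Qed.

HB.instance Definition _ := Lmodule_isNormed.Build R dual
  dual_normD dual_normZ dual_norm0_eq0.

Lemma dual_complete (F : set_system dual) : ProperFilter F -> cauchy F -> cvg F.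
Proof.
move=> FF /cauchyP Fc.
have Fx (x : V) : cvg ((fun f : dual => f x : R^o) @ F).
  apply: cauchy_cvg; apply: cauchy_exP => e e0.
  have d0 : 0 < e / (`|x| + 1) by rewrite divr_gt0// ltr_wpDl.
  have [f Ff] := Fc _ d0; exists (f x).
  suff : F [set g : dual | ball (f x : R^o) e (g x)] by [].
  apply: filterS Ff => g; rewrite -!ball_normE /= => fg.
  rewrite (le_lt_trans (dual_norm_ge (f - g) x))//.
  rewrite (@le_lt_trans _ _ (`|f - g| * (`|x| + 1)))//.
    by rewrite ler_wpM2l// ?dual_norm_ge0// lerDl.
  by rewrite -ltr_pdivlMr// ltr_wpDl.
pose l (x : V) : R^o := lim ((fun f : dual => f x : R^o) @ F).
have lx (x : V) : (fun f : dual => f x : R^o) @ F --> l x by exact: Fx.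
have ll : linear l.
  move=> a x y; apply: (cvg_lim (@Rhausdorff R)).
  have -> : (fun f : dual => f (a *: x + y) : R^o) =
            (fun f : dual => a *: (f x : R^o) + f y).
    by apply/funext => f; rewrite (@dual_linear f).
  by apply: (@cvgD _ R^o); [apply: (@cvgZr _ R^o)|]; exact: lx.
have fl (f : dual) e : F (ball f e) -> forall x, `|f x - l x| <= e * `|x|.
  move=> Ff x.
  have cv : (fun g : dual => `|f x - g x| : R^o) @ F --> (`|f x - l x| : R^o).
    apply: (@cvg_norm _ R^o).
    by apply: (@cvgB _ R^o); [exact: cvg_cst|exact: lx].
  rewrite -(cvg_lim (@Rhausdorff R) cv); apply: limr_le.
    by apply/cvg_ex; eexists; exact: cv.
  apply: filterS Ff => g; rewrite -ball_normE /= => /ltW fg.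
  by rewrite (le_trans (dual_norm_ge (f - g) x))// ler_wpM2r.
have lc : continuous l.
  have [f Ff] := Fc 1 ltr01.
  pose lL : {linear V -> R^o} := HB.pack l (GRing.isLinear.Build R V R^o *:%R l ll).
  suff: continuous lL by [].
  apply: bounded_linear_continuous; apply/linear_boundedP.
  near=> M => x.
  rewrite -[lL x](subKr (f x)) (le_trans (ler_normB _ _))//.
  rewrite (le_trans (lerD (dual_norm_ge f x) (fl f 1 Ff x)))// -mulrDl.
  by rewrite ler_wpM2r//; near: M; apply: nbhs_pinfty_ge; rewrite num_real.
have lD : l \in dual_pred by apply/dual_predP.
apply/cvg_ex; exists (Dual lD : dual); apply/cvgrPdist_le => e e0.
have [f Ff] := Fc _ (divr_gt0 e0 (ltr0n _ 2)).
apply: filterS (Ff) => g fg.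
rewrite distrC -(subrK f g) -addrA (le_trans (ler_normD _ _))// [leRHS]splitr.
rewrite lerD//.
  by move: fg; rewrite -ball_normE /= distrC => /ltW.
apply: dual_norm_le => [|x]; first by rewrite divr_ge0// ltW.
exact: (fl f _ Ff x).
Unshelve. all: by end_near. Qed.

HB.instance Definition _ := Uniform_isComplete.Build dual dual_complete.

End DualSpace.

(* An ordered Banach pair (A_0, A_1), with the inclusion of A_1 in A_0 given
   as a map.  The sum A_0 + A_1 is A_0 and the intersection is A_1, in both
   cases with equal norms.  Complex Banach spaces are covered by restriction of
   scalars: taking real parts identifies their duals isometrically with the
   real ones, compatibly with restriction to A_1. *)
Record ordered_pair (R : realType) := OrderedPair {
  sp0 : completeNormedModType R;
  sp1 : completeNormedModType R;
  emb : {linear sp1 -> sp0};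
  emb_inj : injective emb;
  emb_le : forall x, `|emb x| <= `|x| }.

Section DualPair.
Context {R : realType} (A : ordered_pair R).

Lemma emb_continuous : continuous (emb A).
Proof.
apply: bounded_linear_continuous; apply/linear_boundedP.
exists 1; split; first exact: real1.
by move=> M M1 x; rewrite (le_trans (emb_le x))// ler_peMl// ltW.
Qed.

Lemma restr_subproof (f : dual (sp0 A)) :
  (f \o emb A : sp1 A -> R^o) \in dual_pred (V := sp1 A).
Proof.
apply/dual_predP; split; first by move=> a x y; rewrite /= !linearP.
move=> x; apply: continuous_comp; first exact: emb_continuous.
exact: dual_continuous.
Qed.

Definition restr (f : dual (sp0 A)) : dual (sp1 A) := Dual (restr_subproof f).

Lemma restr_linear : linear restr.
Proof. by move=> a f g; apply/val_inj. Qed.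

HB.instance Definition _ :=
  GRing.isLinear.Build R (dual (sp0 A)) (dual (sp1 A)) *:%R restr restr_linear.

Lemma restr_le f : `|restr f| <= `|f|.
Proof.
apply: dual_norm_le => [|x]; first exact: normr_ge0.
by rewrite (le_trans (dual_norm_ge f _))// ler_wpM2l//; [exact: dual_norm_ge0|exact: emb_le].
Qed.

Hypothesis A1_dense : dense (range (emb A)).

Lemma restr_inj : injective restr.
Proof.
move=> f g fg; apply/eqP; rewrite -subr_eq0; apply/eqP.
set h := f - g.
have h0 (x : sp1 A) : h (emb A x) = 0.
  have /(congr1 (fun k : dual (sp1 A) => k x)) /= fgx := fg.
  by apply/eqP; rewrite subr_eq0; apply/eqP.
apply/val_inj/funext => y; apply/eqP; apply/negPn/negP => hy.
have oU : open (h @^-1` [set z : R^o | z != 0]).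
  apply: open_comp; first by move=> z _; exact: dual_continuous.
  exact: open_neq.
have [|z [/= hz [x _ xz]]] := A1_dense _ oU; first by exists y.
by move/eqP: hz; rewrite -xz; apply; exact: h0.
Qed.

Definition dual_pair : ordered_pair R := OrderedPair restr_inj restr_le.

End DualPair.

Section KJ.
Context {R : realType} {A : ordered_pair R}.

Definition Kfun (x : sp0 A) (t : R) : R :=
  inf [set `|x - emb A b| + t * `|b| | b in [set: sp1 A]].

Definition Jfun (b : sp1 A) (t : R) : R := Num.max `|emb A b| (t * `|b|).

End KJ.

(* A Banach lattice G of functions on (0, 1], given by its norm extended by
   +oo outside G; pnorm_ideal makes the norm depend only on the class of f
   modulo equality a.e. on (0, 1].  The integrals in pnorm_L1w and pnorm_L1
   are the norms of f in L^1(1/t) and L^1 for the measure dt/t. *)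
Record J_parameter (R : realType) := JParameter {
  pnorm :> (R -> R) -> \bar R;
  pnorm_ge0 : forall f : R -> R, (0 <= pnorm f)%E;
  pnorm_meas : forall f : R -> R, (pnorm f < +oo)%E -> measurable_fun `]0 : R, 1] f;
  pnorm_eq0 : forall f : R -> R, pnorm f = 0%E ->
    {ae lebesgue_measure, forall t, `]0 : R, 1]%classic t -> f t = 0};
  pnormZ : forall (a : R) (f : R -> R), pnorm (fun t => a * f t) = (`|a|%:E * pnorm f)%E;
  pnormD : forall f g : R -> R, (pnorm (f \+ g)%R <= pnorm f + pnorm g)%E;
  pnorm_ideal : forall f g : R -> R, measurable_fun `]0 : R, 1] f ->
    {ae lebesgue_measure, forall t, `]0 : R, 1]%classic t -> `|f t| <= `|g t|} ->
    (pnorm f <= pnorm g)%E;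
  pnorm_complete : forall f_ : nat -> R -> R,
    (forall n, pnorm (f_ n) < +oo)%E ->
    (forall e : R, 0 < e -> exists N, forall m n, (N <= m)%N -> (N <= n)%N ->
      (pnorm (f_ m \- f_ n)%R < e%:E)%E) ->
    exists2 f : R -> R, (pnorm f < +oo)%E & pnorm (f_ n \- f) @[n --> \oo] --> 0%E;
  pnorm_L1w : exists2 C : R, 0 < C & forall f : R -> R, measurable_fun `]0 : R, 1] f ->
    (pnorm f <=
     C%:E * \int[lebesgue_measure]_(t in `]0%R, 1%R]) (`|f t| / t ^+ 2)%:E)%E;
  pnorm_L1 : exists2 C : R, 0 < C & forall f : R -> R, measurable_fun `]0 : R, 1] f ->
    (\int[lebesgue_measure]_(t in `]0%R, 1%R]) (`|f t| / t)%:E <=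
     C%:E * pnorm f)%E }.

Section ParameterNorms.
Context {R : realType} (G : J_parameter R).

Definition separable_parameter := exists g_ : nat -> R -> R,
  (forall n, G (g_ n) < +oo)%E /\
  forall (f : R -> R) (e : R), (G f < +oo)%E -> 0 < e ->
    exists n, (G (f \- g_ n)%R < e%:E)%E.

Definition sqrt_bounded := exists C : R, forall f : R -> R, (G f < +oo)%E ->
  (G (fun t => f (Num.sqrt t)) <= C%:E * G f)%E.

(* By the ideal property of G, taking the absolute value inside the integral
   gives the same supremum as |(f, g)| for the form (f, g) = int f g dt/t^2. *)
Definition kothe_norm (g : R -> R) : \bar R :=
  if `[< measurable_fun `]0 : R, 1] g >] then
    ereal_sup [set (\int[lebesgue_measure]_(t in `]0%R, 1%R])
                      (`|f t * g t| / t ^+ 2)%:E)%E | f in [set f | (G f <= 1)%E]]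
  else +oo%E.

Definition K_norm (B : ordered_pair R) (x : sp0 B) : \bar R :=
  kothe_norm (Kfun x).

Definition dense_in_K_space (B : ordered_pair R) :=
  forall x : sp0 B, (K_norm x < +oo)%E -> forall e : R, 0 < e ->
    exists b : sp1 B, (K_norm (x - emb B b)%R < e%:E)%E.

End ParameterNorms.

Section Bochner.
Context {R : realType} {V : normedModType R}.
Implicit Types (D : set R) (s : seq (set R * V)) (v : R -> V).

(* The list s stands for the simple function sum of 1_E a over (E, a) in s. *)
Definition simple_eval s (t : R) : V := \sum_(p <- s) \1_(p.1) t *: p.2.

Definition simple_integral D s : V :=
  \sum_(p <- s) fine (lebesgue_measure (D `&` p.1)) *: p.2.

(* Convergence everywhere rather than a.e., with Borel sets: every function
   that is strongly measurable in the a.e. sense has such a representative, so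
   infima over representations of an element by an integral are unaffected. *)
Definition strongly_measurable D v := exists s_ : nat -> seq (set R * V),
  (forall n p, p \in s_ n -> measurable p.1) /\
  forall t, D t -> simple_eval (s_ n) t @[n --> \oo] --> v t.

Definition bochner_integral D v (x : V) :=
  strongly_measurable D v /\
  exists s_ : nat -> seq (set R * V),
    [/\ forall n p, p \in s_ n ->
          measurable p.1 /\ (lebesgue_measure (D `&` p.1) < +oo)%E,
        (\int[lebesgue_measure]_(t in D) `|(v t - simple_eval (s_ n) t)%R|%:E)%E
          @[n --> \oo] --> 0%E &
        simple_integral D (s_ n) @[n --> \oo] --> x].

End Bochner.

Section Spaces.
Context {R : realType} (A : ordered_pair R).
Implicit Types (u : R -> sp1 A) (x : sp0 A) (q : \bar R) (theta : R).

(* x is the integral of u over D for dt/t, convergent in A_0. *)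
Definition represents (D : set R) u x :=
  strongly_measurable D u /\ bochner_integral D (fun t => t^-1 *: emb A (u t)) x.

(* The spaces below are given by their norms, with value +oo outside. *)

Definition J_norm (G : J_parameter R) x : \bar R :=
  ereal_inf [set G (fun s => Jfun (u s) s) | u in represents `]0, 1[ ^~ x].

(* A supremum is used for q = +oo: u can be set to 0 on a null set without
   changing its integral, so the essential supremum has the same infimum. *)
Definition Lq_theta q theta u : \bar R :=
  match q with
  | r%:E => ((\int[lebesgue_measure]_(s in `]0%R, 1%R[)
               ((s `^ (- theta) * Jfun (u s) s) `^ r / s)%:E) `^ r^-1)%E
  | +oo%E => ereal_sup [set (s `^ (- theta) * Jfun (u s) s)%:E | s in `]0, 1[]
  | -oo%E => 0%E
  end.

(* For q = 1 the conjugate exponent is +oo. *)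
Definition theta_factor q theta : R :=
  if hoelder_conjugate q is q'%:E then
    (q' * theta * (1 - theta)) `^ (- q'^-1)
  else 1.

Definition theta_norm q theta x : \bar R :=
  ((theta_factor q theta)%:E *
   ereal_inf [set Lq_theta q theta u | u in represents `]0%R, 1%R[ ^~ x])%E.

Definition xi (t : R) : R := (2 * ln (expR 1 / t))^-1.

(* The finiteness condition, which always holds since A_1 is contained in every
   intermediate space, keeps fine from turning +oo into 0. *)
Definition xi_norm q (G : J_parameter R) x : \bar R :=
  ereal_inf [set G (fun t => fine (theta_norm q (xi t) (emb A (u t)))) |
    u in [set u | represents `]0, 1] u x /\
      forall t, 0 < t <= 1 -> (theta_norm q (xi t) (emb A (u t)) < +oo)%E]].

Definition same_space (N1 N2 : sp0 A -> \bar R) :=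
  [set x | (N1 x < +oo)%E] = [set x | (N2 x < +oo)%E] /\
  exists2 C : R, 0 < C &
    forall x, (N1 x <= C%:E * N2 x)%E /\ (N2 x <= C%:E * N1 x)%E.

End Spaces.

Arguments J_norm {R} A G x.
Arguments xi_norm {R} A q G x.

(* Main.v *)
(** If [a] has norm less than [b] in the space with parameters [theta, q], then,
    up to a constant independent of [theta] and [q], there are parts [c s] of
    [a], 0 < s <= 1, with [c 1 = 0], |a - c s|_0 <= s^theta b and
    J(r, c r - c s) <= s^theta b for r <= s: the part of a representation of [a]
    living on [s, 1).  Only these parts are used, so that [q] disappears.

    Let x be the integral of u(t) dt/t, with u(t) of norm at most g(t) in the
    space with parameter xi(t).  For t <= 1/e, t^xi(t) <= rho for a fixed
    rho < 1, so the differences of the parts at the points tau^(2^j), with tau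
    slightly larger than t, write u(t) as a series of elements d_j(t) with
    J(t^(2^j), d_j(t)) <= rho^(2^(j-1)) g(t).
    The substitution s = t^(2^j) makes the integral of d_j(t) dt/t a
    J-representation, at the cost of a factor (C/2)^j, where C bounds the
    operator f(t) |-> f(sqrt t); the superexponential decay in j wins.  The
    part of u on (1/e, 1] is a bounded perturbation, because a single element
    with parameter bounded below is in the J-space.  To avoid measurable
    selections of the d_j, u is first replaced by a countably valued function,
    the values of which are close to u and adapted to the cells
    (e^(-k-1), e^(-k)].

    Conversely, spreading [a] uniformly for ds/s over (t e^(-1/xi(t)), t] shows
    that its norm for xi(t) is at most a constant times J(t, a), so that every
    J-representation is admissible for the other space. *)

Require Import Defs.
From mathcomp Require Import all_boot all_order all_algebra.
From mathcomp Require Import all_classical all_reals all_analysis.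
From mathcomp Require Import measurable_realfun ring lra.

Set Implicit Arguments.
Unset Strict Implicit.
Unset Printing Implicit Defensive.

Import Order.TTheory GRing.Theory Num.Theory.
Import numFieldNormedType.Exports.
Local Open Scope classical_set_scope.
Local Open Scope ring_scope.

(** The normalising factor in the norms for theta and q is comparable to theta^(-1/q'), and a
    Hoelder estimate on (0, s) produces this very power. Hence the constants stay uniform as xi(t)
    tends to 0, where the comparison would otherwise degenerate. The function xi is dictated by two
    demands: xi(t) log(1/t) must be bounded above for the converse inclusion, and bounded below away
    from t = 1 for the decay in j. Geometric decay would not do, since C/2 may exceed 1; squaring
    the scale at each step fits the operator f(sqrt t) and squares the bound as well. Near t = 1 the
    power t^xi(t) tends to 1 and gives no decay, so an element occurring there is moved to a fixed
    cell below 1/e. The vector-valued change of variables is carried out only for countably valued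
    functions, whose integrals are series weighted by scalar masses. The discretisation error is at
    most eps t^2 in A_1, which is harmless because t^2 has finite norm in G. *)

Lemma cvge0_near_lt {R : realType} (u : nat -> \bar R) (e : R) :
  u n @[n --> \oo] --> 0%E -> 0 < e -> \forall n \near \oo, (u n < e%:E)%E.
Proof.
move=> /fine_cvgP[fu /cvgrPdist_lt h] /h {}h.
near=> n; have fin : u n \is a fin_num by near: n.
rewrite -(fineK fin) lte_fin (le_lt_trans (ler_norm _)) // -normrN -sub0r.
by near: n.
Unshelve. all: by end_near. Qed.

(** * Integrals of nonnegative real-valued functions *)

Section NonnegativeIntegral.
Context {R : realType}.
Local Notation mu := (@lebesgue_measure R).
Implicit Types (D E : set R) (f g : R -> R).

Lemma le_integral_EFin {D} f g : measurable D ->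
  measurable_fun D f -> measurable_fun D g ->
  (forall t, D t -> 0 <= f t <= g t) ->
  (\int[mu]_(t in D) (f t)%:E <= \int[mu]_(t in D) (g t)%:E)%E.
Proof.
move=> mD mf mg fg; apply: ge0_le_integral => //.
- by move=> t /fg /andP[f0 _]; rewrite lee_fin.
- exact/measurable_EFinP.
- exact/measurable_EFinP.
- by move=> t /fg /andP[_]; rewrite lee_fin.
Qed.

Lemma integralD_EFin_ge0 {D} f g : measurable D ->
  measurable_fun D f -> measurable_fun D g ->
  (forall t, D t -> 0 <= f t) -> (forall t, D t -> 0 <= g t) ->
  (\int[mu]_(t in D) (f t + g t)%:E =
   \int[mu]_(t in D) (f t)%:E + \int[mu]_(t in D) (g t)%:E)%E.
Proof.
move=> mD mf mg f0 g0.
under eq_integral do rewrite EFinD.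
rewrite ge0_integralD //.
- exact/measurable_EFinP.
- exact/measurable_EFinP.
Qed.

Lemma integralZ_EFin_ge0 {D} (k : R) f : measurable D ->
  measurable_fun D f -> (forall t, D t -> 0 <= f t) -> 0 <= k ->
  (\int[mu]_(t in D) (k * f t)%:E = k%:E * \int[mu]_(t in D) (f t)%:E)%E.
Proof.
move=> mD mf f0 k0.
under eq_integral do rewrite EFinM.
rewrite ge0_integralZl_EFin //; exact/measurable_EFinP.
Qed.

Lemma measurable_mem D E : measurable E -> measurable_fun D (fun t => t \in E).
Proof.
move=> mE mD; apply: (@measurable_fun_bool _ _ D _ true) => //.
apply: measurableI => //.
rewrite (_ : _ @^-1` _ = E) //; apply/seteqP; split => t /=.
  by move/set_mem.
exact: mem_set.
Qed.

Lemma integral_split_mem {D} E f : measurable D -> measurable E ->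
  measurable_fun D f -> (forall t, D t -> 0 <= f t) ->
  (\int[mu]_(t in D) (f t)%:E =
   \int[mu]_(t in D `&` E) (f t)%:E + \int[mu]_(t in D `&` ~` E) (f t)%:E)%E.
Proof.
move=> mD mE mf f0; rewrite -ge0_integral_setU//.
- by rewrite -setIUr setUv setIT.
- exact: measurableI.
- by apply: measurableI => //; exact: measurableC.
- by rewrite -setIUr setUv setIT; exact/measurable_EFinP.
- by move=> t; rewrite -setIUr setUv setIT => /f0; rewrite lee_fin.
- by apply/disj_set2P; rewrite setIACA setICr setI0.
Qed.

Lemma dominated_cvg0 {D} (F : nat -> R -> R) g : measurable D ->
  (forall n, measurable_fun D (F n)) -> measurable_fun D g ->
  (forall n t, D t -> 0 <= F n t <= g t) ->
  (\int[mu]_(t in D) (g t)%:E < +oo)%E ->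
  (forall t, D t -> F n t @[n --> \oo] --> 0) ->
  (\int[mu]_(t in D) (F n t)%:E)%E @[n --> \oo] --> 0%E.
Proof.
move=> mD mF mg Fg ig cF.
have g0 t : D t -> 0 <= g t by move=> Dt; have /andP[/le_trans] := Fg 0%N t Dt; apply.
have mF' n : measurable_fun D (fun t => (F n t)%:E) by exact/measurable_EFinP.
have m0 : measurable_fun D (cst 0%E : R -> \bar R) by exact: measurable_cst.
have cF' : {ae mu, forall t, D t -> (F n t)%:E @[n --> \oo] --> cst 0%E t}.
  by apply: aeW => t Dt; apply/fine_cvgP; split; [exact: nearW|exact: cF].
have ig' : mu.-integrable D (EFin \o g).
  apply/integrableP; split; first exact/measurable_EFinP.
  by under eq_integral => t /set_mem Dt do rewrite /= ger0_norm ?g0 //.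
have Fg' : {ae mu, forall t n, D t -> (`|(F n t)%:E| <= (EFin \o g) t)%E}.
  apply: aeW => t n Dt; have /andP[F0 Fgt] := Fg n t Dt.
  by rewrite abse_EFin lee_fin ger0_norm.
have [_ _] := @dominated_convergence _ _ _ mu D mD _ _ _ mF' m0 cF' ig' Fg'.
by rewrite integral0.
Qed.

Lemma monotone_cvg_integral {D} (F : nat -> R -> R) f : measurable D ->
  (forall n, measurable_fun D (F n)) ->
  (forall n t, D t -> 0 <= F n t) ->
  (forall t n m, D t -> (n <= m)%N -> F n t <= F m t) ->
  (forall t, D t -> F n t @[n --> \oo] --> f t) ->
  (\int[mu]_(t in D) (F n t)%:E)%E @[n --> \oo] --> (\int[mu]_(t in D) (f t)%:E)%E.
Proof.
move=> mD mF F0 ndF cF.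
have mF' n : measurable_fun D (fun t => (F n t)%:E) by exact/measurable_EFinP.
have F0' n t : D t -> (0 <= (F n t)%:E)%E by move=> /F0; rewrite lee_fin.
have ndF' t : D t -> nondecreasing_seq (fun n => (F n t)%:E).
  by move=> Dt n m nm; rewrite lee_fin ndF.
have := @cvg_monotone_convergence _ _ _ mu D mD _ mF' F0' ndF'.
congr (_ --> _); apply: eq_integral => t /set_mem Dt.
by apply/cvg_lim => //; apply/fine_cvgP; split; [exact: nearW|exact: cF].
Qed.

End NonnegativeIntegral.

(** * Bochner integration *)

Section BochnerTheory.
Context {R : realType} {V : normedModType R}.
Local Notation mu := (@lebesgue_measure R).
Implicit Types (D : set R) (s : seq (set R * V)) (v w : R -> V).

Definition measurable_list s := forall p, p \in s -> measurable p.1.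

Lemma simple_eval_cons p s t :
  simple_eval (p :: s) t = \1_(p.1) t *: p.2 + simple_eval s t.
Proof. by rewrite /simple_eval big_cons. Qed.

Lemma simple_eval_cat s1 s2 t :
  simple_eval (s1 ++ s2) t = simple_eval s1 t + simple_eval s2 t.
Proof. by rewrite /simple_eval big_cat. Qed.

Lemma simple_integral_cons D p s : simple_integral D (p :: s) =
  fine (mu (D `&` p.1)) *: p.2 + simple_integral D s.
Proof. by rewrite /simple_integral big_cons. Qed.

Lemma simple_integral_cat D s1 s2 : simple_integral D (s1 ++ s2) =
  simple_integral D s1 + simple_integral D s2.
Proof. by rewrite /simple_integral big_cat. Qed.

Definition scale_list (k : R) s := [seq (p.1, k *: p.2) | p <- s].

Lemma simple_eval_scale k s t : simple_eval (scale_list k s) t = k *: simple_eval s t.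
Proof.
rewrite /simple_eval big_map scaler_sumr; apply: eq_bigr => p _ /=.
by rewrite !scalerA mulrC.
Qed.

Lemma simple_integral_scale D k s :
  simple_integral D (scale_list k s) = k *: simple_integral D s.
Proof.
rewrite /simple_integral big_map scaler_sumr; apply: eq_bigr => p _ /=.
by rewrite !scalerA mulrC.
Qed.

Lemma measurable_scale k s : measurable_list s -> measurable_list (scale_list k s).
Proof. by move=> ms p /mapP[p' p's ->] /=; exact: (ms p'). Qed.

Lemma measurable_cat s1 s2 : measurable_list s1 -> measurable_list s2 ->
  measurable_list (s1 ++ s2).
Proof. by move=> m1 m2 p; rewrite mem_cat => /orP[/m1|/m2]. Qed.

(** The offset [c] absorbs the value carried by the head set, so inductions on the list can be run
    with [c] general instead of making the sets disjoint. *)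
Lemma simple_eval_if p s t (c : V) : c + simple_eval (p :: s) t =
  if t \in p.1 then (c + p.2) + simple_eval s t else c + simple_eval s t.
Proof.
rewrite simple_eval_cons indicE; case: ifP => _.
  by rewrite scale1r addrA.
by rewrite scale0r add0r.
Qed.

Lemma measurable_list_cons p s : measurable_list (p :: s) ->
  measurable p.1 /\ measurable_list s.
Proof.
by move=> m; split=> [|p' p's]; apply: m; rewrite inE ?eqxx// p's orbT.
Qed.

Lemma measurable_comp_simple D (Phi : R -> V -> R) s c :
  measurable D -> (forall a, measurable_fun D (Phi ^~ a)) -> measurable_list s ->
  measurable_fun D (fun t => Phi t (c + simple_eval s t)).
Proof.
move=> mD mPhi; elim: s c => [|p s IH] c ms.
  rewrite (_ : (fun _ => _) = Phi ^~ c) //.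
  by apply/funext => t; rewrite /simple_eval big_nil addr0.
have [mp {}ms] := measurable_list_cons ms.
under eq_fun do rewrite simple_eval_if fun_if.
apply: measurable_fun_if => //; first exact: measurable_mem.
- by apply: measurable_funS (IH _ ms) => //; exact: subIsetl.
- by apply: measurable_funS (IH _ ms) => //; exact: subIsetl.
Qed.

(** Caratheodory's argument: [Phi] is measurable in [t] for each fixed value and continuous in the
    value, so the composition is a pointwise limit of its compositions with simple functions. It is
    applied to the J-functional and to the norms with exponent [xi t]. *)
Lemma measurable_comp_strong D (Phi : R -> V -> R) v :
  measurable D -> (forall a, measurable_fun D (Phi ^~ a)) ->
  (forall t, D t -> {for v t, continuous (Phi t)}) ->
  strongly_measurable D v -> measurable_fun D (fun t => Phi t (v t)).
Proof.
move=> mD mPhi cPhi [s_ [ms sv]].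
apply: (@measurable_fun_cvg _ _ _ D
  (fun n t => Phi t (simple_eval (s_ n) t))) => [n|t Dt].
  under eq_fun do rewrite -[simple_eval _ _]add0r.
  by apply: measurable_comp_simple => // p; exact: ms.
apply: (cvg_comp _ _ (sv t Dt)); exact: cPhi.
Qed.

Lemma measurable_norm_sub D v a : measurable D -> strongly_measurable D v ->
  measurable_fun D (fun t => `|v t - a|).
Proof.
move=> mD; apply: (@measurable_comp_strong _ (fun _ x => `|x - a|)) => //.
by move=> t _ ; apply: (@cvg_norm _ V); apply: cvgB; [exact: cvg_id|exact: cvg_cst].
Qed.

Lemma measurable_norm_strong D v : measurable D -> strongly_measurable D v ->
  measurable_fun D (fun t => `|v t|).
Proof.
move=> mD sv; under eq_fun do rewrite -[v _]subr0; exact: measurable_norm_sub.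
Qed.

(* The values of simple functions are finite partial sums, of which there are
   countably many. *)
Lemma strong_dense_values D v : measurable D -> strongly_measurable D v ->
  exists d : nat -> V, forall t, D t -> forall e : R, 0 < e ->
    exists i, `|v t - d i| < e.
Proof.
move=> mD [s_ [ms sv]].
(* The bit mask [m] selects the entries of [s_ n] that are summed; at a point [t] the right mask
   records which of the sets contain [t]. *)
pose d i := if @unpickle (nat * bitseq)%type i is Some (n, m)
  then \sum_(p <- mask m (s_ n)) p.2 else 0.
exists d => t Dt e e0.
have /cvgrPdist_lt/(_ _ e0) [n _ /(_ n (leqnn n)) hn] := sv t Dt.
exists (pickle (n, [seq t \in p.1 | p <- s_ n])).
rewrite /d pickleK -filter_mask big_filter big_mkcond.
rewrite (eq_bigr (fun p => \1_(p.1) t *: p.2)) // => p _.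
by rewrite indicE; case: ifP; rewrite ?scale1r ?scale0r.
Qed.

(** Selecting a nearest point takes only comparisons of distances, so along a function [v] it is
    measurable as soon as the distances of [v t] to the points are. *)
Fixpoint argmin_index (d : nat -> V) k (x : V) : nat :=
  if k is k'.+1 then
    if `|x - d k| < `|x - d (argmin_index d k' x)| then k else argmin_index d k' x
  else 0.

Lemma argmin_index_le d k x i : (i <= k)%N ->
  `|x - d (argmin_index d k x)| <= `|x - d i|.
Proof.
elim: k => [|k IH] /=; first by rewrite leqn0 => /eqP ->.
rewrite leq_eqVlt => /predU1P[->|]; first by case: ltP => // /ltW.
rewrite ltnS => /IH h; case: ltP => // /ltW h'; exact: le_trans h.
Qed.

Lemma argmin_index_leq d k x : (argmin_index d k x <= k)%N.
Proof. by elim: k => //= k IH; case: ifP => // _; exact: leqW. Qed.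

(** A criterion of Pettis type: if the values lie in the closure of a countable set and the
    distances to its points are measurable, then rounding [v t] to the nearest of the first k + 1
    points gives simple functions converging to [v]. *)
Lemma strong_of_norm_sub D v (d : nat -> V) : measurable D ->
  (forall t, D t -> forall e : R, 0 < e -> exists i, `|v t - d i| < e) ->
  (forall i, measurable_fun D (fun t => `|v t - d i|)) ->
  strongly_measurable D v.
Proof.
move=> mD dv md.
pose E k i := D `&` [set t | argmin_index d k (v t) = i].
have mE k i : measurable (E k i).
  elim: k i => [|k IH] i.
    rewrite /E /=; have [->|ni] := eqVneq i 0%N.
      rewrite (_ : _ `&` _ = D) //; apply/seteqP; split => t; first by case.
      by move=> Dt; split.
    rewrite (_ : _ `&` _ = set0) //; apply/seteqP; split => t //=.
    by case=> _ i0; rewrite i0 eqxx in ni.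
  have mlt j : measurable (D `&` [set t | `|v t - d k.+1| < `|v t - d j|]).
    exact: (measurable_fun_ltr (md k.+1) (md j) mD (Y := [set true])).
  (* Either the new point k + 1 beats the previous winner j, or the previous winner i survives the
     comparison. *)
  rewrite (_ : E _ _ = \bigcup_j (E k j `&` (if i == k.+1 then
     D `&` [set t | `|v t - d k.+1| < `|v t - d j|] else set0)) `|`
     (E k i `\` (D `&` [set t | `|v t - d k.+1| < `|v t - d i|]))).
    apply: measurableU; last exact: measurableD.
    by apply: bigcupT_measurable => j; apply: measurableI => //; case: ifP.
  apply/seteqP; split => t.
    move=> [Dt /=]; case: ifP => [h <-|h <-]; [left|right].
      by exists (argmin_index d k (v t)) => //; rewrite eqxx.
    split; first by split.
    by move=> [_]; rewrite /= h.
  move=> [[j _ [[Dt /= ej]]]|[[Dt /= ej] h]].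
    by case: eqP => // -> [_]; rewrite -ej => h; split => //=; rewrite h.
  by split => //=; case: ifP; rewrite ej // => h'; exfalso; apply: h; split.
exists (fun k => [seq (E k i, d i) | i <- iota 0 k.+1]); split.
  by move=> k p /mapP[i _ ->] /=; exact: mE.
move=> t Dt.
have ev k : simple_eval [seq (E k i, d i) | i <- iota 0 k.+1] t =
    d (argmin_index d k (v t)).
  rewrite /simple_eval big_map (bigD1_seq (argmin_index d k (v t))) ?iota_uniq//=.
    rewrite big1 ?addr0 => [|i /eqP ni].
      by rewrite indicE mem_set ?scale1r.
    by rewrite indicE memNset ?scale0r // => -[_ /= /esym].
  by rewrite -/(iota 0 k.+1) mem_iota /= add0n ltnS argmin_index_leq.
under eq_fun do rewrite ev.
apply/cvgrPdist_lt => e /(dv t Dt) [i hi].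
exists i => // k /= ik; exact: le_lt_trans (argmin_index_le _ _ ik) hi.
Qed.

(** The dense sequences of all the [v_ n] together approximate the limit, and distances to a fixed
    point pass to the limit. *)
Lemma strong_cvg D (v_ : nat -> R -> V) v : measurable D ->
  (forall n, strongly_measurable D (v_ n)) ->
  (forall t, D t -> v_ n t @[n --> \oo] --> v t) -> strongly_measurable D v.
Proof.
move=> mD sv vv.
have /choice[d hd] := fun n => strong_dense_values mD (sv n).
apply: (@strong_of_norm_sub _ _ (fun i => if @unpickle (nat * nat)%type i is Some (n, m)
  then d n m else 0)) => // [t Dt e e0|i].
  have /cvgrPdist_lt/(_ _ (divr_gt0 e0 (ltr0Sn R 1))) [n _ /(_ n (leqnn n)) hn] := vv t Dt.
  have [m hm] := hd n t Dt _ (divr_gt0 e0 (ltr0Sn R 1)).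
  exists (pickle (n, m)); rewrite pickleK.
  rewrite -(subrKA (v_ n t)) (le_lt_trans (ler_normD _ _)) // [ltRHS]splitr.
  exact: ltrD.
set a := match _ with | Some _ => _ | _ => _ end.
apply: (@measurable_fun_cvg _ _ _ D
  (fun n t => `|v_ n t - a|)) => [n|t Dt]; first exact: measurable_norm_sub.
by apply: (@cvg_norm _ V); apply: cvgB; [exact: vv|exact: cvg_cst].
Qed.

Lemma measurable_nat_comp D (nu : R -> nat) (g : nat -> R) : measurable D ->
  (forall n, measurable (D `&` [set t | nu t = n])) ->
  measurable_fun D (fun t => g (nu t)).
Proof.
move=> mD mnu _ Y mY.
rewrite (_ : _ `&` _ = \bigcup_n (if g n \in Y then D `&` [set t | nu t = n] else set0)).
  by apply: bigcupT_measurable => n; case: ifP.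
apply/seteqP; split => t.
  by move=> [Dt Yt]; exists (nu t) => //; rewrite mem_set.
by move=> [n _]; case: ifPn => // /set_mem Yn [Dt /= e]; split => //=; rewrite e.
Qed.

Lemma strong_nat_comp D (nu : R -> nat) (f : nat -> V) : measurable D ->
  (forall n, measurable (D `&` [set t | nu t = n])) ->
  strongly_measurable D (fun t => f (nu t)).
Proof.
move=> mD mnu; apply: (@strong_of_norm_sub _ _ f) => //.
  by move=> t Dt e e0; exists (nu t); rewrite subrr normr0.
by move=> i; exact: (@measurable_nat_comp _ _ (fun n => `|f n - f i|)).
Qed.

Lemma strong_lin D v w k : strongly_measurable D v -> strongly_measurable D w ->
  strongly_measurable D (fun t => v t + k *: w t).
Proof.
move=> [s1 [m1 c1]] [s2 [m2 c2]].
exists (fun n => s1 n ++ scale_list k (s2 n)); split.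
  by move=> n; apply: measurable_cat; [exact: m1|apply: measurable_scale; exact: m2].
move=> t Dt; under eq_fun do rewrite simple_eval_cat simple_eval_scale.
by apply: cvgD; [exact: c1|apply: cvgZr; exact: c2].
Qed.

(** Rational multiples of a dense sequence of values of [v] approximate all products; the distances
    are measurable by the Caratheodory argument, now with [h] in the role of the parameter. *)
Lemma strong_scale D (h : R -> R) v : measurable D -> measurable_fun D h ->
  strongly_measurable D v -> strongly_measurable D (fun t => h t *: v t).
Proof.
move=> mD mh sv; have [d hd] := strong_dense_values mD sv.
apply: (@strong_of_norm_sub _ _ (fun i =>
  if @unpickle (rat * nat)%type i is Some (r, m) then ratr r *: d m else 0)) => //.
  move=> t Dt e e0.
  have e2 : 0 < e / 2 by rewrite divr_gt0.
  have p1 : 0 < e / 2 / (`|v t| + 1) by rewrite divr_gt0 // ltr_wpDl.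
  have [r] := @rat_in_itvoo R (h t) (h t + e / 2 / (`|v t| + 1)) ltac:(by rewrite ltrDl).
  rewrite in_itv/= => /andP[r1 r2].
  set q : R := ratr r in r1 r2.
  have p2 : 0 < e / 2 / (`|q| + 1) by rewrite divr_gt0 // ltr_wpDl.
  have [m hm] := hd t Dt _ p2.
  exists (pickle (r, m)); rewrite pickleK.
  rewrite -/q; clearbody q; rewrite -(subrKA (q *: v t)).
  rewrite (le_lt_trans (ler_normD _ _)) // [ltRHS]splitr.
  rewrite -scalerBl -scalerBr !normrZ; apply: ltrD.
    rewrite distrC ger0_norm ?subr_ge0 ?(ltW r1) //.
    apply: (@le_lt_trans _ _ ((q - h t) * (`|v t| + 1))).
      by rewrite ler_wpM2l ?subr_ge0 ?(ltW r1)// lerDl.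
    by rewrite -ltr_pdivlMr ?ltr_wpDl // ltrBlDl.
  apply: (@le_lt_trans _ _ ((`|q| + 1) * `|v t - d m|)).
    by rewrite ler_wpM2r // lerDl.
  by rewrite mulrC -ltr_pdivlMr // ltr_wpDl.
move=> i; set a := match _ with | Some _ => _ | _ => _ end.
apply: (@measurable_comp_strong D (fun t x => `|h t *: x - a|)) => // [x|t Dt].
  have mg : measurable_fun [set: R] (fun y : R => `|y *: x - a|).
    apply: continuous_measurable_fun => y; apply: (@cvg_norm _ V).
    by apply: cvgB; [apply: cvgZl; exact: cvg_id|exact: cvg_cst].
  exact: (measurableT_comp mg mh).
apply: (@cvg_norm _ V).
by apply: cvgB; [apply: cvgZr; exact: cvg_id|exact: cvg_cst].
Qed.

Lemma simple_eval_bounded s : exists2 M : R, 0 <= M & forall t, `|simple_eval s t| <= M.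
Proof.
elim: s => [|p s [M M0 hM]].
  by exists 0 => // t; rewrite /simple_eval big_nil normr0.
exists (`|p.2| + M); first exact: addr_ge0.
move=> t; rewrite simple_eval_cons (le_trans (ler_normD _ _)) // lerD // normrZ.
by rewrite indicE; case: (_ \in _); rewrite /= ?normr1 ?mul1r ?normr0 ?mul0r.
Qed.

Lemma measurable_norm_simple D c s : measurable D -> measurable_list s ->
  measurable_fun D (fun t => `|c + simple_eval s t|).
Proof. by move=> mD; apply: (@measurable_comp_simple D (fun _ x => `|x|)). Qed.

Lemma simple_integral_split D E s : measurable D -> measurable E ->
  (mu D < +oo)%E -> measurable_list s ->
  simple_integral D s = simple_integral (D `&` E) s + simple_integral (D `&` ~` E) s.
Proof.
move=> mD mE fD ms; rewrite /simple_integral -big_split /= big_seq [RHS]big_seq.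
apply: eq_bigr => p ps; rewrite -scalerDl; congr (_ *: _).
have mp := ms _ ps.
have fi F : measurable F -> (mu (D `&` F) < +oo)%E.
  move=> mF; apply: le_lt_trans fD; apply: le_measure; rewrite ?inE//.
  exact: measurableI.
rewrite -fineD; last 2 first.
- rewrite -setIA ge0_fin_numE ?measure_ge0 // fi//; exact: measurableI.
- rewrite -setIA ge0_fin_numE ?measure_ge0 // fi//; apply: measurableI => //.
  exact: measurableC.
congr fine; rewrite -measureU //.
- by rewrite -setIUl -setIUr setUv setIT.
- by rewrite -setIA; apply: measurableI => //; exact: measurableI.
- by rewrite -setIA; apply: measurableI => //; apply: measurableI => //; exact: measurableC.
- by rewrite setIACA [D `&` E `&` _]setIACA setICr setI0 set0I.
Qed.

(** The triangle inequality for integrals of lists with overlapping sets. The induction splits [D]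
    along the head set and adds the head value to [c] on one half, which is why both [D] and [c]
    vary. *)
Lemma simple_integral_le_shift D c s : measurable D -> (mu D < +oo)%E ->
  measurable_list s ->
  (`|fine (mu D) *: c + simple_integral D s|%:E <=
   \int[mu]_(t in D) `|c + simple_eval s t|%:E)%E.
Proof.
elim: s D c => [|p s IH] D c mD fD ms.
  rewrite /simple_integral big_nil addr0.
  under eq_integral do rewrite /simple_eval big_nil addr0.
  rewrite integral_cst // normrZ ger0_norm; last by apply: fine_ge0.
  rewrite EFinM fineK; last by rewrite ge0_fin_numE.
  by rewrite muleC.
have msp := ms; have [mp {}ms] := measurable_list_cons ms.
have m1 : measurable (D `&` p.1) by exact: measurableI.
have m2 : measurable (D `&` ~` p.1) by apply: measurableI => //; exact: measurableC.
have f1 : (mu (D `&` p.1) < +oo)%E.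
  by apply: le_lt_trans fD; apply: le_measure; rewrite ?inE.
have f2 : (mu (D `&` ~` p.1) < +oo)%E.
  by apply: le_lt_trans fD; apply: le_measure; rewrite ?inE.
rewrite (@integral_split_mem _ _ p.1) //; last first.
  exact: measurable_norm_simple.
rewrite (_ : (fine (mu D) *: c + _) =
   (fine (mu (D `&` p.1)) *: (c + p.2) + simple_integral (D `&` p.1) s) +
   (fine (mu (D `&` ~` p.1)) *: c + simple_integral (D `&` ~` p.1) s)); last first.
  rewrite simple_integral_cons (simple_integral_split mD mp fD ms).
  have -> : fine (mu D) = fine (mu (D `&` p.1)) + fine (mu (D `&` ~` p.1)).
    rewrite -fineD ?ge0_fin_numE // -measureU //.
      by rewrite -setIUr setUv setIT.
    by rewrite setIACA setICr setI0.
  rewrite scalerDl scalerDr -!addrA; congr (_ + _).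
  by rewrite [X in _ = _ + X]addrCA [RHS]addrCA.
apply: (le_trans (y := (`|fine (mu (D `&` p.1)) *: (c + p.2) + simple_integral (D `&` p.1) s|%:E
  + `|fine (mu (D `&` ~` p.1)) *: c + simple_integral (D `&` ~` p.1) s|%:E)%E)).
  by rewrite -EFinD lee_fin ler_normD.
apply: leeD.
  apply: (le_trans (IH _ _ m1 f1 ms)).
  rewrite le_eqVlt; apply/orP; left; apply/eqP; apply: eq_integral => t.
  by rewrite inE => -[_ pt]; rewrite simple_eval_if mem_set.
apply: (le_trans (IH _ _ m2 f2 ms)).
rewrite le_eqVlt; apply/orP; left; apply/eqP; apply: eq_integral => t.
by rewrite inE => -[_ pt]; rewrite simple_eval_if memNset.
Qed.

Lemma simple_integral_le D s : measurable D -> (mu D < +oo)%E -> measurable_list s ->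
  (`|simple_integral D s|%:E <= \int[mu]_(t in D) `|simple_eval s t|%:E)%E.
Proof.
move=> mD fD ms; have := simple_integral_le_shift 0 mD fD ms.
by rewrite scaler0 add0r; under eq_integral do rewrite add0r.
Qed.

Lemma strong_simple D s : measurable_list s -> strongly_measurable D (simple_eval s).
Proof. by move=> ms; exists (fun=> s); split => // t _; exact: cvg_cst. Qed.

Lemma strong_sub D v w : strongly_measurable D v -> strongly_measurable D w ->
  strongly_measurable D (fun t => v t - w t).
Proof.
move=> sv sw; under eq_fun do rewrite -scaleN1r; exact: strong_lin.
Qed.

Lemma measurable_norm_subs D v s : measurable D -> strongly_measurable D v ->
  measurable_list s -> measurable_fun D (fun t => `|v t - simple_eval s t|).
Proof.
move=> mD sv ms; apply: (@measurable_norm_strong D (fun t => v t - simple_eval s t)) => //.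
by apply: strong_sub => //; exact: strong_simple.
Qed.

Lemma strong0 D : strongly_measurable D (fun=> 0 : V).
Proof.
exists (fun=> [::]); split => // t _.
under eq_fun do rewrite /simple_eval big_nil; exact: cvg_cst.
Qed.

(** On a set of finite measure the approximating sequence can be traded for one simple function per
    tolerance, since the finiteness condition on its sets becomes automatic. *)
Lemma bochner_integralP D v x : measurable D -> (mu D < +oo)%E ->
  bochner_integral D v x <-> strongly_measurable D v /\ forall e : R, 0 < e ->
    exists s, [/\ measurable_list s,
      (\int[mu]_(t in D) `|v t - simple_eval s t|%:E < e%:E)%E &
      `|x - simple_integral D s| < e].
Proof.
move=> mD fD; split=> [[sv [s_ [ms ints cs]]]|[sv hs]]; split => //.
  move=> e e0; have h := cvge0_near_lt ints e0.
  move/cvgrPdist_lt : cs => /(_ _ e0) h2.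
  near \oo => n; exists (s_ n).
  by split; [move=> p /ms[]|near: n|near: n].
have /choice[s_ h] := fun n => hs n.+1%:R^-1 ltac:(by []).
exists s_; split.
- move=> n p pn; have [+ _ _] := h n => /(_ p pn) mp; split => //.
  by apply: le_lt_trans fD; apply: le_measure; rewrite ?inE//; exact: measurableI.
- apply: (@squeeze_cvge _ _ _ _ (fun=> 0%E) _ (fun n => n.+1%:R^-1%:E)).
  + apply: nearW => n; have [_ /ltW -> _] := h n; rewrite andbT.
    by apply: integral_ge0 => t _; rewrite lee_fin.
  + exact: cvg_cst.
  + apply/fine_cvgP; split; first exact: nearW.
    exact: cvg_harmonic.
- apply/cvgrPdist_lt => e e0.
  have := @cvg_harmonic R => /cvgrPdist_lt/(_ _ e0) [N _ hN].
  exists N => // n /hN /=; rewrite sub0r normrN ger0_norm // => hn.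
  by have [_ _ /lt_trans] := h n; apply.
Unshelve. all: by end_near. Qed.

Lemma bochner_norm_le D v x : measurable D -> (mu D < +oo)%E ->
  bochner_integral D v x -> (`|x|%:E <= \int[mu]_(t in D) `|v t|%:E)%E.
Proof.
move=> mD fD /(bochner_integralP _ _ mD fD)[sv hs]; apply/lee_addgt0Pr => e e0.
have [s [ms h1 h2]] := hs _ (divr_gt0 e0 (ltr0Sn R 1)).
apply: (le_trans (y := ((e / 2)%:E + `|simple_integral D s|%:E)%E)).
  rewrite -EFinD lee_fin -[x in leLHS](subrK (simple_integral D s)).
  by rewrite (le_trans (ler_normD _ _)) // lerD2r ltW.
have ee : (e%:E = (e / 2)%:E + (e / 2)%:E)%E by rewrite -EFinD -splitr.
rewrite ee [leRHS]addeA [leRHS]addeC leeD2l //.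
apply: (le_trans (simple_integral_le mD fD ms)).
apply: (le_trans (y := (\int[mu]_(t in D) (`|v t| + `|v t - simple_eval s t|)%:E)%E)).
  apply: le_integral_EFin => //.
  - by apply: measurable_norm_strong => //; exact: strong_simple.
  - apply: measurable_funD; first exact: measurable_norm_strong.
    exact: measurable_norm_subs.
  - move=> t _; rewrite normr_ge0 /= -[simple_eval s t in leLHS](subrK (v t)).
    by rewrite addrC (le_trans (ler_normD _ _)) // lerD2l distrC.
rewrite integralD_EFin_ge0 //; last 2 first.
- exact: measurable_norm_strong.
- exact: measurable_norm_subs.
by rewrite leeD2l // ltW.
Qed.

Lemma bochner_lin D v w x y k : measurable D -> (mu D < +oo)%E ->
  bochner_integral D v x -> bochner_integral D w y ->
  bochner_integral D (fun t => v t + k *: w t) (x + k *: y).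
Proof.
move=> mD fD /(bochner_integralP _ _ mD fD)[sv hv] /(bochner_integralP _ _ mD fD)[sw hw].
apply/(bochner_integralP _ _ mD fD); split; first exact: strong_lin.
move=> e e0; have e2 : 0 < e / 2 by exact: divr_gt0.
have k1 : 0 < `|k| + 1 by rewrite ltr_wpDl.
have ek : 0 < e / 2 / (`|k| + 1) by exact: divr_gt0.
have [s1 [m1 i1 d1]] := hv _ e2.
have [s2 [m2 i2 d2]] := hw _ ek.
exists (s1 ++ scale_list k s2); split.
- by apply: measurable_cat => //; exact: measurable_scale.
- apply: (@le_lt_trans _ _ (\int[mu]_(t in D) (`|v t - simple_eval s1 t| +
     (`|k| + 1) * `|w t - simple_eval s2 t|)%:E)%E).
    apply: le_integral_EFin => //.
    + apply: measurable_norm_subs => //; first exact: strong_lin.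
      by apply: measurable_cat => //; exact: measurable_scale.
    + apply: measurable_funD; first exact: measurable_norm_subs.
      by apply: measurable_funM => //; exact: measurable_norm_subs.
    + move=> t _; rewrite normr_ge0 /= simple_eval_cat simple_eval_scale opprD addrACA.
      rewrite -scalerBr (le_trans (ler_normD _ _)) // lerD2l normrZ.
      by rewrite ler_wpM2r // lerDl.
  rewrite integralD_EFin_ge0 //; last 2 first.
  + exact: measurable_norm_subs.
  + by apply: measurable_funM => //; exact: measurable_norm_subs.
  rewrite integralZ_EFin_ge0 //; last exact: measurable_norm_subs.
  have -> : (e%:E = (e / 2)%:E + (e / 2)%:E)%E by rewrite -EFinD -splitr.
  rewrite lteD //.
  by rewrite -lte_pdivlMl // -EFinM mulrC.
- rewrite simple_integral_cat simple_integral_scale opprD addrACA -scalerBr.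
  rewrite (le_lt_trans (ler_normD _ _)) // normrZ [ltRHS]splitr ltr_leD //.
  apply: (@le_trans _ _ ((`|k| + 1) * `|y - simple_integral D s2|)).
    by rewrite ler_wpM2r // lerDl.
  by rewrite mulrC -ler_pdivlMr // ltW.
Qed.

Lemma bochner0 D : measurable D -> (mu D < +oo)%E ->
  bochner_integral D (fun=> 0 : V) 0.
Proof.
move=> mD fD; apply/(bochner_integralP _ _ mD fD); split; first exact: strong0.
move=> e e0; exists [::]; split => //.
  under eq_integral do rewrite /simple_eval big_nil subrr normr0.
  by rewrite integral0 lte_fin.
by rewrite /simple_integral big_nil subrr normr0.
Qed.

Lemma bochnerD D v w x y : measurable D -> (mu D < +oo)%E ->
  bochner_integral D v x -> bochner_integral D w y ->
  bochner_integral D (fun t => v t + w t) (x + y).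
Proof.
move=> mD fD bv bw; have := bochner_lin 1 mD fD bv bw.
by rewrite scale1r; under eq_fun do rewrite scale1r.
Qed.

Lemma bochnerB D v w x y : measurable D -> (mu D < +oo)%E ->
  bochner_integral D v x -> bochner_integral D w y ->
  bochner_integral D (fun t => v t - w t) (x - y).
Proof.
move=> mD fD bv bw; have := bochner_lin (-1) mD fD bv bw.
by rewrite scaleN1r; under eq_fun do rewrite scaleN1r.
Qed.

Lemma bochner_sum D (v_ : nat -> R -> V) (x_ : nat -> V) n : measurable D ->
  (mu D < +oo)%E -> (forall i, bochner_integral D (v_ i) (x_ i)) ->
  bochner_integral D (fun t => \sum_(i < n) v_ i t) (\sum_(i < n) x_ i).
Proof.
move=> mD fD hv; elim: n => [|n IH].
  by rewrite big_ord0; under eq_fun do rewrite big_ord0; exact: bochner0.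
rewrite big_ord_recr /=; under eq_fun do rewrite big_ord_recr /=.
exact: bochnerD.
Qed.

Lemma bochner_eq D v w x : {in D, v =1 w} ->
  bochner_integral D v x -> bochner_integral D w x.
Proof.
move=> vw [[s_ [m c]] [s2 [m2 i2 c2]]]; split.
  by exists s_; split => // t Dt; rewrite -vw ?inE//; exact: c.
exists s2; split => //; apply: cvg_trans i2; apply: near_eq_cvg.
by near=> n; apply: eq_integral => t Dt; rewrite vw.
Unshelve. all: by end_near. Qed.

Lemma bochner_dist_le D v w x y : measurable D -> (mu D < +oo)%E ->
  bochner_integral D v x -> bochner_integral D w y ->
  (`|x - y|%:E <= \int[mu]_(t in D) `|v t - w t|%:E)%E.
Proof. by move=> mD fD bv bw; apply: bochner_norm_le => //; exact: bochnerB. Qed.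

Lemma bochner_integrable D v x : measurable D -> (mu D < +oo)%E ->
  bochner_integral D v x -> (\int[mu]_(t in D) `|v t|%:E < +oo)%E.
Proof.
move=> mD fD /(bochner_integralP _ _ mD fD)[sv /(_ 1 ltr01) [s [ms h _]]].
have [M M0 hM] := simple_eval_bounded s.
apply: (@le_lt_trans _ _ (\int[mu]_(t in D) (`|v t - simple_eval s t| + M)%:E)%E).
  apply: le_integral_EFin => //.
  - exact: measurable_norm_strong.
  - by apply: measurable_funD => //; exact: measurable_norm_subs.
  - move=> t _; rewrite normr_ge0 /= -[v t in leLHS](subrK (simple_eval s t)).
    by rewrite (le_trans (ler_normD _ _)) // lerD2l.
rewrite integralD_EFin_ge0 //; last exact: measurable_norm_subs.
rewrite integral_cst // lte_add_pinfty //; first exact: lt_trans h (ltry _).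
by rewrite lte_mul_pinfty.
Qed.

End BochnerTheory.

Section BochnerExistence.
Context {R : realType} {V : normedModType R}.
Local Notation mu := (@lebesgue_measure R).
Implicit Types (D F : set R) (s : seq (set R * V)) (v : R -> V).

Definition restrict_list F s := [seq (F `&` p.1, p.2) | p <- s].

Lemma simple_eval_restrict F s t :
  simple_eval (restrict_list F s) t = if t \in F then simple_eval s t else 0.
Proof.
rewrite /simple_eval big_map; case: ifPn => tF.
  by apply: eq_bigr => p _; rewrite !indicE in_setI tF.
by apply: big1 => p _; rewrite indicE in_setI (negbTE tF) scale0r.
Qed.

Lemma measurable_restrict_list F s : measurable F -> measurable_list s ->
  measurable_list (restrict_list F s).
Proof. by move=> mF ms p /mapP[p' p's ->] /=; apply: measurableI => //; exact: ms. Qed.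

(** Pointwise approximants need not be dominated. Each is cut to 0 where its norm exceeds twice that
    of [v]: this preserves pointwise convergence, also where [v] vanishes, and leaves the error
    below three times the norm of [v]. *)
Lemma simple_approx D v (e : R) : measurable D -> strongly_measurable D v ->
  (\int[mu]_(t in D) `|v t|%:E < +oo)%E -> 0 < e ->
  exists2 s, measurable_list s & (\int[mu]_(t in D) `|v t - simple_eval s t|%:E < e%:E)%E.
Proof.
move=> mD sv iv e0; have [s_ [ms cs]] := sv.
have mv : measurable_fun D (fun t => `|v t|) by exact: measurable_norm_strong.
pose F n := D `&` [set t | `|simple_eval (s_ n) t| <= 2 * `|v t|].
have mF n : measurable (F n).
  apply: (measurable_fun_ler (f := fun t => `|simple_eval (s_ n) t|)
    (g := fun t => 2 * `|v t|) _ _ mD (Y := [set true])) => //.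
    by apply: measurable_norm_strong => //; apply: strong_simple => p; exact: ms.
  exact: measurable_funM.
pose T n := restrict_list (F n) (s_ n).
have mT n : measurable_list (T n) by apply: measurable_restrict_list => // p; exact: ms.
have cT t : D t -> simple_eval (T n) t @[n --> \oo] --> v t.
  move=> Dt; have [v0|v0] := eqVneq (v t) 0.
    rewrite v0 (_ : (fun n => simple_eval (T n) t) = fun=> 0); first exact: cvg_cst.
    apply/funext => n; rewrite /T simple_eval_restrict.
    by case: ifPn => // /set_mem [_] /=; rewrite v0 normr0 mulr0 normr_le0 => /eqP.
  apply: cvg_trans (cs t Dt); apply: near_eq_cvg.
  have nv : 0 < `|v t| by rewrite normr_gt0.
  have /cvgrPdist_lt/(_ _ nv) h := cs t Dt.
  near=> n; rewrite /T simple_eval_restrict mem_set //; split => //=.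
  rewrite -[simple_eval _ _](subrK (v t)) (le_trans (ler_normD _ _)) //.
  rewrite mulrDl mul1r lerD2r distrC ltW //; near: n; exact: h.
have bT n t : `|v t - simple_eval (T n) t| <= 3 * `|v t|.
  rewrite (le_trans (ler_normB _ _)) // [3 * _](_ : _ = `|v t| + 2 * `|v t|); last by ring.
  rewrite lerD2l /T simple_eval_restrict.
  by case: ifPn => [/set_mem[]//|_]; rewrite normr0 mulr_ge0.
have cv : (\int[mu]_(t in D) `|v t - simple_eval (T n) t|%:E)%E @[n --> \oo] --> 0%E.
  apply: (@dominated_cvg0 _ _ _ (fun t => 3 * `|v t|)) => //.
  - by move=> n; exact: measurable_norm_subs.
  - exact: measurable_funM.
  - by move=> n t _; rewrite normr_ge0 bT.
  - by rewrite integralZ_EFin_ge0 // lte_mul_pinfty.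
  - move=> t Dt; rewrite -(normr0 V) -(subrr (v t)); apply: (@cvg_norm _ V).
    by apply: cvgB; [exact: cvg_cst|exact: cT].
have [n _ /(_ n (leqnn n)) h] := cvge0_near_lt cv e0.
by exists (T n).
Unshelve. all: by end_near. Qed.

End BochnerExistence.

Section BochnerComplete.
Context {R : realType} {V : completeNormedModType R}.
Local Notation mu := (@lebesgue_measure R).

Lemma cvg_harmonic_cauchy (x_ : nat -> V) :
  (forall k l, `|x_ k - x_ l| <= k.+1%:R^-1 + l.+1%:R^-1) ->
  exists x : V, x_ n @[n --> \oo] --> x.
Proof.
move=> h; suff : cvg (x_ n @[n --> \oo]) by move=> /cvg_ex.
apply: cauchy_cvg; apply: cauchy_exP => e e0.
have := @cvg_harmonic R => /cvgrPdist_lt/(_ _ (divr_gt0 e0 (ltr0Sn R 1))) [N _ hN].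
have hN' n : (N <= n)%N -> n.+1%:R^-1 < e / 2.
  by move=> /hN /=; rewrite sub0r normrN ger0_norm.
exists (x_ N); exists N => // n /= Nn; rewrite -ball_normE /=.
by rewrite (le_lt_trans (h _ _)) // [ltRHS]splitr ltrD // hN'.
Qed.

(** The difference of two approximants is again a list, so the triangle inequality for lists shows
    that their integrals form a Cauchy sequence. *)
Lemma bochner_exists (D : set R) (v : R -> V) : measurable D -> (mu D < +oo)%E ->
  strongly_measurable D v -> (\int[mu]_(t in D) `|v t|%:E < +oo)%E ->
  exists x, bochner_integral D v x.
Proof.
move=> mD fD sv iv.
have /choice[s_ hs] : forall n, exists s, measurable_list s /\
    (\int[mu]_(t in D) `|v t - simple_eval s t|%:E < n.+1%:R^-1%:E)%E.
  by move=> n; have [s ms hs] := @simple_approx _ _ D v n.+1%:R^-1 mD sv iv ltac:(by []);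
     exists s.
pose x_ n := simple_integral D (s_ n).
have hx k l : `|x_ k - x_ l| <= k.+1%:R^-1 + l.+1%:R^-1.
  have [mk ik] := hs k; have [ml il] := hs l.
  rewrite -lee_fin -[x_ k - _]/(simple_integral D (s_ k) - simple_integral D (s_ l)).
  rewrite -scaleN1r -simple_integral_scale -simple_integral_cat.
  have ms : measurable_list (s_ k ++ scale_list (-1) (s_ l)).
    by apply: measurable_cat => //; exact: measurable_scale.
  apply: (le_trans (simple_integral_le mD fD ms)).
  apply: (le_trans (y := (\int[mu]_(t in D) (`|v t - simple_eval (s_ k) t| +
      `|v t - simple_eval (s_ l) t|)%:E)%E)).
    apply: le_integral_EFin => //.
    - by apply: measurable_norm_strong => //; exact: strong_simple.
    - by apply: measurable_funD; exact: measurable_norm_subs.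
    - move=> t _; rewrite normr_ge0 /= simple_eval_cat simple_eval_scale scaleN1r.
      rewrite -[simple_eval (s_ k) t - _](subrKA (v t)) (le_trans (ler_normD _ _)) //.
      by rewrite lerD2r distrC.
  rewrite integralD_EFin_ge0 //; [|exact: measurable_norm_subs|exact: measurable_norm_subs].
  by rewrite EFinD leeD // ltW.
have [x cx] := cvg_harmonic_cauchy hx.
exists x; apply/(bochner_integralP _ _ mD fD); split => // e e0.
have := @cvg_harmonic R => /cvgrPdist_lt/(_ _ e0) hN.
have /cvgrPdist_lt/(_ _ e0) hc := cx.
near \oo => n; exists (s_ n); have [mn i_n] := hs n; split => //.
  apply: lt_trans i_n _; rewrite lte_fin -[ltLHS]ger0_norm // -normrN -sub0r.
  by near: n.
by near: n.
Unshelve. all: by end_near. Qed.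

End BochnerComplete.

Section BochnerLinear.
Context {R : realType} {V W : normedModType R}.
Local Notation mu := (@lebesgue_measure R).
Implicit Types (D : set R) (v : R -> V).
(** A bare map with explicit linearity and bound serves both for [emb A] and for the maps r |-> r *:
    a. *)
Variables (L : V -> W) (M : R).
Hypothesis linL : forall k x y, L (k *: x + y) = k *: L x + L y.
Hypothesis L_le : forall x, `|L x| <= M * `|x|.

Let L0 : L 0 = 0.
Proof.
have := linL 1 0 0; rewrite !scale1r addr0 => h.
by apply: (@addrI _ (L 0)); rewrite -h addr0.
Qed.

Let LB x y : L (x - y) = L x - L y.
Proof. by rewrite -scaleN1r addrC linL scaleN1r addrC. Qed.

Let map_list (s : seq (set R * V)) : seq (set R * W) := [seq (p.1, L p.2) | p <- s].

Let simple_eval_map s t : simple_eval (map_list s) t = L (simple_eval s t).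
Proof.
elim: s => [|p s IH]; first by rewrite /simple_eval !big_nil L0.
by rewrite /= !simple_eval_cons /= IH linL.
Qed.

Let simple_integral_map D s : simple_integral D (map_list s) = L (simple_integral D s).
Proof.
elim: s => [|p s IH]; first by rewrite /simple_integral !big_nil L0.
by rewrite /= !simple_integral_cons /= IH linL.
Qed.

Let L_cvg (u : nat -> V) x : u n @[n --> \oo] --> x -> L (u n) @[n --> \oo] --> L x.
Proof.
move=> /cvgrPdist_lt h; apply/cvgrPdist_lt => e e0.
have M1 : 0 < `|M| + 1 by rewrite ltr_wpDl.
have := h _ (divr_gt0 e0 M1); apply: filterS => n hn.
rewrite -LB (le_lt_trans (L_le _)) //.
apply: (@le_lt_trans _ _ ((`|M| + 1) * `|x - u n|)).
  by rewrite ler_wpM2r // (le_trans (ler_norm _)) // lerDl.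
by rewrite mulrC -ltr_pdivlMr.
Qed.

Lemma strong_linear D v : strongly_measurable D v ->
  strongly_measurable D (fun t => L (v t)).
Proof.
move=> [s_ [ms cs]]; exists (fun n => map_list (s_ n)); split.
  by move=> n p /mapP[p' /ms mp ->].
by move=> t Dt; under eq_fun do rewrite simple_eval_map; apply: L_cvg; exact: cs.
Qed.

Lemma bochner_linear D v x : measurable D -> (mu D < +oo)%E ->
  bochner_integral D v x -> bochner_integral D (fun t => L (v t)) (L x).
Proof.
move=> mD fD /(bochner_integralP _ _ mD fD)[sv hv].
apply/(bochner_integralP _ _ mD fD); split; first exact: strong_linear.
move=> e e0; have M1 : 0 < `|M| + 1 by rewrite ltr_wpDl.
have LM y : `|L y| <= (`|M| + 1) * `|y|.
  by rewrite (le_trans (L_le _)) // ler_wpM2r // (le_trans (ler_norm _)) // lerDl.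
have [s [ms hs dx]] := hv _ (divr_gt0 e0 M1).
have mm : measurable_list (map_list s) by move=> p /mapP[p' /ms mp ->].
exists (map_list s); split => //.
- apply: (@le_lt_trans _ _ (\int[mu]_(t in D) ((`|M| + 1) * `|v t - simple_eval s t|)%:E)%E).
    apply: le_integral_EFin => //.
    + by apply: measurable_norm_subs => //; exact: strong_linear.
    + by apply: measurable_funM => //; exact: measurable_norm_subs.
    + by move=> t _; rewrite normr_ge0 simple_eval_map -LB LM.
  rewrite integralZ_EFin_ge0 //; last exact: measurable_norm_subs.
  by rewrite -lte_pdivlMl // -EFinM mulrC.
- rewrite simple_integral_map -LB (le_lt_trans (LM _)) //.
  by rewrite mulrC -ltr_pdivlMr.
Qed.

End BochnerLinear.

Section BochnerScalar.
Context {R : realType}.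
Local Notation mu := (@lebesgue_measure R).
Implicit Types (D : set R) (h : R -> R).

Lemma strong_cst {V : normedModType R} D (a : V) : strongly_measurable D (fun=> a).
Proof.
exists (fun=> [:: (setT, a)]); split.
  by move=> _ p; rewrite inE => /eqP -> /=; exact: measurableT.
move=> t _; under eq_fun do rewrite /simple_eval big_seq1 indicT scale1r.
exact: cvg_cst.
Qed.

(** The values may have either sign, so integrability has to be carried through the induction
    together with the formula. *)
Lemma simple_integralE D (s : seq (set R * R^o)) : measurable D -> (mu D < +oo)%E ->
  measurable_list s ->
  mu.-integrable D (fun t => (simple_eval s t)%:E) /\
  (\int[mu]_(t in D) (simple_eval s t)%:E = (simple_integral D s)%:E)%E.
Proof.
move=> mD fD; elim: s => [|p s IH] ms.
  split.
    apply: (@eq_integrable _ _ _ mu D mD (cst 0%E)); last exact: integrable0.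
    by move=> t _; rewrite /simple_eval big_nil.
  rewrite /simple_integral big_nil; apply: integral0_eq => t _.
  by rewrite /simple_eval big_nil.
have [mp {}ms] := measurable_list_cons ms.
have [is_ Is] := IH ms.
have ip : mu.-integrable D (fun t => (\1_(p.1) t)%:E).
  apply/integrableP; split; first exact/measurable_EFinP/measurable_indic.
  under eq_integral do rewrite abse_EFin ger0_norm //.
  rewrite integral_indic //; apply: le_lt_trans fD; apply: le_measure; rewrite ?inE//.
  exact: measurableI.
have ip2 : mu.-integrable D (fun t => (p.2 : R)%:E * (\1_(p.1) t)%:E)%E.
  exact: integrableZl.
have E t : (simple_eval (p :: s) t)%:E =
    ((p.2 : R)%:E * (\1_(p.1) t)%:E + (simple_eval s t)%:E)%E.
  by rewrite simple_eval_cons -EFinM -EFinD mulrC.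
split.
  by apply: (@eq_integrable _ _ _ mu D mD
    (fun t => (p.2 : R)%:E * (\1_(p.1) t)%:E + (simple_eval s t)%:E)%E);
    [move=> t _; rewrite E|exact: integrableD].
under eq_integral do rewrite E.
rewrite integralD // Is integralZl // integral_indic // simple_integral_cons EFinD.
congr (_ + _)%E; rewrite setIC -[fine _ *: _]/(fine _ * _) EFinM fineK 1?muleC //.
rewrite ge0_fin_numE //; apply: le_lt_trans fD; apply: le_measure; rewrite ?inE//.
exact: measurableI.
Qed.

Lemma bochner_scalar D h : measurable D -> (mu D < +oo)%E ->
  measurable_fun D h -> (forall t, D t -> 0 <= h t) ->
  (\int[mu]_(t in D) (h t)%:E < +oo)%E ->
  bochner_integral (V := R^o) D h (fine (\int[mu]_(t in D) (h t)%:E)).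
Proof.
move=> mD fD mh h0 ih.
have sh : strongly_measurable (V := R^o) D h.
  have := strong_scale mD mh (strong_cst D (1 : R^o)).
  by under [X in strongly_measurable _ X]eq_fun do rewrite [_ *: _]mulr1.
have hfin : (\int[mu]_(t in D) (h t)%:E)%E \is a fin_num.
  by rewrite ge0_fin_numE // integral_ge0.
have inth : mu.-integrable D (EFin \o h).
  apply/integrableP; split; first exact/measurable_EFinP.
  by under eq_integral => t /set_mem Dt do rewrite /= ger0_norm ?h0 //.
apply/(bochner_integralP _ _ mD fD); split => // e e0.
have ih' : (\int[mu]_(t in D) `|(h t : R^o)|%:E < +oo)%E.
  by under eq_integral => t /set_mem Dt do rewrite /= ger0_norm ?h0 //.
have [s ms hs] := simple_approx mD sh ih' e0.
have [is_ Is] := simple_integralE mD fD ms.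
exists s; split => //; rewrite -lte_fin; apply: le_lt_trans hs.
rewrite -[leLHS]abse_EFin EFinB fineK // -Is -integralB //.
have mhs : measurable_fun D (fun t => (h t)%:E - (simple_eval s t)%:E)%E.
  apply/measurable_EFinP; apply: measurable_funB => //.
  rewrite (_ : simple_eval s = fun t => 0 + simple_eval s t); last first.
    by apply/funext => t; rewrite add0r.
  exact: (@measurable_comp_simple _ R^o _ (fun _ x => x)).
exact: (le_abse_integral mu mD mhs).
Qed.

Lemma bochner_scale_cst {V : normedModType R} D h (a : V) : measurable D ->
  (mu D < +oo)%E -> measurable_fun D h -> (forall t, D t -> 0 <= h t) ->
  (\int[mu]_(t in D) (h t)%:E < +oo)%E ->
  bochner_integral D (fun t => h t *: a) (fine (\int[mu]_(t in D) (h t)%:E) *: a).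
Proof.
move=> mD fD mh h0 ih.
apply: (@bochner_linear _ R^o V (fun r => r *: a) `|a| _ _ D h _ mD fD).
- by move=> k x y; rewrite scalerDl scalerA.
- by move=> x; rewrite normrZ mulrC.
- exact: bochner_scalar.
Qed.

(** The integral of a countably valued function is the series of its values weighted by the masses
    of the level sets. Through this series, identities between such vector-valued integrals reduce
    to identities between scalar masses. *)
Lemma bochner_nat_series {V : normedModType R} D h (nu : R -> nat) (f : nat -> V) x :
  measurable D -> (mu D < +oo)%E -> measurable_fun D h ->
  (forall t, D t -> 0 <= h t) ->
  (forall n, measurable (D `&` [set t | nu t = n])) ->
  bochner_integral D (fun t => h t *: f (nu t)) x ->
  \sum_(i < n) fine (\int[mu]_(t in D) (h t * (nu t == i)%:R)%:E) *: f i
    @[n --> \oo] --> x.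
Proof.
move=> mD fD mh h0 mnu bx.
have ifin := bochner_integrable mD fD bx.
have mnui i : measurable_fun D (fun t => (nu t == i)%:R : R).
  exact: (@measurable_nat_comp _ _ nu (fun n => (n == i)%:R)).
have mhi i : measurable_fun D (fun t => h t * (nu t == i)%:R).
  exact: measurable_funM.
have hi0 i t : D t -> 0 <= h t * (nu t == i)%:R.
  by move=> /h0 ht; rewrite mulr_ge0.
have mhf : measurable_fun D (fun t => `|h t *: f (nu t)|).
  by apply: measurable_norm_strong => //; case: bx.
have bi i : bochner_integral D (fun t => (h t * (nu t == i)%:R) *: f i)
    (fine (\int[mu]_(t in D) (h t * (nu t == i)%:R)%:E) *: f i).
  (* The level set of a zero value may have infinite mass. For a nonzero value, dividing by its norm
     bounds the mass by the finite integral of the norm of the integrand. *)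
  have [->|fi0] := eqVneq (f i) 0.
    rewrite scaler0; under [X in bochner_integral _ X]eq_fun do rewrite scaler0.
    exact: bochner0.
  apply: bochner_scale_cst => //; first exact: hi0.
  apply: (@le_lt_trans _ _ (\int[mu]_(t in D) (`|f i|^-1 * `|h t *: f (nu t)|)%:E)%E).
    apply: le_integral_EFin => //; first exact: measurable_funM.
    move=> t Dt; rewrite hi0 //=; case: eqP => [nui|_]; last by rewrite mulr0 mulr_ge0.
    rewrite mulr1 normrZ (ger0_norm (h0 _ Dt)) nui mulrCA mulVf ?mulr1 //.
    by rewrite normr_eq0.
  by rewrite integralZ_EFin_ge0 // lte_mul_pinfty.
pose S n t := \sum_(i < n) (h t * (nu t == i)%:R) *: f i.
have SE n t : S n t = if (nu t < n)%N then h t *: f (nu t) else 0.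
  rewrite /S; case: ltnP => nt.
    rewrite (bigD1 (Ordinal nt)) //= eqxx mulr1 big1 ?addr0 // => j.
    rewrite -val_eqE /= eq_sym => /negbTE ->; by rewrite mulr0 scale0r.
  apply: big1 => j _; rewrite gtn_eqF ?mulr0 ?scale0r //.
  exact: leq_trans (ltn_ord j) nt.
have bS n := bochner_sum n mD fD bi.
have mS n : measurable_fun D (fun t => `|h t *: f (nu t) - S n t|).
  apply: measurable_norm_strong => //; apply: strong_sub; first by case: bx.
  by case: (bS n).
have cv : (\int[mu]_(t in D) `|h t *: f (nu t) - S n t|%:E)%E @[n --> \oo] --> 0%E.
  apply: (@dominated_cvg0 _ _ _ (fun t => `|h t *: f (nu t)|)) => //.
    move=> n t _; rewrite normr_ge0 SE.
    by case: ifP => _; rewrite ?subrr ?normr0 ?subr0 /=.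
  move=> t Dt; apply: (@cvg_near_cst _ R^o); exists (nu t).+1 => //= n /= tn.
  by rewrite SE tn subrr normr0.
apply/cvgrPdist_lt => e e0.
have := cvge0_near_lt cv e0; apply: filterS => n hn.
rewrite -lte_fin; apply: le_lt_trans hn.
exact: (bochner_dist_le mD fD bx (bS n)).
Qed.

End BochnerScalar.

(** * The substitution s = t ^ 2 *)

Section SquareSubstitution.
Context {R : realType}.
Local Notation mu := (@lebesgue_measure R).
Implicit Types (A : set R) (psi : R -> R).

Lemma integral_oc_derive (F f : R -> R) (a b : R) : a < b ->
  (forall x, a <= x <= b -> is_derive x 1 F (f x)) ->
  (forall x, a <= x <= b -> {for x, continuous f}) ->
  (\int[mu]_(x in `]a, b]) (f x)%:E = (F b - F a)%:E)%E.
Proof.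
move=> ab dF cf.
have cF x : a <= x <= b -> {for x, continuous F}.
  move=> /dF dFx; apply: differentiable_continuous; apply/derivable1_diffP.
  exact: ex_derive.
rewrite integral_itv_obnd_cbnd; last first.
  apply/measurable_EFinP; apply: subspace_continuous_measurable_fun => //.
  apply: continuous_in_subspaceT => x; rewrite inE /= in_itv /= => /andP[xa xb].
  by apply: cf; rewrite ltW.
rewrite EFinB; apply: continuous_FTC2 => //.
- by apply: continuous_in_subspaceT => x; rewrite inE /= in_itv /=; exact: cf.
- split.
  + move=> x; rewrite in_itv /= => /andP[xa xb].
    by have := dF x; rewrite !ltW // => /(_ isT) ?; exact: ex_derive.
  + by apply: cvg_at_right_filter; apply: cF; rewrite lexx ltW.
  + by apply: cvg_at_left_filter; apply: cF; rewrite lexx ltW.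
- move=> x; rewrite in_itv /= => /andP[xa xb]; rewrite derive1E.
  by have := dF x; rewrite !ltW // => /(_ isT) ?; exact: derive_val.
Qed.

Lemma integral_oc_double (a b : R) : a < b ->
  (\int[mu]_(x in `]a, b]) (2 * x)%:E = (b ^+ 2 - a ^+ 2)%:E)%E.
Proof.
move=> ab; apply: (@integral_oc_derive (fun x => x ^+ 2)) => // x _.
  by apply: is_derive_eq; rewrite /GRing.scale /=; ring.
by apply: cvgM; [exact: cvg_cst|exact: cvg_id].
Qed.

Lemma sqrt_le_sqr (s b : R) : 0 <= s -> 0 <= b -> (Num.sqrt s <= b) = (s <= b ^+ 2).
Proof.
by move=> s0 b0; rewrite -[b in LHS](ger0_norm b0) -sqrtr_sqr ler_sqrt ?sqr_ge0.
Qed.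

Lemma sqr_lt_sqrt (s a : R) : 0 <= s -> 0 <= a -> (a < Num.sqrt s) = (a ^+ 2 < s).
Proof. by move=> s0 a0; rewrite !ltNge sqrt_le_sqr. Qed.

Lemma measurable_sqrt_preimage A : measurable A -> measurable (Num.sqrt @^-1` A).
Proof.
move=> mA; rewrite -[X in measurable X]setTI.
by apply: (continuous_measurable_fun (@sqrt_continuous R)).
Qed.

(** Both sides are finite measures in [A] that agree on the half-open intervals, so a Dynkin class
    argument extends the equality to Borel sets. *)
Lemma measure_sqrt_preimage A : measurable A ->
  mu (`]0, 1] `&` Num.sqrt @^-1` A) = (\int[mu]_(t in `]0%R, 1%R] `&` A) (2 * t)%:E)%E.
Proof.
pose m (A : set R) := mu (`]0, 1] `&` Num.sqrt @^-1` A).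
pose w (A : set R) := (\int[mu]_(t in `]0%R, 1%R] `&` A) (2 * t)%:E)%E.
have m2 D : measurable D -> measurable_fun D (fun t : R => 2 * t).
  by move=> mD; apply: measurable_funM => //; exact: measurable_id.
have Poc (a b : R) : m `]a, b]%classic = w `]a, b]%classic.
  (* The interval is clipped to ]0, 1], where squaring is increasing; the result may be empty, which
     is the second case below. *)
  pose a' := Num.max 0 a; pose b' := Num.min b 1.
  have a'0 : 0 <= a' by rewrite le_max lexx.
  have E : `]0, 1] `&` `]a, b] = `]a', b']%classic :> set R.
    apply/seteqP; split => t; rewrite /= !in_itv /= gt_max le_min.
      by move=> [/andP[-> ->] /andP[-> ->]].
    by move=> /andP[/andP[-> ->] /andP[-> ->]].
  rewrite /w E; have [ab|ba] := ltP a' b'.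
    have b'0 := le_lt_trans a'0 ab.
    rewrite integral_oc_double // /m.
    rewrite (_ : _ `&` _ = `](a' ^+ 2), (b' ^+ 2)]%classic).
      by rewrite lebesgue_measure_itv /= lte_fin ltrXn2r // ?ltW // ab -EFinB.
    have -> : Num.sqrt @^-1` `]a, b] = [set s | a < Num.sqrt s <= b] :> set R.
      by apply/seteqP; split => s /=; rewrite in_itv.
    apply/seteqP; split => s /=; rewrite !in_itv /=.
      move=> [/andP[s0 s1] /andP[sa sb]]; rewrite -sqr_lt_sqrt ?(ltW s0) // gt_max.
      rewrite sqrtr_gt0 s0 sa /= -sqrt_le_sqr ?(ltW s0) ?(ltW b'0) // le_min sb.
      by rewrite -sqrtr1 ler_sqrt.
    have s0' : a' ^+ 2 < s -> 0 < s by move/(le_lt_trans (sqr_ge0 _)).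
    move=> /andP[sa sb]; have s0 := s0' sa; move: sa sb.
    rewrite -sqr_lt_sqrt ?(ltW s0) // gt_max => /andP[_ ->].
    rewrite -sqrt_le_sqr ?(ltW s0) ?(ltW b'0) // le_min => /andP[-> ].
    by rewrite -{1}sqrtr1 ler_sqrt // => ->; rewrite s0.
  have -> : `]a', b']%classic = set0 :> set R by rewrite set_itv_ge // bnd_simp -leNgt.
  rewrite integral_set0 /m.
  rewrite (_ : _ `&` _ = set0) ?measure0 //; apply/seteqP; split => // s /=.
  rewrite !in_itv /= => -[/andP[s0 s1] /andP[sa sb]].
  have : a' < b'.
    by rewrite gt_max !lt_min (lt_le_trans sa sb) (lt_le_trans _ sb) ?sqrtr_gt0 //= ltr01
      (lt_le_trans sa) // -sqrtr1 ler_sqrt.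
  by rewrite ltNge ba.
(* Finiteness of the total mass allows the subtraction in the complement step. *)
have finm : m setT = w setT /\ (w setT < +oo)%E.
  have E : m setT = m `]0, 1]%classic /\ w setT = w `]0, 1]%classic.
    rewrite /w setIT setIid; split => //; rewrite /m preimage_setT setIT.
    congr (mu _); apply/seteqP; split => s /=; rewrite !in_itv /=; last by case.
    by move=> /andP[s0 s1]; rewrite s0 s1 sqrtr_gt0 s0 -sqrtr1 ler_sqrt.
  rewrite E.1 E.2 Poc; split => //.
  by rewrite /w setIid integral_oc_double // ltry.
have mI1 : measurable (`]0, 1]%classic : set R) by exact: measurable_itv.
have w_ge0 B : (forall t, (`]0, 1] `&` B) t -> (0 <= (2 * t)%:E)%E).
  by move=> t [/=]; rewrite in_itv /= => /andP[t0 _] _; rewrite lee_fin mulr_ge0 // ltW.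
suff P : forall S, <<s @ocitv R >> S -> m S = w S.
  by move=> mA; exact: P.
apply: (@dynkin_induction _ (measurableTypeR R)) => //.
- exact: ocitvI.
- exact: finm.1.
- by move=> _ [[a b] _ <-].
- move=> S mS PS.
  have mS' : measurable (S : set R) by [].
  have mI (B : set R) : measurable B -> measurable (`]0, 1] `&` Num.sqrt @^-1` B : set R).
    by move=> mB; apply: measurableI => //; exact: measurable_sqrt_preimage.
  have Em : (m setT = m S + m (~` S))%E.
    rewrite /m -measureU //.
    + by rewrite -setIUr -preimage_setU setUv.
    + exact: mI.
    + by apply: mI; exact: measurableC.
    + by rewrite -setIIr -preimage_setI setICr preimage_set0 setI0.
  have Ew : (w setT = w S + w (~` S))%E.
    rewrite /w -ge0_integral_setU //.
    + by rewrite -setIUr setUv.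
    + exact: measurableI.
    + by apply: measurableI => //; exact: measurableC.
    + by rewrite -setIUr setUv setIT; apply/measurable_EFinP; exact: m2.
    + by rewrite -setIUr; exact: w_ge0.
    + by apply/disj_set2P; rewrite -setIIr setICr setI0.
  have wS0 : (0 <= w S)%E by apply: integral_ge0; exact: w_ge0.
  have wC0 : (0 <= w (~` S))%E by apply: integral_ge0; exact: w_ge0.
  have fS : w S \is a fin_num.
    rewrite ge0_fin_numE //; apply: le_lt_trans finm.2.
    by rewrite Ew leeDl.
  move: Em; rewrite finm.1 Ew PS => /esym.
  by move=> /(congr1 (fun z => z - w S)%E); rewrite [X in (X - _)%E = _]addeC addeK //
    [X in (_ = X - _)%E]addeC addeK.
- move=> F mF tF PF.
  have mF' n : measurable (F n : set R) by exact: mF.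
  rewrite /m preimage_bigcup setI_bigcupr measure_bigcup //; last 2 first.
  + by move=> n _; apply: measurableI => //; exact: measurable_sqrt_preimage.
  + by apply: trivIset_setIl; move=> i j _ _ [s [Fi Fj]]; apply: tF => //; exists (Num.sqrt s).
  rewrite /w setI_bigcupr ge0_integral_bigcup //.
  + congr (limn _); apply/funext => n; apply: eq_big => [i|i _]; last exact: PF.
    by rewrite in_setT.
  + by move=> n; apply: measurableI.
  + by apply/measurable_EFinP; apply: m2; apply: bigcupT_measurable => n; exact: measurableI.
  + by move=> t; rewrite -setI_bigcupr; exact: w_ge0.
  + exact: trivIset_setIl.
Qed.

End SquareSubstitution.

Section SquareSubstitutionIntegral.
Context {R : realType}.
Local Notation mu := (@lebesgue_measure R).
Implicit Types (A : set R).
Local Notation I := (`]0, 1]%classic : set R).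
Import HBNNSimple.

Let mI : measurable I. Proof. exact: measurable_itv. Qed.

Lemma integral_sqrt_nnsfun (g : {nnsfun R >-> R}) :
  (\int[mu]_(s in I) (g (Num.sqrt s))%:E = \int[mu]_(t in I) (g t * (2 * t))%:E)%E.
Proof.
have sqrtm : measurable_fun setT (@Num.sqrt R).
  by apply: continuous_measurable_fun; exact: sqrt_continuous.
have mgA k : measurable (g @^-1` [set k]) by [].
have m1 k : measurable_fun I (fun s => \1_(g @^-1` [set k]) (Num.sqrt s) : R).
  apply: (measurableT_comp (measurable_indic (mgA k))).
  exact: measurable_funS sqrtm.
transitivity (\sum_(k \in range g)
    \int[mu]_(s in I) (k * \1_(g @^-1` [set k]) (Num.sqrt s))%:E)%E.
  under eq_integral do rewrite fimfunE -fsumEFin//.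
  rewrite ge0_integral_fsum//.
  - by move=> k; apply/measurable_EFinP; apply: measurable_funM; [exact: measurable_cst|exact: m1].
  - by move=> k s _; rewrite nnfun_muleindic_ge0.
have gE t : (g t * (2 * t))%:E =
    (\sum_(k \in range g) (k * \1_(g @^-1` [set k]) t * (2 * t))%:E)%E.
  rewrite {1}fimfunE EFinM -fsumEFin// ge0_mule_fsuml.
    by apply: eq_fsbigr => k _; rewrite -EFinM.
  by move=> k; rewrite nnfun_muleindic_ge0.
under [RHS]eq_integral do rewrite gE.
rewrite ge0_integral_fsum//.
- apply: eq_fsbigr => k; rewrite inE => -[t _ gt].
  have k0 : 0 <= k by rewrite -gt.
  under [RHS]eq_integral do rewrite -mulrA.
  rewrite !integralZ_EFin_ge0 //.
  + congr (_ * _)%E.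
    transitivity (mu (I `&` Num.sqrt @^-1` (g @^-1` [set k]))).
      rewrite setIC -integral_indic //; last exact: measurable_sqrt_preimage.
    rewrite measure_sqrt_preimage //.
    rewrite integral_mkcondr; apply: eq_integral => s _.
    by rewrite patchE indicE; case: ifP; rewrite ?mul1r ?mul0r.
  + apply: measurable_funM => //; apply: measurable_funM => //.
  + by move=> s; rewrite /= in_itv /= => /andP[s0 _]; rewrite !mulr_ge0 // ltW.
- move=> k; apply/measurable_EFinP; apply: measurable_funM; last by apply: measurable_funM.
  by apply: measurable_funM; [exact: measurable_cst|exact: measurable_indic (mgA k)].
- move=> k s; rewrite /= in_itv /= => /andP[s0 _].
  rewrite EFinM mule_ge0 ?nnfun_muleindic_ge0// lee_fin mulr_ge0 // ltW //.
Qed.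

Lemma integral_sqrt_double (psi : R -> R) : measurable_fun setT psi ->
  (forall t, 0 <= psi t) ->
  (\int[mu]_(s in I) (psi (Num.sqrt s))%:E = \int[mu]_(t in I) (psi t * (2 * t))%:E)%E.
Proof.
move=> mpsi psi0.
have sqrtm : measurable_fun setT (@Num.sqrt R).
  by apply: continuous_measurable_fun; exact: sqrt_continuous.
have mE : measurable_fun setT (EFin \o psi) by exact/measurable_EFinP.
pose g := nnsfun_approx measurableT mE.
have cg t : (g n t)%:E @[n --> \oo] --> (psi t)%:E.
  by apply: (@cvg_nnsfun_approx _ _ _ _ measurableT _ mE) => // s _; rewrite lee_fin.
have nd n m t : (n <= m)%N -> g n t <= g m t.
  by move=> nm; have /lefP := nd_nnsfun_approx measurableT mE nm; apply.
have c1 : (\int[mu]_(s in I) (g n (Num.sqrt s))%:E)%E @[n --> \oo] -->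
    (\int[mu]_(s in I) (psi (Num.sqrt s))%:E)%E.
  apply: (@monotone_cvg_integral _ _ (fun n s => g n (Num.sqrt s))) => //.
  - move=> n; apply: (@measurableT_comp _ _ _ _ _ _ (g n)) => //.
    exact: measurable_funS sqrtm.
  - by move=> s n m _ nm; rewrite nd.
  - by move=> s _; have /fine_cvgP[] := cg (Num.sqrt s).
have c2 : (\int[mu]_(t in I) (g n t * (2 * t))%:E)%E @[n --> \oo] -->
    (\int[mu]_(t in I) (psi t * (2 * t))%:E)%E.
  apply: (@monotone_cvg_integral _ _ (fun n t => g n t * (2 * t))) => //.
  - move=> n; apply: measurable_funM; last by apply: measurable_funM.
    by apply: measurable_funTS.
  - by move=> n s; rewrite /= in_itv /= => /andP[s0 _]; rewrite !mulr_ge0 // ltW.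
  - move=> s n m; rewrite /= in_itv /= => /andP[s0 _] nm.
    by rewrite ler_wpM2r ?nd // mulr_ge0 // ltW.
  - by move=> t _; apply: cvgM; [have /fine_cvgP[] := cg t|exact: cvg_cst].
apply: (cvg_unique _ c1); first exact: ereal_hausdorff.
suff -> : (fun n => \int[mu]_(s in I) (g n (Num.sqrt s))%:E)%E =
  (fun n => \int[mu]_(t in I) (g n t * (2 * t))%:E)%E by exact: c2.
by apply/funext => n; exact: integral_sqrt_nnsfun.
Qed.

Lemma integral_sqrt (phi : R -> R) : measurable_fun I phi ->
  (forall t, I t -> 0 <= phi t) ->
  (\int[mu]_(s in I) (s^-1 * phi (Num.sqrt s))%:E =
   2%:E * \int[mu]_(t in I) (t^-1 * phi t)%:E)%E.
Proof.
move=> mphi phi0.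
(* Dividing by t^2 puts the weight 1/s inside the composition with the square root, and the density
   2t then leaves the weight 2/t. Restriction to ]0, 1] makes [psi] nonnegative and measurable on
   the whole line. *)
pose psi := (fun t => (t^-1) ^+ 2 * phi t) \_ I.
have minv : measurable_fun I (fun t : R => t^-1).
  apply: subspace_continuous_measurable_fun => //; apply: continuous_in_subspaceT => t.
  rewrite inE /= in_itv /= => /andP[t0 _]; apply: inv_continuous; exact: lt0r_neq0.
have mpsi : measurable_fun setT psi.
  apply/(measurable_restrictT _ mI); apply: measurable_funM => //.
  exact: measurable_funX.
have psi0 t : 0 <= psi t.
  rewrite /psi patchE; case: ifPn => // /set_mem It.
  by rewrite mulr_ge0 ?sqr_ge0 ?phi0.
have := integral_sqrt_double mpsi psi0.
rewrite (_ : (\int[mu]_(s in I) (psi (Num.sqrt s))%:E)%E =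
  (\int[mu]_(s in I) (s^-1 * phi (Num.sqrt s))%:E)%E); last first.
  apply: eq_integral => s; rewrite inE /= in_itv /= => /andP[s0 s1].
  rewrite /psi patchE mem_set; last by rewrite /= in_itv /= sqrtr_gt0 s0 -sqrtr1 ler_sqrt.
  by rewrite exprVn sqr_sqrtr // ltW.
move=> ->; rewrite -integralZ_EFin_ge0 //.
- apply: eq_integral => t It; move: (It); rewrite inE /= in_itv /= => /andP[t0 t1].
  congr (_%:E); rewrite /psi patchE It; field; exact: lt0r_neq0.
- exact: measurable_funM.
- move=> t It; move: (It); rewrite /= in_itv /= => /andP[t0 t1].
  by rewrite mulr_ge0 ?phi0 // invr_ge0 ltW.
Qed.

End SquareSubstitutionIntegral.

(** * J-representations *)

Section JFunctional.
Context {R : realType} {A : ordered_pair R}.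
Local Notation mu := (@lebesgue_measure R).
Local Notation I := (`]0, 1]%classic : set R).
Implicit Types (a b : sp1 A) (t : R).

Lemma Jfun_ge0 a t : 0 <= Jfun a t.
Proof. by rewrite /Jfun le_max normr_ge0. Qed.

Lemma emb_le_Jfun a t : `|emb A a| <= Jfun a t.
Proof. by rewrite /Jfun le_max lexx. Qed.

Lemma norm_le_Jfun a t : t * `|a| <= Jfun a t.
Proof. by rewrite /Jfun le_max lexx orbT. Qed.

Lemma Jfun_le a t k : `|emb A a| <= k -> t * `|a| <= k -> Jfun a t <= k.
Proof. by move=> h1 h2; rewrite /Jfun ge_max h1. Qed.

Lemma Jfun_le_norm a t : 0 <= t <= 1 -> Jfun a t <= `|a|.
Proof.
by move=> /andP[t0 t1]; apply: Jfun_le; [exact: emb_le|rewrite ler_piMl].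
Qed.

Lemma JfunD a b t : 0 <= t -> Jfun (a + b) t <= Jfun a t + Jfun b t.
Proof.
move=> t0; apply: Jfun_le.
  by rewrite linearD (le_trans (ler_normD _ _)) // lerD ?emb_le_Jfun.
rewrite (le_trans (ler_wpM2l t0 (ler_normD _ _))) // mulrDr.
by rewrite lerD ?norm_le_Jfun.
Qed.

Lemma JfunZ k a t : Jfun (k *: a) t = `|k| * Jfun a t.
Proof. by rewrite /Jfun linearZ /= !normrZ mulrCA maxr_pMr. Qed.

Lemma Jfun0 t : Jfun (0 : sp1 A) t = 0.
Proof. by rewrite /Jfun linear0 !normr0 mulr0 maxxx. Qed.

Lemma Jfun_mono a s t : s <= t -> Jfun a s <= Jfun a t.
Proof.
move=> st; apply: Jfun_le; first exact: emb_le_Jfun.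
by rewrite (le_trans _ (norm_le_Jfun _ _)) // ler_wpM2r.
Qed.

Lemma Jfun_sum (u : nat -> sp1 A) n t : 0 <= t ->
  Jfun (\sum_(i < n) u i) t <= \sum_(i < n) Jfun (u i) t.
Proof.
move=> t0; elim: n => [|n IH]; first by rewrite !big_ord0 Jfun0.
by rewrite !big_ord_recr /= (le_trans (JfunD _ _ t0)) // lerD2r.
Qed.

Lemma continuous_Jfun t : continuous (fun a => Jfun a t).
Proof.
move=> a; rewrite /Jfun; apply: (@continuous_max _ _ (fun a => `|emb A a|) (fun a => t * `|a|)).
  by apply: (@cvg_norm _ (sp0 A)); exact: emb_continuous.
by apply: cvgM; [exact: cvg_cst|apply: (@cvg_norm _ (sp1 A)); exact: cvg_id].
Qed.

Lemma measurable_Jfun (D : set R) (u : R -> sp1 A) : measurable D ->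
  strongly_measurable D u -> measurable_fun D (fun t => Jfun (u t) t).
Proof.
move=> mD; apply: (@measurable_comp_strong _ _ _ (fun t a => Jfun a t)) => //.
  move=> a; apply: measurable_maxr => //.
  by apply: measurable_funM.
by move=> t _; exact: continuous_Jfun.
Qed.

Lemma emb_lin k (a b : sp1 A) : emb A (k *: a + b) = k *: emb A a + emb A b.
Proof. by rewrite linearP. Qed.

Lemma emb_le1 (a : sp1 A) : `|emb A a| <= 1 * `|a|.
Proof. by rewrite mul1r emb_le. Qed.

Lemma strong_emb (D : set R) (u : R -> sp1 A) : strongly_measurable D u ->
  strongly_measurable D (fun t => emb A (u t)).
Proof. exact: (strong_linear emb_lin emb_le1). Qed.

Lemma measurable_I : measurable I. Proof. exact: measurable_itv. Qed.

Lemma measure_I_lty : (mu I < +oo)%E.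
Proof. by rewrite lebesgue_measure_itv /= lte_fin ltr01 oppr0 adde0 ltry. Qed.

Lemma measurable_inv_sub (D : set R) : measurable D -> D `<=` [set t | 0 < t] ->
  measurable_fun D (fun t : R => t^-1).
Proof.
move=> mD D0; apply: subspace_continuous_measurable_fun => //.
apply: continuous_in_subspaceT => t /set_mem /D0 t0.
by apply: inv_continuous; exact: lt0r_neq0.
Qed.

Lemma I_gt0 t : I t -> 0 < t.
Proof. by rewrite /= in_itv /= => /andP[]. Qed.

Lemma I_le1 t : I t -> t <= 1.
Proof. by rewrite /= in_itv /= => /andP[]. Qed.

Lemma measurable_inv_I : measurable_fun I (fun t : R => t^-1).
Proof. by apply: measurable_inv_sub; [exact: measurable_I|exact: I_gt0]. Qed.

Lemma strong_weight_emb (u : R -> sp1 A) : strongly_measurable I u ->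
  strongly_measurable I (fun t => t^-1 *: emb A (u t)).
Proof.
move=> su; apply: strong_scale; [exact: measurable_I|exact: measurable_inv_I|].
exact: strong_emb.
Qed.

Lemma norm_weight (V : normedModType R) (x : V) t : I t -> `|t^-1 *: x| = t^-1 * `|x|.
Proof. by move=> /I_gt0 t0; rewrite normrZ ger0_norm // invr_ge0 ltW. Qed.

End JFunctional.

(** * Passage between ]0, 1[ and ]0, 1] *)

Section EndpointIndependence.
Context {R : realType} {V : normedModType R}.
Local Notation mu := (@lebesgue_measure R).
Local Notation I := (`]0, 1]%classic : set R).
Local Notation O := (`]0, 1[%classic : set R).

Lemma strong_subset (D E : set R) (v : R -> V) : D `<=` E ->
  strongly_measurable E v -> strongly_measurable D v.
Proof. by move=> DE [s_ [ms cs]]; exists s_; split => // t /DE; exact: cs. Qed.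

(** Convergence is required at every point, so the value at 1 is inserted as a term supported on the
    singleton of 1, after the approximants have been confined to the open interval. *)
Lemma strong_oo_oc (v : R -> V) : strongly_measurable O v -> strongly_measurable I v.
Proof.
move=> [s_ [ms cs]].
exists (fun n => restrict_list O (s_ n) ++ [:: ([set 1], v 1)]); split.
  move=> n; apply: measurable_cat.
    by apply: measurable_restrict_list; [exact: measurable_itv|exact: ms].
  by move=> p; rewrite inE => /eqP -> /=; exact: measurable_set1.
move=> t It; under eq_fun do rewrite simple_eval_cat simple_eval_restrict
  [simple_eval [:: _] _]/simple_eval big_seq1 /= indicE.
have [->|t1] := eqVneq t 1.
  have -> : ((1 : R) \in [set 1 : R]) = true by exact: mem_set.
  have -> : ((1 : R) \in O) = false.
    by apply: memNset; rewrite /= in_itv /= ltxx andbF.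
  by under eq_fun do rewrite scale1r add0r; exact: cvg_cst.
have Ot : O t.
  by move: It; rewrite /= !in_itv /= [t < 1]lt_neqAle t1 => /andP[-> ->].
have -> : (t \in O) = true by exact: mem_set.
have -> : (t \in [set 1 : R]) = false by apply: memNset => /eqP; rewrite (negbTE t1).
under eq_fun do rewrite scale0r addr0.
exact: cs.
Qed.

Lemma integral_oo_oc (f : R -> R) : measurable_fun O f ->
  (\int[mu]_(t in O) (f t)%:E = \int[mu]_(t in I) (f t)%:E)%E.
Proof. by move=> mf; apply: integral_itv_bndo_bndc; exact/measurable_EFinP. Qed.

Lemma simple_integral_oo_oc (s : seq (set R * V)) : measurable_list s ->
  simple_integral O s = simple_integral I s.
Proof.
move=> ms; rewrite /simple_integral big_seq [RHS]big_seq; apply: eq_bigr => p ps.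
have mp := ms _ ps; congr (fine _ *: _); rewrite setIC [in RHS]setIC.
by rewrite -!integral_indic //; apply: integral_oo_oc; exact: measurable_indic.
Qed.

Lemma bochner_oo_oc (v : R -> V) x : bochner_integral O v x <-> bochner_integral I v x.
Proof.
have mO : measurable O by exact: measurable_itv.
have mI : measurable I by exact: measurable_itv.
have OI : O `<=` I by move=> t; rewrite /= !in_itv /= => /andP[-> /ltW ->].
have fI : (mu I < +oo)%E by exact: measure_I_lty.
have fO : (mu O < +oo)%E by apply: le_lt_trans fI; apply: le_measure; rewrite ?inE.
split=> [/(bochner_integralP _ _ mO fO)|/(bochner_integralP _ _ mI fI)] [sv hv].
  apply/(bochner_integralP _ _ mI fI); split=> [|e e0]; first exact: strong_oo_oc.
  have [s [ms i1 i2]] := hv e e0; exists s; split => //.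
    by rewrite -integral_oo_oc //; exact: measurable_norm_subs.
  by rewrite -simple_integral_oo_oc.
have sv' := strong_subset OI sv.
apply/(bochner_integralP _ _ mO fO); split=> [//|e e0].
have [s [ms i1 i2]] := hv e e0; exists s; split => //.
  by rewrite integral_oo_oc //; exact: measurable_norm_subs.
by rewrite simple_integral_oo_oc.
Qed.

End EndpointIndependence.

Lemma strong_sum (R : realType) (V : normedModType R) (D : set R)
  (v_ : nat -> R -> V) n : (forall i, strongly_measurable D (v_ i)) ->
  strongly_measurable D (fun t => \sum_(i < n) v_ i t).
Proof.
move=> sv; elim: n => [|n IH].
  rewrite (_ : (fun _ => _) = fun=> 0); first exact: strong0.
  by apply/funext => t; rewrite big_ord0.
rewrite (_ : (fun _ => _) = fun t => \sum_(i < n) v_ i t + 1 *: v_ n t).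
  exact: strong_lin.
by apply/funext => t; rewrite big_ord_recr scale1r.
Qed.

(** * Calculus of representations by integrals for dt/t *)

Section Representations.
Context {R : realType} {A : ordered_pair R}.
Local Notation mu := (@lebesgue_measure R).
Local Notation I := (`]0, 1]%classic : set R).
Local Notation O := (`]0, 1[%classic : set R).
Implicit Types (u : R -> sp1 A) (x : sp0 A).

Lemma represents_oo_oc u x : represents O u x <-> represents I u x.
Proof.
have OI : O `<=` I by move=> t; rewrite /= !in_itv /= => /andP[-> /ltW ->].
split=> -[su /bochner_oo_oc bu]; split => //; first exact: strong_oo_oc.
exact: strong_subset su.
Qed.

Lemma represents_lin u v x y k : represents I u x -> represents I v y ->
  represents I (fun t => u t + k *: v t) (x + k *: y).
Proof.
move=> [su bu] [sv bv]; split; first exact: strong_lin.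
have := bochner_lin k measurable_I measure_I_lty bu bv.
apply: bochner_eq => t _.
by rewrite [u t + _]addrC emb_lin addrC scalerDr !scalerA mulrC.
Qed.

Lemma represents_exists u : strongly_measurable I u ->
  (\int[mu]_(t in I) (t^-1 * `|emb A (u t)|)%:E < +oo)%E -> exists x, represents I u x.
Proof.
move=> su iu.
have [x bx] : exists x, bochner_integral I (fun t => t^-1 *: emb A (u t)) x.
  apply: bochner_exists; [exact: measurable_I|exact: measure_I_lty| |].
    exact: strong_weight_emb.
  by under eq_integral => t /set_mem It do rewrite norm_weight //.
by exists x.
Qed.

Lemma represents_dist_le u v x y : represents I u x -> represents I v y ->
  (`|x - y|%:E <= \int[mu]_(t in I) (t^-1 * `|emb A (u t) - emb A (v t)|)%:E)%E.
Proof.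
move=> [su bu] [sv bv].
have := bochner_dist_le measurable_I measure_I_lty bu bv.
by under eq_integral => t /set_mem It do rewrite -scalerBr norm_weight //.
Qed.

Lemma represents_integrable u x : represents I u x ->
  (\int[mu]_(t in I) (t^-1 * `|emb A (u t)|)%:E < +oo)%E.
Proof.
move=> [su bu]; have := bochner_integrable measurable_I measure_I_lty bu.
by under eq_integral => t /set_mem It do rewrite norm_weight //.
Qed.

Lemma represents_eq u v x : {in I, u =1 v} -> represents I u x -> represents I v x.
Proof.
move=> uv [[s_ [ms cs]] bu]; split.
  by exists s_; split => // t It; rewrite -uv ?inE//; exact: cs.
by apply: bochner_eq bu => t It; rewrite uv.
Qed.

(** It permits an integrand to be set to 0 on the null set where a series of integrands might
    diverge. *)
Lemma represents_ae u x (N : set R) : measurable N -> mu N = 0%E ->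
  represents I u x -> represents I (fun t => \1_(~` N) t *: u t) x.
Proof.
move=> mN N0 ru; have [su _] := ru.
have mC : measurable_fun I (\1_(~` N) : R -> R).
  by apply: measurable_indic; exact: measurableC.
have su' : strongly_measurable I (fun t => \1_(~` N) t *: u t).
  by apply: strong_scale => //; exact: measurable_I.
have me v : strongly_measurable I v -> measurable_fun I (fun t => t^-1 * `|emb A (v t)|).
  move=> sv; apply: measurable_funM; first exact: measurable_inv_I.
  by apply: measurable_norm_strong; [exact: measurable_I|exact: strong_emb].
have [y ry] : exists y, represents I (fun t => \1_(~` N) t *: u t) y.
  apply: represents_exists => //; apply: le_lt_trans (represents_integrable ru).
  apply: le_integral_EFin; [exact: measurable_I|exact: me|exact: me|] => t It.
  have t0 := I_gt0 It; rewrite mulr_ge0 ?invr_ge0 ?(ltW t0) //=.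
  rewrite ler_wpM2l ?invr_ge0 ?(ltW t0) // linearZ /= normrZ indicE.
  by case: (_ \in _); rewrite ?normr1 ?mul1r ?normr0 ?mul0r.
suff -> : x = y by [].
apply/eqP; rewrite -subr_eq0 -normr_le0 -lee_fin.
apply: (le_trans (represents_dist_le ru ry)).
rewrite (@ge0_negligible_integral _ _ _ mu I N) //.
- rewrite integral0_eq // => t [It Nt].
  by rewrite indicE mem_set // scale1r subrr normr0 mulr0.
- apply/measurable_EFinP; apply: measurable_funM; first exact: measurable_inv_I.
  apply: measurable_norm_strong; first exact: measurable_I.
  by apply: strong_sub; exact: strong_emb.
- by move=> t /I_gt0 t0; rewrite lee_fin mulr_ge0 // invr_ge0 ltW.
Qed.

Lemma represents_sum (v_ : nat -> R -> sp1 A) (x_ : nat -> sp0 A) n :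
  (forall i, represents I (v_ i) (x_ i)) ->
  represents I (fun t => \sum_(i < n) v_ i t) (\sum_(i < n) x_ i).
Proof.
move=> rv; split; first by apply: strong_sum => i; case: (rv i).
have := bochner_sum n measurable_I measure_I_lty (fun i => (rv i).2).
by apply: bochner_eq => t _; rewrite linear_sum scaler_sumr.
Qed.

End Representations.

Section ParameterBasics.
Context {R : realType} (G : J_parameter R).
Local Notation mu := (@lebesgue_measure R).
Local Notation I := (`]0, 1]%classic : set R).
Implicit Types (f g : R -> R).

Lemma pnorm_le f g : measurable_fun I f -> (forall t, I t -> `|f t| <= `|g t|) ->
  (G f <= G g)%E.
Proof. by move=> mf fg; apply: pnorm_ideal => //; exact: aeW. Qed.

Lemma pnorm_sum (f_ : nat -> R -> R) (e_ : nat -> R) n :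
  (forall i, (G (f_ i) <= (e_ i)%:E)%E) ->
  (G (fun t => \sum_(i < n) f_ i t)%R <= (\sum_(i < n) e_ i)%:E)%E.
Proof.
move=> h; elim: n => [|n IH].
  under eq_fun do rewrite big_ord0; rewrite big_ord0.
  (* Homogeneity with the factor 0 gives the zero function norm 0, whatever norm is being
     multiplied. *)
  have -> : (fun=> 0 : R) = (fun t : R => 0 * (0 : R)) by apply/funext => t; rewrite mul0r.
  by rewrite (pnormZ G 0 (fun=> 0)) normr0 mul0e.
under eq_fun do rewrite big_ord_recr /=.
rewrite big_ord_recr EFinD; apply: (le_trans (pnormD G _ _)).
exact: leeD.
Qed.

Lemma pnorm_fin_meas f : (G f < +oo)%E -> measurable_fun I f.
Proof. exact: pnorm_meas. Qed.

Lemma pnorm_opp f : G (fun t => - f t) = G f.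
Proof.
have := pnormZ G (-1) f; rewrite normrN1 mul1e => <-.
by congr (pnorm G _); apply/funext => t; rewrite mulN1r.
Qed.

End ParameterBasics.

Lemma cvg_le_ubound (R : realType) (u : nat -> R) (l M : R) :
  u n @[n --> \oo] --> l -> (forall n, u n <= M) -> l <= M.
Proof.
move=> ul uM; rewrite -(cvg_lim (@Rhausdorff R) ul).
by apply: limr_le; [apply/cvg_ex; exists l|exact: nearW].
Qed.

Lemma sum_ord_cat (V : zmodType) (f : nat -> V) m n : (m <= n)%N ->
  \sum_(i < n) f i = \sum_(i < m) f i + \sum_(m <= i < n) f i.
Proof. by move=> mn; rewrite -!(big_mkord xpredT) (@big_cat_nat _ _ _ m). Qed.

Lemma sum_nat_shift (V : zmodType) (f : nat -> V) m n :
  \sum_(m <= i < n) f i = \sum_(i < n - m) f (i + m)%N.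
Proof. by rewrite -[X in \sum_(X <= _ < _) _]add0n big_addn big_mkord. Qed.

(** * Countable subadditivity of the J-norm *)

Section CountableSubadditivity.
Context {R : realType} (A : ordered_pair R) (G : J_parameter R).
Local Notation mu := (@lebesgue_measure R).
Local Notation I := (`]0, 1]%classic : set R).

Lemma J_norm_le (u : R -> sp1 A) x : represents I u x ->
  (J_norm A G x <= G (fun s => Jfun (u s) s))%E.
Proof. by move=> /represents_oo_oc ru; apply: ereal_inf_lbound; exists u. Qed.

Lemma J_norm_ge0 x : (0 <= J_norm A G x)%E.
Proof. by apply: le_ereal_inf_tmp => _ [u _ <-]; exact: pnorm_ge0. Qed.

Lemma bounded_psums (e_ : nat -> R) M : (forall i, 0 <= e_ i) ->
  (forall n, \sum_(i < n) e_ i <= M) -> forall e, 0 < e ->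
  exists N, forall m n, (N <= m <= n)%N -> \sum_(m <= i < n) e_ i < e.
Proof.
move=> e0 eM e epos.
have nd : {homo (fun n => \sum_(i < n) e_ i) : n m / (n <= m)%N >-> n <= m}.
  move=> n m nm; rewrite (sum_ord_cat _ nm) lerDl.
  by apply: sumr_ge0.
have ub : has_ubound (range (fun n => \sum_(i < n) e_ i)).
  by exists M => _ [n _ <-].
have /cvgrPdist_lt/(_ _ (divr_gt0 epos (ltr0Sn R 1))) [N _ hN] :=
  nondecreasing_is_cvgn nd ub.
exists N => m n /andP[Nm mn].
have h1 := hN m Nm; have h2 := hN n (leq_trans Nm mn).
have -> : \sum_(m <= i < n) e_ i = \sum_(i < n) e_ i - \sum_(i < m) e_ i.
  by rewrite (sum_ord_cat _ mn) addrC addKr.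
rewrite (le_lt_trans (ler_norm _)) //.
set l := lim _ in h1 h2; rewrite -(subrKA l) (le_lt_trans (ler_normD _ _)) //.
by rewrite distrC [ltRHS]splitr; exact: ltrD.
Qed.

(** The Riesz-Fischer argument in [G]: the partial sums are Cauchy, and their limit [f] dominates
    each of them almost everywhere because the positive part of [F n - f] has integral 0 for
    dt/t. *)
Lemma nneg_series_majorant (h_ : nat -> R -> R) (e_ : nat -> R) M :
  (forall n, measurable_fun I (h_ n)) -> (forall n t, I t -> 0 <= h_ n t) ->
  (forall n, (G (h_ n) <= (e_ n)%:E)%E) -> (forall n, \sum_(i < n) e_ i <= M) ->
  exists f N, [/\ (G f <= M%:E)%E, measurable N, mu N = 0%E &
    forall t n, I t -> ~ N t -> \sum_(i < n) h_ i t <= f t].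
Proof.
move=> mh h0 he eM.
have e0 i : 0 <= e_ i by rewrite -lee_fin (le_trans _ (he i)) // pnorm_ge0.
pose F n t := \sum_(i < n) h_ i t.
have GF n : (G (F n) <= (\sum_(i < n) e_ i)%:E)%E by exact: pnorm_sum.
have mF n : measurable_fun I (F n) by exact: measurable_sum.
have FB m n t : (m <= n)%N -> F n t - F m t = \sum_(m <= i < n) h_ i t.
  by move=> mn; rewrite /F (sum_ord_cat (h_^~ t) mn) addrC addKr.
have GFB m n : (m <= n)%N -> (G (F n \- F m)%R <= (\sum_(m <= i < n) e_ i)%:E)%E.
  move=> mn; rewrite (_ : F n \- F m = fun t => \sum_(i < n - m) h_ (i + m)%N t).
    rewrite sum_nat_shift.
    by apply: (@pnorm_sum _ _ (fun i => h_ (i + m)%N) (fun i => e_ (i + m)%N)).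
  by apply/funext => t /=; rewrite FB // sum_nat_shift.
have [f fG cf] : exists2 f : R -> R, (G f < +oo)%E & G (F n \- f) @[n --> \oo] --> 0%E.
  apply: (@pnorm_complete _ G F) => [n|e epos]; first exact: le_lt_trans (GF n) (ltry _).
  have [N hN] := bounded_psums e0 eM epos.
  exists N => m n Nm Nn; have [mn|/ltnW nm] := leqP m n.
    rewrite -pnorm_opp (_ : (fun t => _) = F n \- F m); last first.
      by apply/funext => t /=; rewrite opprB.
    by apply: (le_lt_trans (GFB _ _ mn)); rewrite lte_fin hN // Nm.
  by apply: (le_lt_trans (GFB _ _ nm)); rewrite lte_fin hN // Nn.
have mf := pnorm_fin_meas fG.
have Ff n : {ae mu, forall t, I t -> F n t <= f t}.
  pose p t := Num.max (F n t - f t) 0.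
  have mp : measurable_fun I p.
    by apply: measurable_maxr => //; apply: measurable_funB.
  have mtp : measurable_fun I (fun t => t^-1 * p t).
    by apply: measurable_funM => //; exact: measurable_inv_I.
  have p0 t : 0 <= p t by rewrite /p le_max lexx orbT.
  have tp0 t : I t -> 0 <= t^-1 * p t.
    by move=> /I_gt0 t0; rewrite mulr_ge0 // invr_ge0 ltW.
  have ip0 : (\int[mu]_(t in I) (t^-1 * p t)%:E = 0)%E.
    apply/eqP; rewrite eq_le integral_ge0 ?andbT; last first.
      by move=> t /tp0; rewrite lee_fin.
    have [C C0 hC] := pnorm_L1 G.
    apply/lee_addgt0Pr => e epos; rewrite add0e.
    have [N _ hN] := cvge0_near_lt cf (divr_gt0 epos C0).
    (* The partial sums increase, so [p] is at most |F m - f|; the embedding of [G] into L^1 makes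
       the integral of the latter as small as desired. *)
    pose m := maxn n N.
    have mFf : measurable_fun I (F m \- f) by exact: measurable_funB.
    apply: (@le_trans _ _ (\int[mu]_(t in I) (`|(F m \- f) t| / t)%:E)%E).
      apply: le_integral_EFin => //.
        by apply: measurable_funM; [apply: measurableT_comp|exact: measurable_inv_I].
      move=> t It; rewrite tp0 //= mulrC ler_wpM2r ?invr_ge0 ?(ltW (I_gt0 It)) //.
      rewrite /p ge_max normr_ge0 andbT (le_trans _ (ler_norm _)) //= lerD2r.
      rewrite -subr_ge0 FB ?leq_maxl //; apply: sumr_ge0 => i _; exact: h0.
    apply: (le_trans (hC _ mFf)).
    apply: (@le_trans _ _ (C%:E * (e / C)%:E)%E).
      by rewrite lee_pmul2l // ltW // hN //= leq_maxr.
    by rewrite -EFinM mulrC divfK // gt_eqF.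
  have /(ae_eq_integral_abs mu measurable_I) : measurable_fun I (fun t => (t^-1 * p t)%:E).
    exact/measurable_EFinP.
  move=> [+ _]; under eq_integral => t /set_mem It do rewrite abse_EFin ger0_norm ?tp0 //.
  move=> /(_ ip0); apply: filterS => t h It; have := h It; move=> [].
  move=> /eqP; rewrite mulf_eq0 invr_eq0 gt_eqF ?(I_gt0 It) //= => /eqP pt.
  by rewrite -subr_le0 -pt /p le_max lexx.
have /ae_foralln [N [mN N0 hN]] := Ff.
exists f, N; split => //.
  apply/lee_addgt0Pr => e epos.
  have [k _ /(_ k (leqnn k)) hk] := cvge0_near_lt cf epos.
  rewrite (_ : f = F k \+ (fun t => - (F k \- f) t)); last first.
    by apply/funext => t /=; rewrite opprB addrC subrK.
  apply: (le_trans (pnormD G _ _)); apply: leeD.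
    by apply: (le_trans (GF k)); rewrite lee_fin.
  by rewrite pnorm_opp ltW.
move=> t n It Nt; apply: contrapT => h; apply: Nt; apply: hN => /= h'.
by apply: h; exact: h'.
Qed.

Lemma integrable_pnorm f : (G f < +oo)%E ->
  (\int[mu]_(t in I) (t^-1 * `|f t|)%:E < +oo)%E.
Proof.
move=> fG; have [C C0 hC] := pnorm_L1 G.
under eq_integral do rewrite mulrC.
apply: le_lt_trans (hC _ (pnorm_fin_meas fG)) _.
by rewrite lte_mul_pinfty // ltW.
Qed.

(** Nearly optimal representations are summed pointwise. A majorant in [G] of the sums of their
    J-functionals, finite off a null set, bounds t times the sum of the A_1-norms, so the integrands
    sum absolutely in A_1. Dominated convergence in A_0 then identifies the represented element with
    [x]. *)
Lemma J_norm_series (x_ : nat -> sp0 A) x (e_ : nat -> R) M :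
  (forall n, (J_norm A G (x_ n) < (e_ n)%:E)%E) ->
  (forall n, \sum_(i < n) e_ i <= M) ->
  \sum_(i < n) x_ i @[n --> \oo] --> x -> (J_norm A G x <= M%:E)%E.
Proof.
move=> hx eM cx.
have /choice[u hu] : forall n, exists u, represents I u (x_ n) /\
    (G (fun s => Jfun (u s) s) < (e_ n)%:E)%E.
  move=> n; have /ereal_inf_lt[_ [u ru <-] hu] := hx n.
  by exists u; split => //; exact/represents_oo_oc.
have su n : strongly_measurable I (u n) by case: (hu n) => -[].
have [||n|f [N [fM mN N0 hN]]] := nneg_series_majorant
    (h_ := fun n t => Jfun (u n t) t) _ _ _ eM.
- by move=> n; apply: measurable_Jfun => //; exact: measurable_I.
- by move=> n t _; exact: Jfun_ge0.
- by have [_ /ltW] := hu n.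
have fG : (G f < +oo)%E by apply: le_lt_trans fM (ltry _).
pose v n t := \1_(~` N) t *: u n t.
have rv n : represents I (v n) (x_ n) by apply: represents_ae => //; case: (hu n).
have sv n : strongly_measurable I (v n) by case: (rv n).
have Jv t n : I t -> \sum_(i < n) Jfun (v i t) t <= `|f t|.
  move=> It; have [Nt|Nt] := pselect (N t).
    rewrite big1 // => i _; rewrite /v indicE memNset; last by move=> /(_ Nt).
    by rewrite scale0r Jfun0.
  rewrite (le_trans _ (ler_norm _)) // (le_trans _ (hN t n It Nt)) //.
  by apply: ler_sum => i _; rewrite /v indicE mem_set // scale1r.
have cvS t : I t -> cvgn (series (fun n => v n t)).
  move=> It; have t0 := I_gt0 It; apply: normed_cvg.
  have E n : [normed series (v^~ t)] n = \sum_(i < n) `|v i t|.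
    by rewrite /= seriesEord.
  apply: nondecreasing_is_cvgn.
    move=> n m nm; rewrite !E (sum_ord_cat (fun i => `|v i t|) nm).
    by rewrite lerDl sumr_ge0.
  exists (t^-1 * `|f t|) => _ [n _ <-]; rewrite E.
  rewrite -ler_pdivrMl ?invr_gt0 // invrK (le_trans _ (Jv t n It)) // mulr_sumr.
  by apply: ler_sum => i _; exact: norm_le_Jfun.
pose w t := limn (series (fun n => v n t)).
have cw t : I t -> \sum_(i < n) v i t @[n --> \oo] --> w t.
  by move=> It; have := cvS t It; rewrite /w seriesEord.
have sS n : strongly_measurable I (fun t => \sum_(i < n) v i t).
  exact: strong_sum.
have sw : strongly_measurable I w by apply: strong_cvg sS cw; exact: measurable_I.
have Jw t : I t -> Jfun (w t) t <= `|f t|.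
  move=> It; have := cvg_comp _ _ (cw t It) (@continuous_Jfun _ _ t (w t)).
  move=> h; apply: (cvg_le_ubound h) => n /=.
  by rewrite (le_trans (Jfun_sum (fun i => v i t) n (ltW (I_gt0 It)))) // Jv.
have mf := pnorm_fin_meas fG.
have mJw : measurable_fun I (fun t => Jfun (w t) t).
  by apply: measurable_Jfun => //; exact: measurable_I.
have If := integrable_pnorm fG.
have mtf : measurable_fun I (fun t => t^-1 * `|f t|).
  by apply: measurable_funM; [exact: measurable_inv_I|exact: measurableT_comp].
have me z : strongly_measurable I z -> measurable_fun I (fun t => t^-1 * `|emb A (z t)|).
  move=> sz; apply: measurable_funM; first exact: measurable_inv_I.
  by apply: measurable_norm_strong; [exact: measurable_I|exact: strong_emb].
have [y ry] : exists y, represents I w y.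
  apply: represents_exists => //; apply: le_lt_trans If.
  apply: le_integral_EFin => // [|t It]; first exact: me.
  have t0 : 0 <= t^-1 by rewrite invr_ge0 ltW // I_gt0.
  by rewrite mulr_ge0 //= ler_wpM2l // (le_trans _ (Jw t It)) // emb_le_Jfun.
have rS n := represents_sum n rv.
suff xy : x = y.
  rewrite xy; apply: (le_trans (J_norm_le ry)); apply: le_trans fM.
  apply: pnorm_le => // t It; rewrite ger0_norm ?Jfun_ge0 //; exact: Jw.
have cy : \sum_(i < n) x_ i @[n --> \oo] --> y.
  have cv : (\int[mu]_(t in I) (t^-1 * `|emb A (w t) -
      emb A (\sum_(i < n) v i t)|)%:E)%E @[n --> \oo] --> 0%E.
    apply: (@dominated_cvg0 _ _ _ (fun t => 2 * (t^-1 * `|f t|))).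
    - exact: measurable_I.
    - move=> n; apply: measurable_funM; first exact: measurable_inv_I.
      apply: measurable_norm_strong; first exact: measurable_I.
      by apply: strong_sub; exact: strong_emb.
    - exact: measurable_funM.
    - move=> n t It; have t0 : 0 <= t^-1 by rewrite invr_ge0 ltW // I_gt0.
      rewrite mulr_ge0 //= mulrCA ler_wpM2l // (le_trans (ler_normB _ _)) //.
      rewrite mulrDl mul1r lerD // (le_trans (emb_le_Jfun _ t)) //; first exact: Jw.
      by rewrite (le_trans (Jfun_sum (fun i => v i t) n (ltW (I_gt0 It)))) // Jv.
    - rewrite integralZ_EFin_ge0 //; first by rewrite lte_mul_pinfty.
      by move=> t /I_gt0 t0; rewrite mulr_ge0 // invr_ge0 ltW.
    - move=> t It; rewrite -(mulr0 t^-1); apply: cvgM; first exact: cvg_cst.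
      rewrite -(normr0 (sp0 A)) -(subrr (emb A (w t))); apply: (@cvg_norm _ (sp0 A)).
      apply: cvgB; first exact: cvg_cst.
      exact: (cvg_comp _ _ (cw t It) (@emb_continuous _ _ _)).
  apply/cvgrPdist_lt => e e0; have := cvge0_near_lt cv e0; apply: filterS => n.
  rewrite -lte_fin; apply: le_lt_trans; exact: represents_dist_le.
exact: (cvg_unique _ cx cy).
Qed.

End CountableSubadditivity.

Section JNormBounds.
Context {R : realType} (A : ordered_pair R) (G : J_parameter R).
Local Notation mu := (@lebesgue_measure R).
Local Notation I := (`]0, 1]%classic : set R).

Lemma J_norm_lt_rep x (e : \bar R) : (J_norm A G x < e)%E ->
  exists2 u, represents I u x & (G (fun s => Jfun (u s) s) < e)%E.
Proof.
by move=> /ereal_inf_lt[_ [u ru <-] hu]; exists u => //; exact/represents_oo_oc.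
Qed.

Lemma J_norm_lin x y k (a b : R) : (J_norm A G x <= a%:E)%E ->
  (J_norm A G y <= b%:E)%E -> (J_norm A G (x + k *: y)%R <= (a + `|k| * b)%:E)%E.
Proof.
move=> xa yb; apply/lee_addgt0Pr => e e0.
have k1 : 0 < `|k| + 1 by rewrite ltr_wpDl.
have e2 : 0 < e / 2 by rewrite divr_gt0.
have e3 : 0 < e / 2 / (`|k| + 1) by rewrite divr_gt0.
have [|u ru hu] := @J_norm_lt_rep x (a + e / 2)%:E.
  by apply: le_lt_trans xa _; rewrite lte_fin ltrDl.
have [|v rv hv] := @J_norm_lt_rep y (b + e / 2 / (`|k| + 1))%:E.
  by apply: le_lt_trans yb _; rewrite lte_fin ltrDl.
apply: (le_trans (J_norm_le G (represents_lin k ru rv))).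
have [[su _] [sv _]] := (ru, rv).
apply: (@le_trans _ _ (G ((fun s => Jfun (u s) s) \+ (fun s => `|k| * Jfun (v s) s)))).
  apply: pnorm_le.
    by apply: measurable_Jfun; [exact: measurable_I|exact: strong_lin].
  move=> t /I_gt0 /ltW t0; rewrite ger0_norm ?Jfun_ge0 // (le_trans _ (ler_norm _)) //.
  by rewrite (le_trans (JfunD _ _ t0)) // JfunZ.
apply: (le_trans (pnormD G _ _)); rewrite pnormZ normr_id.
apply: (@le_trans _ _ ((a + e / 2)%:E + (`|k| * (b + e / 2 / (`|k| + 1)))%:E)%E).
  apply: leeD; first exact: ltW.
  by rewrite EFinM lee_wpmul2l ?lee_fin // ltW.
rewrite -!EFinD lee_fin mulrDr addrACA lerD2l [leRHS]splitr lerD2l.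
by rewrite mulrA ler_pdivrMr // mulrC ler_wpM2l ?ltW // ltrDl.
Qed.

Lemma half_psums n : \sum_(i < n) (2^-1 : R) ^+ i.+1 = 1 - 2^-1 ^+ n.
Proof.
elim: n => [|n IH]; first by rewrite big_ord0 expr0 subrr.
by rewrite big_ord_recr /= IH exprS; field.
Qed.

(** The slack d 2^(-n-1) makes the n-th bound strict and adds up to at most d. *)
Lemma J_norm_series_le (x_ : nat -> sp0 A) x (e_ : nat -> R) M :
  (forall n, (J_norm A G (x_ n) <= (e_ n)%:E)%E) ->
  (forall n, \sum_(i < n) e_ i <= M) ->
  \sum_(i < n) x_ i @[n --> \oo] --> x -> (J_norm A G x <= M%:E)%E.
Proof.
move=> hx eM cx; apply/lee_addgt0Pr => d d0; rewrite -EFinD.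
apply: (@J_norm_series _ _ _ x_ x (fun n => e_ n + d * 2^-1 ^+ n.+1)) => // n.
  by apply: le_lt_trans (hx n) _; rewrite lte_fin ltrDl mulr_gt0 // exprn_gt0.
have h : d * (1 - 2^-1 ^+ n) <= d * 1.
  by rewrite ler_wpM2l ?(ltW d0) // lerBlDl lerDr exprn_ge0 // invr_ge0.
rewrite big_split /= -mulr_sumr half_psums; apply: lerD; first exact: eM.
by rewrite mulr1 in h.
Qed.

End JNormBounds.

(** * Change of scale by iterated square roots *)

Section Transport.
Context {R : realType} (A : ordered_pair R) (G : J_parameter R).
Local Notation mu := (@lebesgue_measure R).
Local Notation I := (`]0, 1]%classic : set R).
Implicit Types (f : nat -> sp1 A) (nu : R -> nat).

(** Countably valued functions are kept in the form [f (nu t)], so that a substitution changes only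
    the index function and the same index can drive several families of values. *)
Definition measurable_index nu := forall n, measurable (I `&` [set t | nu t = n]).

Lemma I_sqrt (t : R) : I t -> I (Num.sqrt t).
Proof.
rewrite /= !in_itv /= => /andP[t0 t1].
by rewrite sqrtr_gt0 t0 /= -sqrtr1 ler_sqrt.
Qed.

Lemma measurable_index_sqrt nu : measurable_index nu ->
  measurable_index (fun t => nu (Num.sqrt t)).
Proof.
move=> mnu n; rewrite (_ : _ `&` _ = I `&` Num.sqrt @^-1` (I `&` [set t | nu t = n])).
  by apply: measurableI; [exact: measurable_I|exact: measurable_sqrt_preimage].
by apply/seteqP; split=> t [It] => [/= h|[]//]; split => //; split => //=; exact: I_sqrt.
Qed.

Lemma strong_index f nu : measurable_index nu -> strongly_measurable I (fun t => f (nu t)).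
Proof. by move=> mnu; apply: strong_nat_comp => //; exact: measurable_I. Qed.

Lemma measurable_index_fun nu (b : nat -> R) : measurable_index nu ->
  measurable_fun I (fun t => b (nu t)).
Proof. by move=> mnu; apply: measurable_nat_comp => //; exact: measurable_I. Qed.

Lemma represents_series f nu x : measurable_index nu ->
  represents I (fun t => f (nu t)) x ->
  \sum_(i < n) fine (\int[mu]_(t in I) (t^-1 * (nu t == i)%:R)%:E) *: emb A (f i)
    @[n --> \oo] --> x.
Proof.
move=> mnu [_ bx].
apply: (@bochner_nat_series _ _ _ _ nu (fun n => emb A (f n)) x measurable_I
  measure_I_lty measurable_inv_I _ mnu bx).
by move=> t /I_gt0 t0; rewrite invr_ge0 ltW.
Qed.

(* For countably valued integrands the vector-valued substitution reduces to the
   scalar one, term by term. *)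
Lemma represents_sqrt f nu x : measurable_index nu ->
  represents I (fun t => f (nu t)) x ->
  represents I (fun s => 2^-1 *: f (nu (Num.sqrt s))) x.
Proof.
move=> mnu rx; have mnu' := measurable_index_sqrt mnu.
have [y ry] : exists y, represents I (fun s => 2^-1 *: f (nu (Num.sqrt s))) y.
  apply: represents_exists; first exact: (strong_index (fun n => 2^-1 *: f n) mnu').
  rewrite (_ : (\int[mu]_(t in I) _)%E =
      \int[mu]_(s in I) (2^-1 * (s^-1 * `|emb A (f (nu (Num.sqrt s)))|))%:E)%E; last first.
    apply: eq_integral => s _; congr (_%:E).
    by rewrite linearZ /= normrZ ger0_norm ?invr_ge0 // mulrCA.
  have mphi : measurable_fun I (fun t => `|emb A (f (nu t))|).
    exact: (measurable_index_fun (fun n => `|emb A (f n)|) mnu).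
  rewrite integralZ_EFin_ge0 ?invr_ge0 //.
  - rewrite (@integral_sqrt _ (fun t => `|emb A (f (nu t))|)) //.
    by rewrite !lte_mul_pinfty ?lee_fin ?invr_ge0 // (represents_integrable rx).
  - apply: measurable_funM; first exact: measurable_inv_I.
    exact: (measurable_index_fun (fun n => `|emb A (f n)|) mnu').
  - by move=> t /I_gt0 t0; rewrite mulr_ge0 // invr_ge0 ltW.
suff -> : x = y by [].
have cx := represents_series mnu rx.
have cy := represents_series (f := fun n => 2^-1 *: f n) mnu' ry.
suff E : (fun n => \sum_(i < n)
    fine (\int[mu]_(t in I) (t^-1 * (nu t == i)%:R)%:E) *: emb A (f i)) =
  (fun n => \sum_(i < n)
    fine (\int[mu]_(s in I) (s^-1 * (nu (Num.sqrt s) == i)%:R)%:E) *: emb A (2^-1 *: f i)).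
  by rewrite E in cx; exact: (cvg_unique _ cx cy).
apply/funext => n; apply: eq_bigr => i _.
rewrite (@integral_sqrt _ (fun t => (nu t == i)%:R)) //; last first.
  exact: (measurable_index_fun (fun n => (n == i)%:R) mnu).
rewrite linearZ /= scalerA; congr (_ *: _).
set m := (\int[mu]_(t in I) _)%E; have : (0 <= m)%E.
  by apply: integral_ge0 => t /I_gt0 t0; rewrite lee_fin mulr_ge0 // invr_ge0 ltW.
(* For an infinite mass [fine] returns 0 on both sides, so the two coefficients agree in this case
   too. *)
case: m => [r _| |]; rewrite ?leNye //=.
  by rewrite mulrAC divff ?mul1r.
by rewrite mulry gtr0_sg // mul1e mul0r.
Qed.

Lemma represents_iter_sqrt f nu x n : measurable_index nu ->
  represents I (fun t => f (nu t)) x ->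
  measurable_index (fun s => nu (iter n Num.sqrt s)) /\
  represents I (fun s => (2^-1 ^+ n) *: f (nu (iter n Num.sqrt s))) x.
Proof.
move=> mnu rx; elim: n => [|n [mn rn]].
  split; first exact: mnu.
  by apply: (represents_eq _ rx) => t _; rewrite expr0 scale1r.
split.
  have := measurable_index_sqrt mn.
  suff -> : (fun s => nu (iter n.+1 Num.sqrt s)) =
    (fun s => nu (iter n Num.sqrt (Num.sqrt s))) by [].
  by apply/funext => s; rewrite iterSr.
have := represents_sqrt (f := fun m => (2^-1 ^+ n) *: f m) mn rn.
by apply: represents_eq => s _; rewrite scalerA -exprS -iterSr.
Qed.

Lemma iter_sqrt_expr n (s : R) : 0 <= s -> iter n Num.sqrt s ^+ (2 ^ n) = s.
Proof.
elim: n s => [|n IH] s s0; first by rewrite expn0 expr1.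
by rewrite iterSr expnSr exprM IH ?sqrtr_ge0 // sqr_sqrtr.
Qed.

Lemma I_iter_sqrt n (t : R) : I t -> I (iter n Num.sqrt t).
Proof. by move=> It; elim: n => //= n; exact: I_sqrt. Qed.

Variable C : R.
Hypothesis C0 : 0 <= C.
Hypothesis hC : forall f : R -> R, (G f < +oo)%E ->
  (G (fun t => f (Num.sqrt t)) <= C%:E * G f)%E.

Lemma pnorm_iter_sqrt n (h : R -> R) : (G h < +oo)%E ->
  (G (fun s => h (iter n Num.sqrt s)) <= (C ^+ n)%:E * G h)%E.
Proof.
move=> Gh; elim: n => [|n IH]; first by rewrite expr0 mul1e.
have fin : (G (fun s => h (iter n Num.sqrt s)) < +oo)%E.
  by apply: le_lt_trans IH _; rewrite lte_mul_pinfty // ?lee_fin ?exprn_ge0.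
under eq_fun do rewrite iterSr.
apply: (le_trans (hC fin)); rewrite exprS EFinM -muleA lee_wpmul2l //.
Qed.

Lemma J_norm_transport f nu h n x : measurable_index nu -> (G h < +oo)%E ->
  (forall t, I t -> Jfun (f (nu t)) (t ^+ (2 ^ n)) <= h t) ->
  represents I (fun t => f (nu t)) x ->
  (J_norm A G x <= ((C / 2) ^+ n)%:E * G h)%E.
Proof.
move=> mnu Gh Jh rx; have [mn rn] := represents_iter_sqrt n mnu rx.
apply: (le_trans (J_norm_le G rn)).
apply: (@le_trans _ _ (G (fun s => 2^-1 ^+ n * h (iter n Num.sqrt s)))).
  apply: pnorm_le.
    by apply: measurable_Jfun; [exact: measurable_I|case: rn].
  move=> s Is; have It := I_iter_sqrt n Is.
  have h0 : 0 <= h (iter n Num.sqrt s) by rewrite (le_trans _ (Jh _ It)) ?Jfun_ge0.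
  have p0 : 0 <= (2^-1 : R) ^+ n by rewrite exprn_ge0 ?invr_ge0.
  rewrite !ger0_norm ?Jfun_ge0 ?mulr_ge0 // JfunZ ger0_norm // ler_wpM2l //.
  have := Jh _ It; rewrite iter_sqrt_expr //; exact: ltW (I_gt0 Is).
rewrite pnormZ ger0_norm ?exprn_ge0 ?invr_ge0 // exprMn mulrC EFinM -muleA.
rewrite lee_wpmul2l ?lee_fin ?exprn_ge0 ?invr_ge0 //; exact: pnorm_iter_sqrt.
Qed.

(** Level j is integrated by itself and moved to the scale t^(2^j), where its J-functional is
    controlled by [kappa j]. The remainders are at most [kappa' m] times one integrable function in
    A_0, so the integrals of the levels add up to [x]. *)
Lemma J_norm_levels f nu x (a : nat -> nat -> sp1 A) (b : nat -> R)
    (kappa kappa' : nat -> R) K :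
  measurable_index nu -> represents I (fun t => f (nu t)) x ->
  (forall n, 0 <= b n) -> (forall j, 0 <= kappa j) -> (forall j, 0 <= kappa' j) ->
  (G (fun t => b (nu t)) < +oo)%E ->
  (forall j t, I t -> Jfun (a j (nu t)) (t ^+ (2 ^ j)) <= kappa j * b (nu t)) ->
  (forall m t, I t ->
    `|emb A (f (nu t)) - \sum_(j < m) emb A (a j (nu t))| <= kappa' m * b (nu t)) ->
  kappa' m @[m --> \oo] --> 0 ->
  (forall m, \sum_(j < m) kappa j * (C / 2) ^+ j <= K) ->
  (J_norm A G x <= K%:E * G (fun t => b (nu t)))%E.
Proof.
move=> mnu rx b0 k0 k'0 Gb Ja fa ck hK.
have Ib : (\int[mu]_(t in I) (t^-1 * b (nu t))%:E < +oo)%E.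
  have := integrable_pnorm Gb.
  by under eq_integral do rewrite ger0_norm //.
have tb0 t : I t -> 0 <= t^-1 * b (nu t).
  by move=> /I_gt0 t0; rewrite mulr_ge0 // invr_ge0 ltW.
have mb : measurable_fun I (fun t => t^-1 * b (nu t)).
  by apply: measurable_funM; [exact: measurable_inv_I|exact: measurable_index_fun].
have /choice[x_ rx_] : forall j, exists y, represents I (fun t => a j (nu t)) y.
  move=> j; apply: represents_exists; first exact: strong_index.
  apply: (@le_lt_trans _ _ (\int[mu]_(t in I) (kappa j * (t^-1 * b (nu t)))%:E)%E).
    apply: le_integral_EFin; [exact: measurable_I| | |].
    - apply: measurable_funM; first exact: measurable_inv_I.
      exact: (measurable_index_fun (fun n => `|emb A (a j n)|)).
    - exact: measurable_funM.
    - move=> t It; have t0 : 0 <= t^-1 by rewrite invr_ge0 ltW // I_gt0.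
      by rewrite mulr_ge0 //= mulrCA ler_wpM2l // (le_trans (emb_le_Jfun _ _) (Ja j t It)).
  by rewrite integralZ_EFin_ge0 // lte_mul_pinfty // lee_fin.
have Gfin : (G (fun t => b (nu t))) \is a fin_num by rewrite ge0_fin_numE // pnorm_ge0.
set g := G _ in Gfin *.
have -> : g = (fine g)%:E by rewrite fineK.
have g0 : 0 <= fine g by rewrite fine_ge0 // pnorm_ge0.
rewrite -EFinM.
apply: (@J_norm_series_le _ _ _ x_ x (fun j => kappa j * (C / 2) ^+ j * fine g)).
- move=> j; have h : (G (fun t => kappa j * b (nu t))%R < +oo)%E.
    by rewrite pnormZ lte_mul_pinfty.
  apply: (le_trans (@J_norm_transport (a j) nu _ j _ mnu h (Ja j) (rx_ j))).
  rewrite pnormZ (ger0_norm (k0 j)) -/g -(fineK Gfin) -!EFinM lee_fin /=.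
  by rewrite mulrA [_ ^+ j * _]mulrC.
- by move=> n; rewrite -mulr_suml ler_wpM2r.
- have Ifin : (\int[mu]_(t in I) (t^-1 * b (nu t))%:E)%E \is a fin_num.
    by rewrite ge0_fin_numE // integral_ge0 // => t /tb0; rewrite lee_fin.
  set l := fine (\int[mu]_(t in I) (t^-1 * b (nu t))%:E)%E.
  have cl : kappa' m * l @[m --> \oo] --> 0.
    by rewrite -(mul0r l); apply: cvgM => //; exact: cvg_cst.
  apply/cvgrPdist_lt => e e0.
  have /cvgrPdist_lt/(_ _ e0) := cl; apply: filterS => m.
  rewrite sub0r normrN; apply: le_lt_trans; apply: le_trans (ler_norm _).
  have rS := represents_sum m rx_.
  rewrite -lee_fin; apply: (le_trans (represents_dist_le rx rS)).
  rewrite EFinM fineK // -integralZ_EFin_ge0 //.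
  apply: le_integral_EFin; [exact: measurable_I| | |].
  + apply: measurable_funM; first exact: measurable_inv_I.
    apply: measurable_norm_strong; first exact: measurable_I.
    by apply: strong_sub; apply: strong_emb; [case: rx|case: rS].
  + exact: measurable_funM.
  + move=> t It; have t0 : 0 <= t^-1 by rewrite invr_ge0 ltW // I_gt0.
    by rewrite mulr_ge0 //= mulrCA ler_wpM2l // linear_sum fa.
Qed.

End Transport.

(** * Decompositions of a single element *)

Section Decomposition.
Context {R : realType} {A : ordered_pair R}.
Implicit Types (a : sp1 A) (theta b rho : R).

(* [c s] plays the role of the part of a J-representation of [a] living on
   [s, 1[; only these two estimates are needed to re-represent [a]. *)
Definition decomposition theta b a := exists c : R -> sp1 A, [/\ c 1 = 0,
  forall s, 0 < s -> s <= 1 -> `|emb A (a - c s)| <= s `^ theta * b &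
  forall r s, 0 < r -> r <= s -> s <= 1 -> Jfun (c r - c s) r <= s `^ theta * b].

Lemma decomposition_ge0 theta b a : decomposition theta b a -> 0 <= b.
Proof.
move=> [c [_ h _]]; have := h 1 ltr01 (lexx _).
by rewrite powR1 mul1r; exact: le_trans.
Qed.

(** Only s <= 1 occurs, so lowering the exponent weakens both estimates. This lets one exponent and
    one bound be used for a whole cell of values of [t]. *)
Lemma decomposition_mono theta theta' b b' a : theta <= theta' -> b' <= b ->
  decomposition theta' b' a -> decomposition theta b a.
Proof.
move=> tt bb D; have b0 := decomposition_ge0 D; move: D => [c [c1 h1 h2]].
have H s : 0 < s -> s <= 1 -> s `^ theta' * b' <= s `^ theta * b.
  by move=> s0 s1; rewrite ler_pM ?powR_ge0 //; apply: ger_powR => //; rewrite s0.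
exists c; split => // [s s0 s1|r s r0 rs s1].
  by rewrite (le_trans (h1 s s0 s1)) // H.
by rewrite (le_trans (h2 r s r0 rs s1)) // H // (lt_le_trans r0).
Qed.

Lemma decompositionD theta b b' a a' : decomposition theta b a ->
  decomposition theta b' a' -> decomposition theta (b + b') (a + a').
Proof.
move=> [c [c1 h1 h2]] [c' [c1' h1' h2']].
exists (fun s => c s + c' s); split; first by rewrite c1 c1' addr0.
  move=> s s0 s1; rewrite opprD addrACA linearD mulrDr.
  by rewrite (le_trans (ler_normD _ _)) // lerD ?h1 ?h1'.
move=> r s r0 rs s1; rewrite opprD addrACA mulrDr.
by rewrite (le_trans (JfunD _ _ (ltW r0))) // lerD ?h2 ?h2'.
Qed.

(** The element [a] is represented by u(s) = s a, whose integral for ds/s over (s, 1) is (1 - s) a.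
    The lemma absorbs approximation errors that are small in A_1. *)
Lemma decomposition_norm theta a : theta <= 1 -> decomposition theta `|a| a.
Proof.
move=> t1.
have H s : 0 < s -> s <= 1 -> s <= s `^ theta.
  by move=> s0 s1; rewrite -{1}[s]powRr1 ?(ltW s0) //; apply: ger_powR => //; rewrite s0.
exists (fun s => (1 - s) *: a); split; first by rewrite subrr scale0r.
  move=> s s0 s1; rewrite -{1}[a]scale1r -scalerBl opprB addrC subrK.
  rewrite (le_trans (emb_le _)) // normrZ (ger0_norm (ltW s0)).
  by rewrite ler_wpM2r // H.
move=> r s r0 rs s1; have s0 := lt_le_trans r0 rs.
rewrite -scalerBl (_ : 1 - r - (1 - s) = s - r); last by ring.
rewrite (le_trans (Jfun_le_norm _ _)) ?(ltW r0) ?(le_trans rs) //.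
rewrite normrZ ler_wpM2r // ger0_norm ?subr_ge0 //.
by rewrite (le_trans _ (H s s0 s1)) // gerBl ltW.
Qed.

(** With s_j = tau^(2^j) and tau^theta <= rho, this bounds s_(j-1)^theta; the value 1 at j = 0
    belongs to the starting point s = 1. *)
Definition level rho j : R := if j is i.+1 then rho ^+ (2 ^ i) else 1.

Lemma level_ge0 rho j : 0 <= rho -> 0 <= level rho j.
Proof. by move=> r0; case: j => //= j; rewrite exprn_ge0. Qed.

(** The same terms must serve for every [t] of a cell, so they are built from an upper bound [tau]
    of the cell; for smaller [t] the J-functional can only decrease. *)
Lemma decomposition_levels theta b a tau rho : 0 < tau -> tau <= 1 ->
  tau `^ theta <= rho -> decomposition theta b a ->
  exists d : nat -> sp1 A,
    (forall j t, 0 < t -> t <= tau -> Jfun (d j) (t ^+ (2 ^ j)) <= level rho j * b) /\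
    (forall m, `|emb A a - \sum_(j < m) emb A (d j)| <= level rho m * b).
Proof.
move=> t0 t1 tr D; have b0 := decomposition_ge0 D; move: D => [c [c1 h1 h2]].
pose s j := tau ^+ (2 ^ j).
have s0 j : 0 < s j by rewrite exprn_gt0.
have s1 j : s j <= 1 by rewrite exprn_ile1 // ltW.
have sS j : s j.+1 <= s j by apply: ler_wiXn2l; [exact: ltW|exact: t1|rewrite leq_exp2l].
have sl j : s j `^ theta <= level rho j.+1.
  have -> : s j `^ theta = (tau `^ theta) ^+ (2 ^ j).
    rewrite /s -(powR_mulrn _ (ltW t0)) -(powR_mulrn _ (powR_ge0 tau theta)).
    by rewrite -!powRrM mulrC.
  by rewrite lerXn2r // ?nnegrE ?powR_ge0 // (le_trans _ tr) ?powR_ge0.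
pose d j := if j is i.+1 then c (s j) - c (s i) else c (s 0%N).
have Sd m : \sum_(j < m.+1) emb A (d j) = emb A (c (s m)).
  elim: m => [|m IH]; first by rewrite big_ord_recr big_ord0 /= add0r.
  by rewrite big_ord_recr IH /= linearB addrC subrK.
exists d; split.
  move=> j t tp tt.
  have tj : t ^+ (2 ^ j) <= s j by rewrite lerXn2r // nnegrE ltW.
  apply: le_trans (Jfun_mono _ tj) _; case: j tj => [|j] _ /=.
    (* The first term is the difference with the part at 1, which vanishes, so its bound is 1 times
       [b]. *)
    have := h2 (s 0%N) 1 (s0 _) (s1 _) (lexx _).
    by rewrite c1 subr0 powR1.
  apply: le_trans (h2 _ _ (s0 _) (sS _) (s1 _)) _.
  by rewrite ler_wpM2r // sl.
move=> [|m].
  have := h1 1 ltr01 (lexx _); rewrite big_ord0 subr0 c1 subr0 powR1 //.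
rewrite Sd -linearB; apply: le_trans (h1 _ (s0 _) (s1 _)) _.
by rewrite ler_wpM2r // sl.
Qed.

Lemma level_cvg0 rho : 0 <= rho -> rho < 1 -> level rho m @[m --> \oo] --> 0.
Proof.
move=> r0 r1; have cr := cvg_expr (z := rho) ltac:(by rewrite ger0_norm).
apply/cvgrPdist_lt => e e0; have /cvgrPdist_lt/(_ _ e0)[N _ hN] := cr.
exists N.+1 => // -[//|m] /=; rewrite ltnS => Nm.
by apply: hN => /=; rewrite (leq_trans Nm) // ltnW // ltn_expl.
Qed.

Lemma level_summable rho D : 0 <= rho -> rho < 1 -> 0 <= D ->
  exists2 K, 0 < K & forall m, \sum_(j < m) level rho j * D ^+ j <= K.
Proof.
move=> r0 r1 D0; pose w j := level rho j * D ^+ j.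
have w0 j : 0 <= w j by rewrite mulr_ge0 ?exprn_ge0 ?level_ge0.
have D1 : 0 < 2 * (D + 1) by rewrite mulr_gt0 // ltr_wpDl.
have cr := level_cvg0 r0 r1.
(* Below this threshold the ratio [level rho j * D] is at most 1/2, also when [D] is large. *)
have /cvgrPdist_lt/(_ (2 * (D + 1))^-1) := cr.
rewrite invr_gt0 => /(_ D1) [N _ hN].
(* the ratio of consecutive terms is [level rho j * D] *)
have ratio j : (N <= j)%N -> (0 < j)%N -> w j.+1 <= w j / 2.
  case: j => // j /hN /=; rewrite sub0r normrN ger0_norm ?exprn_ge0 // => hj _.
  rewrite /w /= expnS mul2n -addnn exprD [D ^+ j.+2]exprS.
  rewrite mulrACA mulrAC -!mulrA ler_wpM2l ?exprn_ge0 // mulrCA ler_wpM2l ?exprn_ge0 //.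
  apply: (@le_trans _ _ ((2 * (D + 1))^-1 * D)); first by rewrite ler_wpM2r // ltW.
  by rewrite invfM -mulrA ler_piMr ?invr_ge0 // mulrC ler_pdivrMr ?ltr_wpDl // mul1r lerDl.
(* Each level is the square of the preceding one only from index 1 on, so the tail starts after
   0. *)
pose M := N.+1.
have tail m : \sum_(j < m) w (M + j)%N <= 2 * w M.
  (* Strengthened for the induction: the next term plus half of the tail so far never exceeds [w M],
     since halving pays for each new term. *)
  suff h : w (M + m)%N + \sum_(j < m) w (M + j)%N * 2^-1 <= w M.
    rewrite -mulr_suml in h; rewrite mulrC -ler_pdivrMr // (le_trans _ h) // lerDr.
    exact: w0.
  elim: m => [|m IH]; first by rewrite big_ord0 addn0 addr0.
  rewrite big_ord_recr /= addnS (le_trans _ IH) //.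
  rewrite [_ + w _ * _]addrC addrA lerD2r.
  have := ratio (M + m)%N; rewrite (leq_trans (leqnSn N)) ?leq_addr // => /(_ isT isT) h.
  by rewrite (le_trans (lerD h (lexx _))) // -mulr2n -[_ *+ 2]mulr_natr divfK.
exists (\sum_(j < M) w j + 2 * w M + 1).
  by apply: ltr_wpDl => //; apply: addr_ge0; [exact: sumr_ge0|rewrite mulr_ge0].
move=> m; rewrite (le_trans (y := \sum_(j < M + m) w j)) //.
  rewrite -[leLHS]/(\sum_(j < m) w j) (sum_ord_cat w (leq_addl M m)) lerDl.
  by apply: sumr_ge0.
rewrite big_split_ord /= -addrA lerD2l (le_trans (tail m)) // lerDl //.
Qed.

End Decomposition.

(** * J-norms of integrals of decomposable elements *)

Section JNormOfDecompositions.
Context {R : realType} (A : ordered_pair R) (G : J_parameter R).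
Local Notation mu := (@lebesgue_measure R).
Local Notation I := (`]0, 1]%classic : set R).
Implicit Types (f : nat -> sp1 A) (nu : R -> nat).

Lemma J_norm0 : (J_norm A G 0%R <= 0%:E)%E.
Proof.
have r0 : represents I (fun=> 0 : sp1 A) 0.
  split; first exact: strong0.
  apply: (bochner_eq _ (bochner0 measurable_I measure_I_lty)) => t _.
  by rewrite linear0 scaler0.
apply: (le_trans (J_norm_le G r0)); under eq_fun do rewrite Jfun0.
have -> : (fun=> 0 : R) = (fun t : R => 0 * (0 : R)) by apply/funext => t; rewrite mul0r.
by rewrite (pnormZ G 0 (fun=> 0)) normr0 mul0e.
Qed.

Lemma J_normZ_le x k (b : R) : (J_norm A G x <= b%:E)%E ->
  (J_norm A G (k *: x)%R <= (`|k| * b)%:E)%E.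
Proof. by move=> h; have := J_norm_lin k J_norm0 h; rewrite !add0r. Qed.

Lemma J_normD_le x y (a b : R) : (J_norm A G x <= a%:E)%E ->
  (J_norm A G y <= b%:E)%E -> (J_norm A G (x + y)%R <= (a + b)%:E)%E.
Proof. by move=> h h'; have := J_norm_lin 1 h h'; rewrite scale1r normr1 mul1r. Qed.

(** The exponent and the cell bound may change with the index; only [rho] is common, and it alone
    governs the levels. Thus [K] depends on [rho] and the operator bound, but not on the
    decompositions. *)
Lemma J_norm_far rho : sqrt_bounded G -> 0 <= rho -> rho < 1 -> exists2 K, 0 < K &
  forall f nu x (b : nat -> R), measurable_index nu ->
    represents I (fun t => f (nu t)) x -> (forall n, 0 <= b n) ->
    (G (fun t => b (nu t)) < +oo)%E ->
    (forall n, f n = 0 \/ exists theta tau, [/\ 0 < tau, tau <= 1, tau `^ theta <= rho,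
       decomposition theta (b n) (f n) & forall t, I t -> nu t = n -> t <= tau]) ->
    (J_norm A G x <= K%:E * G (fun t => b (nu t)))%E.
Proof.
move=> [C0 hC0] r0 r1; pose C := Num.max C0 0.
have C_ge0 : 0 <= C by rewrite le_max lexx orbT.
have hC h : (G h < +oo)%E -> (G (fun t => h (Num.sqrt t)) <= C%:E * G h)%E.
  move=> /hC0 /le_trans; apply; rewrite lee_wpmul2r ?pnorm_ge0 // lee_fin.
  by rewrite le_max lexx.
have C2 : 0 <= C / 2 by rewrite divr_ge0.
have [K K0 hK] := level_summable r0 r1 C2.
exists K => // f nu x b mnu rx b0 Gb H.
have /choice[d hd] : forall n, exists d : nat -> sp1 A,
    (forall j t, I t -> nu t = n -> Jfun (d j) (t ^+ (2 ^ j)) <= level rho j * b n) /\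
    (forall m, `|emb A (f n) - \sum_(j < m) emb A (d j)| <= level rho m * b n).
  move=> n; have [f0|[theta [tau [t0 t1 tr D ht]]]] := H n.
    exists (fun=> 0); split => [j t _ _|m].
      by rewrite Jfun0 mulr_ge0 // level_ge0.
    rewrite f0 big1 => [|i _]; last by rewrite linear0.
    by rewrite linear0 subrr normr0 mulr_ge0 // level_ge0.
  have [d [h1 h2]] := decomposition_levels t0 t1 tr D.
  by exists d; split => // j t It tn; apply: h1; [exact: I_gt0|exact: ht].
apply: (@J_norm_levels _ A G C C_ge0 hC f nu x (fun j n => d n j) b (level rho) (level rho)) => //.
- by move=> j; exact: level_ge0.
- by move=> j; exact: level_ge0.
- by move=> j t It; have [h _] := hd (nu t); exact: h.
- by move=> m t It; have [_ h] := hd (nu t); exact: h.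
- exact: level_cvg0.
Qed.

(** Here each value is estimated separately, without any gain from its position: [x] is the series
    of the values weighted by the masses of the level sets, and countable subadditivity turns the
    bounds into an integral. *)
Lemma J_norm_index_sum f nu x (b : nat -> R) K : measurable_index nu ->
  represents I (fun t => f (nu t)) x -> (forall n, 0 <= b n) -> 0 <= K ->
  (\int[mu]_(t in I) (t^-1 * b (nu t))%:E < +oo)%E ->
  (forall n, (J_norm A G (emb A (f n)) <= (K * b n)%:E)%E) ->
  (J_norm A G x <= K%:E * \int[mu]_(t in I) (t^-1 * b (nu t))%:E)%E.
Proof.
move=> mnu rx b0 K0 Ib hf.
have tb0 t : I t -> 0 <= t^-1 * b (nu t).
  by move=> /I_gt0 t0; rewrite mulr_ge0 // invr_ge0 ltW.
have Ifin : (\int[mu]_(t in I) (t^-1 * b (nu t))%:E)%E \is a fin_num.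
  by rewrite ge0_fin_numE // integral_ge0 // => t /tb0; rewrite lee_fin.
rewrite -(fineK Ifin) -EFinM.
set m := fun i : nat => (\int[mu]_(t in I) (t^-1 * (nu t == i)%:R)%:E)%E.
have ti0 i t : I t -> 0 <= t^-1 * (nu t == i)%:R.
  by move=> /I_gt0 t0; rewrite mulr_ge0 // invr_ge0 ltW.
have m0 i : (0 <= m i)%E by apply: integral_ge0 => t /ti0; rewrite lee_fin.
have mti i : measurable_fun I (fun t => t^-1 * (nu t == i)%:R).
  apply: measurable_funM; first exact: measurable_inv_I.
  exact: (measurable_index_fun (fun n => (n == i)%:R) mnu).
apply: (@J_norm_series_le _ _ _ (fun i => fine (m i) *: emb A (f i)) x
  (fun i => fine (m i) * (K * b i))).
- move=> i; have := J_normZ_le (fine (m i)) (hf i).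
  by rewrite ger0_norm // fine_ge0.
- move=> n; rewrite (eq_bigr (fun i : 'I_n => K * (fine (m i) * b i))); last first.
    by move=> i _; rewrite mulrCA.
  rewrite -mulr_sumr ler_wpM2l // -lee_fin fineK //.
  apply: (@le_trans _ _ (\int[mu]_(t in I) (\sum_(i < n) b i * (t^-1 * (nu t == i)%:R))%:E)%E).
    under [leRHS]eq_integral do rewrite -sumEFin.
    rewrite -sumEFin ge0_integral_sum //; last 2 first.
    + move=> i; apply/measurable_EFinP; apply: measurable_funM.
        exact: measurable_cst.
      exact: mti.
    + by move=> i t It; rewrite lee_fin mulr_ge0 // ti0.
    apply: lee_sum => i _; rewrite integralZ_EFin_ge0 //; last exact: ti0.
    (* If the mass is infinite, its [fine] part is 0 and the inequality is trivial. *)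
    rewrite -/(m i); move: (m0 i); case: (m i) => [r _| |//] /=.
      by rewrite -EFinM mulrC.
    by move=> _; rewrite mul0r mule_ge0 // ?lee_fin // leey.
  apply: le_integral_EFin; [exact: measurable_I| | |].
  + by apply: measurable_sum => i; exact: measurable_funM.
  + by apply: measurable_funM; [exact: measurable_inv_I|exact: measurable_index_fun].
  + move=> t It; rewrite sumr_ge0 /=; last by move=> i _; rewrite mulr_ge0 // ti0.
    have [tn|nt] := ltnP (nu t) n.
      rewrite (bigD1 (Ordinal tn)) //= eqxx mulr1 mulrC big1 ?addr0 // => j.
      by rewrite -val_eqE /= eq_sym => /negbTE ->; rewrite !mulr0.
    rewrite big1 ?tb0 // => i _; rewrite gtn_eqF ?mulr0 //.
    exact: leq_trans (ltn_ord i) nt.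
- exact: represents_series.
Qed.

(** A multiple of [a] is the integral of the constant [a] over (e^-2, e^-1]. On this cell the power
    [tau^theta] with tau = e^-1 is at most [rho], so [J_norm_far] applies; the cell stays away from
    0, so its indicator lies in [G]. *)
Lemma J_norm_single rho theta : sqrt_bounded G -> rho < 1 ->
  expR (- 1) `^ theta <= rho -> exists2 K, 0 < K & forall a b,
    decomposition theta b a -> (J_norm A G (emb A a) <= (K * b)%:E)%E.
Proof.
move=> sG r1 hr; have r0 : 0 <= rho by rewrite (le_trans _ hr) // powR_ge0.
have [K K0 hK] := J_norm_far sG r0 r1.
pose tau : R := expR (- 1); pose E := `]expR (- 2), tau]%classic : set R.
have t0 : 0 < tau by exact: expR_gt0.
have t1 : tau <= 1 by rewrite /tau -[leRHS]expR0 ler_expR oppr_le0.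
have mE : measurable E by exact: measurable_itv.
have EI : E `<=` I.
  move=> t; rewrite /E /= !in_itv /= => /andP[h1 h2].
  by rewrite (lt_trans _ h1) ?expR_gt0 //= (le_trans h2).
pose nu t : nat := t \in E.
have mnu : measurable_index nu.
  move=> n; case: n => [|[|n]].
  - rewrite (_ : _ `&` _ = I `\` E); first by apply: measurableD => //; exact: measurable_I.
    apply/seteqP; split => t [It] /=; rewrite /nu.
      by case: (boolP (t \in E)) => // /negP h _; split => // /mem_set.
    by move=> Et; split => //; rewrite memNset.
  - rewrite (_ : _ `&` _ = E) //; apply/seteqP; split => t.
      by move=> [It] /=; rewrite /nu; case: (boolP (t \in E)) => // /set_mem.
    by move=> Et; split; [exact: EI|rewrite /= /nu mem_set].
  - rewrite (_ : _ `&` _ = set0) //; apply/seteqP; split => t // [_] /=.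
    by rewrite /nu; case: (t \in E).
have mh : measurable_fun I (fun t => t^-1 * (nu t)%:R).
  apply: measurable_funM; first exact: measurable_inv_I.
  exact: (measurable_index_fun (fun n => n%:R)).
have h0 t : I t -> 0 <= t^-1 * (nu t)%:R.
  by move=> /I_gt0 tp; rewrite mulr_ge0 // invr_ge0 ltW.
have nuE t : I t -> t^-1 * (nu t)%:R <= expR 2.
  move=> It; rewrite /nu; case: (boolP (t \in E)) => [/set_mem|_]; last by rewrite mulr0 expR_ge0.
  rewrite /E /= in_itv /= => /andP[h1 _]; rewrite mulr1 -[leRHS]invrK -expRN.
  by rewrite lef_pV2 ?posrE ?expR_gt0 ?ltW // (I_gt0 It).
have fI (c : R) : 0 <= c -> (\int[mu]_(t in I) c%:E < +oo)%E.
  move=> c0; rewrite integral_cst; last exact: measurable_I.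
  rewrite lte_mul_pinfty ?lee_fin //; exact: measure_I_lty.
have ih : (\int[mu]_(t in I) (t^-1 * (nu t)%:R)%:E < +oo)%E.
  apply: le_lt_trans (fI (expR 2) (expR_ge0 _)); apply: le_integral_EFin => //.
  by move=> t It; rewrite h0 // nuE.
set m := fine (\int[mu]_(t in I) (t^-1 * (nu t)%:R)%:E)%E.
have m0 : 0 < m.
  rewrite -lte_fin fineK; last first.
    by rewrite ge0_fin_numE // integral_ge0 // => t /h0; rewrite lee_fin.
  apply: (@lt_le_trans _ _ (mu E)).
    rewrite lebesgue_measure_itv /= lte_fin ltr_expR ltrN2 ltr1n -EFinB lte_fin.
    by rewrite subr_gt0 ltr_expR ltrN2 ltr1n.
  rewrite -(setIidl EI) -integral_indic //.
  apply: le_integral_EFin => // t It; rewrite ler0n /= indicE /nu.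
  by rewrite ler_peMl // invf_ge1 ?I_gt0 // I_le1.
pose one t : R := (nu t)%:R.
have m1 : measurable_fun I one by exact: (measurable_index_fun (fun n => n%:R)).
have G1 : (G one < +oo)%E.
  have [c c0 hc] := pnorm_L1w G; apply: le_lt_trans (hc _ m1) _.
  rewrite lte_mul_pinfty ?lee_fin ?(ltW c0) //.
  apply: le_lt_trans (fI (expR 2 ^+ 2) (sqr_ge0 _)); apply: le_integral_EFin => //.
    apply: measurable_funM; first exact: measurableT_comp.
    rewrite (_ : (fun t => _) = fun t => (t^-1) ^+ 2).
      by apply: measurable_funX; exact: measurable_inv_I.
    by apply/funext => t; rewrite exprVn.
  move=> t It; rewrite divr_ge0 ?sqr_ge0 //= ger0_norm ?ler0n //.
  have := nuE t It; rewrite /one /nu; case: (t \in E); rewrite ?mul0r ?exprn_ge0 ?expR_ge0 //.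
  rewrite mulr1 mul1r -exprVn => h.
  by rewrite lerXn2r // nnegrE ?expR_ge0 ?invr_ge0 ?(ltW (I_gt0 It)).
(* Adding 1 makes the constant positive without a lower bound for the norm of [one]. *)
exists (m^-1 * (K * fine (G one)) + 1).
  rewrite ltr_wpDl // mulr_ge0 ?invr_ge0 ?(ltW m0) // mulr_ge0 ?(ltW K0) //.
  by rewrite fine_ge0 // pnorm_ge0.
move=> a b D; have b0 := decomposition_ge0 D.
pose f n : sp1 A := if n == 1%N then a else 0.
pose bb n : R := if n == 1%N then b else 0.
have bnu t : bb (nu t) = b * one t.
  by rewrite /bb /one /nu; case: (t \in E); rewrite /= ?mulr1 ?mulr0.
have rx : represents I (fun t => f (nu t)) (m *: emb A a).
  split; first exact: strong_index.
  have := @bochner_scale_cst _ (sp0 A) I _ (emb A a) measurable_I measure_I_lty mh h0 ih.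
  apply: bochner_eq => t _; rewrite -scalerA /f /nu.
  by case: (t \in E); congr (_ *: _); rewrite ?scale1r //= scale0r linear0.
have Gb : (G (fun t => bb (nu t)) <= (b * fine (G one))%:E)%E.
  under eq_fun do rewrite bnu.
  rewrite pnormZ ger0_norm // EFinM fineK //.
  by rewrite ge0_fin_numE // pnorm_ge0.
have Jx : (J_norm A G (m *: emb A a)%R <= (K * (b * fine (G one)))%:E)%E.
  apply: (le_trans (hK f nu _ bb mnu rx _ _ _)).
  - by move=> n; rewrite /bb; case: eqP.
  - exact: le_lt_trans Gb (ltry _).
  - move=> n; rewrite /f /bb; case: eqP => [n1|_]; [right|by left].
    exists theta, tau; split => // t It; rewrite n1 /nu.
    by case: (boolP (t \in E)) => // /set_mem; rewrite /E /= in_itv /= => /andP[].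
  - by rewrite [leRHS]EFinM lee_wpmul2l // lee_fin ltW.
have := J_normZ_le m^-1 Jx; rewrite scalerA mulVf ?gt_eqF // scale1r.
move=> /le_trans; apply; rewrite lee_fin ger0_norm ?invr_ge0 ?(ltW m0) //.
by rewrite mulrDl mul1r -!mulrA [fine _ * b]mulrC lerDl.
Qed.

End JNormOfDecompositions.

(** * From pointwise decompositions to J-representations *)

Section Exponent.
Context {R : realType}.
Implicit Types t : R.

Lemma xiE t : 0 < t -> xi t = (2 * (1 - ln t))^-1.
Proof. by move=> t0; rewrite /xi ln_div ?posrE ?expR_gt0 // expRK. Qed.

Lemma one_sub_ln_ge1 t : 0 < t -> t <= 1 -> 1 <= 1 - ln t.
Proof. by move=> t0 t1; rewrite lerDl oppr_ge0 ln_le0. Qed.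

Lemma xi_gt0 t : 0 < t -> t <= 1 -> 0 < xi t.
Proof.
move=> t0 t1; rewrite xiE // invr_gt0 mulr_gt0 //.
exact: lt_le_trans (one_sub_ln_ge1 t0 t1).
Qed.

Lemma xi_le_half t : 0 < t -> t <= 1 -> xi t <= 2^-1.
Proof.
move=> t0 t1; have h := one_sub_ln_ge1 t0 t1.
by rewrite xiE // lef_pV2 ?posrE ?mulr_gt0 ?(lt_le_trans _ h) // ler_peMr.
Qed.

Lemma xi_ge (c t : R) : 0 < t -> t <= 1 -> expR (- c) < t -> (2 * (1 + c))^-1 <= xi t.
Proof.
move=> t0 t1 ct; have h := one_sub_ln_ge1 t0 t1.
have : - c < ln t by rewrite -ltr_expR lnK.
move=> cl; have h' : 1 - ln t <= 1 + c by rewrite lerD2l lerNl ltW.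
rewrite xiE // lef_pV2 ?posrE ?mulr_gt0 ?(lt_le_trans _ h) //.
  by rewrite ler_pM2l.
by rewrite (lt_le_trans _ h') // (lt_le_trans _ h).
Qed.

Lemma expR_powR (x y : R) : expR x `^ y = expR (y * x).
Proof. by rewrite /powR gt_eqF ?expR_gt0 // expRK. Qed.

End Exponent.

Section FirstIndex.
Context {R : realType}.
Local Notation I := (`]0, 1]%classic : set R).

(** Taking the first admissible index is a measurable selection: its level sets are differences of
    measurable sets. *)
Lemma measurable_first_index (P : nat -> R -> bool) :
  (forall n, measurable (I `&` [set t | P n t])) ->
  (forall t, I t -> exists n, P n t) ->
  exists nu, measurable_index nu /\ forall t, I t -> P (nu t) t.
Proof.
move=> mP eP.
pose nu t := if pselect (exists n, P n t) is left h then ex_minn h else 0%N.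
have nuP t : I t -> P (nu t) t /\ forall j, (j < nu t)%N -> ~~ P j t.
  move=> It; rewrite /nu; case: pselect => [h|/(_ (eP t It))//].
  case: ex_minnP => m Pm hm; split => // j jm; apply/negP => /hm.
  by rewrite leqNgt jm.
exists nu; split; last by move=> t /nuP[].
move=> n; rewrite (_ : _ `&` _ = (I `&` [set t | P n t]) `\`
  \bigcup_(j in [set j | (j < n)%N]) (I `&` [set t | P j t])).
  by apply: measurableD => //; apply: bigcup_measurable.
apply/seteqP; split => t.
  move=> [It /= nt]; have [h1 h2] := nuP t It; rewrite nt in h1 h2.
  by split => // -[j /= jn [_ /=]]; apply/negP; exact: h2.
move=> [[It /= Pt] h]; split => //=; have [h1 h2] := nuP t It.
apply/eqP; rewrite eqn_leq; apply/andP; split; rewrite leqNgt; apply/negP => lt.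
  by have := h2 _ lt; rewrite Pt.
by apply: h; exists (nu t).
Qed.

End FirstIndex.

Section Core.
Context {R : realType} (A : ordered_pair R) (G : J_parameter R).
Local Notation mu := (@lebesgue_measure R).
Local Notation I := (`]0, 1]%classic : set R).

Lemma near_inf (g : R -> R) (S : set R) (e : R) : S !=set0 -> (forall t, S t -> 0 <= g t) ->
  0 < e -> exists2 t, S t & forall t', S t' -> g t <= g t' + e.
Proof.
move=> [t0 St0] g0 e0; have hi : has_inf (g @` S).
  by split; [exists (g t0), t0|exists 0 => _ [t St <-]; exact: g0].
have [_ [t St <-] h] := inf_adherent e0 hi.
exists t => // t' St'; apply: (le_trans (ltW h)); rewrite lerD2r.
by apply: ge_inf; [exact: hi.2|exists t'].
Qed.

Lemma exp_cell (t : R) : I t -> exists k : nat,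
  (expR (- k.+1%:R) < t) && (t <= expR (- k%:R)).
Proof.
move=> It; have t0 := I_gt0 It.
have l0 : 0 <= - ln t by rewrite oppr_ge0 ln_le0 // I_le1.
exists (Num.truncn (- ln t)).
have /andP[h1 h2] := truncn_itv l0.
set k := Num.truncn _ in h1 h2 *; rewrite -(lnK t0) ltr_expR ler_expR.
by rewrite ltrNl h2 lerNr h1.
Qed.

Lemma measure_I1 : mu I = 1%E.
Proof. by rewrite lebesgue_measure_itv /= lte_fin ltr01 oppr0 adde0. Qed.

(** The function t^2 has integral 1 in L^1(1/t), hence finite norm in [G]. It is the gauge for
    discretisation errors: an error below eps t^2 in A_1 changes the J-norm by a multiple of eps. *)
Lemma pnorm_sqr : exists2 C : R, 0 < C & (G (fun t => t ^+ 2)%R <= C%:E)%E.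
Proof.
have [c c0 hc] := pnorm_L1w G.
have m2 : measurable_fun I (fun t : R => t ^+ 2) by exact: measurable_funX.
exists c => //; apply: le_trans (hc _ m2) _.
rewrite (_ : (\int[mu]_(t in I) _ = \int[mu]_(t in I) 1)%E); last first.
  apply: eq_integral => t /set_mem It; rewrite ger0_norm ?sqr_ge0 // divff //.
  by rewrite gt_eqF // exprn_gt0 // I_gt0.
rewrite integral_cst; last exact: measurable_I.
by rewrite mul1e [X in (_ * X)%E](_ : _ = 1%E) ?mule1 //; exact: measure_I1.
Qed.

Lemma J_norm_small (e : R -> sp1 A) x (eps C : R) : (G (fun t => t ^+ 2)%R <= C%:E)%E ->
  0 <= eps -> strongly_measurable I e -> (forall t, I t -> `|e t| <= eps * t ^+ 2) ->
  represents I e x -> (J_norm A G x <= (eps * C)%:E)%E.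
Proof.
move=> hC e0 se he re; apply: (le_trans (J_norm_le G re)).
apply: (@le_trans _ _ (G (fun t => eps * t ^+ 2))).
  apply: pnorm_le; first by apply: measurable_Jfun => //; exact: measurable_I.
  move=> t It; have t0 : 0 <= t by rewrite ltW // I_gt0.
  rewrite !ger0_norm ?Jfun_ge0 ?mulr_ge0 ?sqr_ge0 //.
  by apply: le_trans (he t It); apply: Jfun_le_norm; rewrite t0 I_le1.
rewrite [leLHS](pnormZ G eps (fun t => t ^+ 2)) ger0_norm // EFinM.
by apply: lee_wpmul2l.
Qed.

Lemma represents_small (e : R -> sp1 A) (eps : R) : 0 <= eps ->
  strongly_measurable I e -> (forall t, I t -> `|e t| <= eps * t ^+ 2) ->
  exists x, represents I e x.
Proof.
move=> e0 se he; apply: represents_exists => //.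
apply: (@le_lt_trans _ _ (\int[mu]_(t in I) eps%:E)%E).
  apply: le_integral_EFin; [exact: measurable_I| |exact: measurable_cst|].
    apply: measurable_funM; first exact: measurable_inv_I.
    by apply: measurable_norm_strong; [exact: measurable_I|exact: strong_emb].
  move=> t It; have t0 := I_gt0 It; rewrite mulr_ge0 ?invr_ge0 ?(ltW t0) //=.
  rewrite ler_pdivrMl // (le_trans (emb_le _)) // (le_trans (he t It)) //.
  by rewrite mulrC ler_wpM2r // expr2 ler_piMl ?(ltW t0) // I_le1.
rewrite integral_cst; last exact: measurable_I.
rewrite lte_mul_pinfty ?lee_fin //; exact: measure_I_lty.
Qed.

Lemma J_norm_core : sqrt_bounded G -> exists2 K, 0 < K & forall u x (g : R -> R),
  represents I u x -> (G g < +oo)%E -> (forall t, I t -> 0 <= g t) ->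
  (forall t e, I t -> 0 < e -> decomposition (xi t) (g t + e) (u t)) ->
  (J_norm A G x <= K%:E * G g)%E.
Proof.
move=> sG.
(* On the cell (e^(-k-1), e^-k] the exponent [xi] is at least 1/(2(k + 2)), and (e^-k)^(1/(2(k +
   2))) is largest over k >= 1 at k = 1, where it equals e^(-1/6). *)
pose rho : R := expR (- 6^-1).
have r0 : 0 <= rho by exact: expR_ge0.
have r1 : rho < 1 by rewrite /rho -[ltRHS]expR0 ltr_expR oppr_lt0 invr_gt0.
have [Kf Kf0 hKf] := J_norm_far A sG r0 r1.
have hr : expR (- 1) `^ 6^-1 <= rho by rewrite expR_powR mulrN1.
have [Kn Kn0 hKn] := J_norm_single A sG r1 hr.
have [C0 C0p hC0] := pnorm_sqr.
have [c1 c1p hc1] := pnorm_L1 G.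
exists (Kf + Kn * c1); first by rewrite addr_gt0 // mulr_gt0.
move=> u x g ru Gg g0 Dg.
have su : strongly_measurable I u by case: ru.
have mg := pnorm_fin_meas Gg.
have [d hd] := strong_dense_values measurable_I su.
have Gfin : G g \is a fin_num by rewrite ge0_fin_numE // pnorm_ge0.
suff main eps : 0 < eps -> (J_norm A G x <=
    ((Kf + Kn * c1) * (fine (G g) + 3 * eps * C0) + eps * C0)%:E)%E.
  rewrite -(fineK Gfin) -EFinM; apply/lee_addgt0Pr => e e0.
  have p0 : 0 < (Kf + Kn * c1) * (3 * C0) + C0.
    by rewrite addr_gt0 // !mulr_gt0 // addr_gt0 // mulr_gt0.
  have := main (e / ((Kf + Kn * c1) * (3 * C0) + C0)) (divr_gt0 e0 p0).
  rewrite -EFinD; congr (_ <= _%:E)%E.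
  by field; rewrite gt_eqF.
move=> eps0.
(* The index of t codes a pair (i, k): t lies in the cell of [k], and [u t] is
   within [eta k] of [d i].  The cell of [k = 0] is treated separately. *)
pose eta (k : nat) : R := eps * expR (- k.+1%:R) ^+ 2.
have eta0 k : 0 < eta k by rewrite mulr_gt0 // exprn_gt0 // expR_gt0.
pose idx n : nat * nat := odflt (0, 0)%N (unpickle n).
pose P n t := [&& expR (- (idx n).2.+1%:R) < t, t <= expR (- (idx n).2%:R) &
  `|u t - d (idx n).1| < eta (idx n).2].
have [nu [mnu hnu]] : exists nu, measurable_index nu /\ forall t, I t -> P (nu t) t.
  apply: measurable_first_index => [n|t It].
    rewrite (_ : _ `&` _ = (I `&` `]expR (- (idx n).2.+1%:R), expR (- (idx n).2%:R)]) `&`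
      (I `&` [set t | `|u t - d (idx n).1| < eta (idx n).2])).
      apply: measurableI; first by apply: measurableI; exact: measurable_itv.
      have mn := measurable_norm_sub (d (idx n).1) measurable_I su.
      exact: (measurable_fun_ltr mn (measurable_cst (eta (idx n).2)) measurable_I
        (Y := [set true])).
    apply/seteqP; split => t.
      by move=> [It /and3P[h1 h2 h3]]; split; split => //; rewrite /= in_itv /= h1.
    move=> [[It]]; rewrite /= in_itv /= => /andP[h1 h2] [_ h3].
    by split => //; apply/and3P.
  have [k /andP[h1 h2]] := exp_cell It.
  have [i hi] := hd t It _ (eta0 k).
  by exists (pickle (i, k)); rewrite /P /idx pickleK /= h1 h2.
have etat t : I t -> eta (idx (nu t)).2 <= eps * t ^+ 2.
  move=> It; have /and3P[h _ _] := hnu t It; rewrite ler_wpM2l ?(ltW eps0) //.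
  by rewrite lerXn2r ?nnegrE ?expR_ge0 ?ltW // I_gt0.
pose f n := d (idx n).1.
have sf : strongly_measurable I (fun t => f (nu t)) by exact: strong_index.
pose e t := u t - f (nu t).
have se : strongly_measurable I e by exact: strong_sub.
have he t : I t -> `|e t| <= eps * t ^+ 2.
  by move=> It; have /and3P[_ _ /ltW h] := hnu t It; exact: le_trans h (etat t It).
have [xe re] := represents_small (ltW eps0) se he.
have r0' : represents I (fun t => f (nu t)) (x - xe).
  have := represents_lin (-1) ru re; rewrite scaleN1r.
  by apply: represents_eq => t _; rewrite /e scaleN1r opprB addrC subrK.
(* On a level set that occurs, [b n] is a nearly minimal value of [g] plus two errors [eta]: one for
   the slack in the hypothesis, one for replacing [u t] by [f n]. The third [eta] in the upper bound
   pays for the infimum not being attained. *)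
have /choice[b hb] : forall n, exists b : R, [/\ 0 <= b,
    (forall t, I t -> nu t = n -> b <= g t + 3 * eta (idx n).2) &
    (exists2 t, I t & nu t = n) -> exists t, [/\ I t, nu t = n & decomposition (xi t) b (f n)]].
  move=> n; have e0 := eta0 (idx n).2.
  have [ne|ne] := pselect (exists2 t, I t & nu t = n); last first.
    exists 0; split => // t It nt; first by rewrite addr_ge0 ?g0 // mulr_ge0 // ltW.
  have [||t [It nt] ht] := @near_inf g [set t | I t /\ nu t = n] (eta (idx n).2) _ _ e0.
  - by case: ne => t It nt; exists t.
  - by move=> t [It _]; exact: g0.
  exists (g t + 2 * eta (idx n).2); split.
  - by rewrite addr_ge0 ?g0 // mulr_ge0 // ltW.
  - move=> t' It' nt'; have := ht t' (conj It' nt').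
    set y := eta _; lra.
  - move=> _; exists t; split => //.
    have D1 := Dg t _ It e0.
    have D2 : decomposition (xi t) (eta (idx n).2) (f n - u t).
      have tl : xi t <= 1.
        by apply: le_trans (xi_le_half (I_gt0 It) (I_le1 It)) _; lra.
      apply: (decomposition_mono (lexx _) _ (decomposition_norm _ tl)).
      by rewrite distrC; have /and3P[_ _ /ltW] := hnu t It; rewrite nt.
    have := decompositionD D1 D2; rewrite [u t + _]addrC subrK -addrA => D.
    by apply: (decomposition_mono (lexx _) _ D); rewrite lerD2l mulr2n mulrDl mul1r.
have b0 n : 0 <= b n by have [] := hb n.
have bg t : I t -> b (nu t) <= g t + 3 * eps * t ^+ 2.
  move=> It; have [_ h _] := hb (nu t); apply: (le_trans (h t It erefl)).
  by rewrite lerD2l -mulrA ler_wpM2l // etat.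
have mb : measurable_fun I (fun t => b (nu t)) by exact: measurable_index_fun.
have Gb : (G (fun t => b (nu t)) <= (fine (G g) + 3 * eps * C0)%:E)%E.
  apply: (@le_trans _ _ (G (g \+ (fun t => 3 * eps * t ^+ 2)))).
    apply: pnorm_le => // t It; rewrite ger0_norm // (le_trans (bg t It)) //.
    exact: ler_norm.
  apply: (le_trans (pnormD G _ _)); rewrite EFinD fineK // leeD2l //.
  have e30 : 0 <= 3 * eps by rewrite mulr_ge0 // ltW.
  rewrite [leLHS](pnormZ G (3 * eps) (fun t => t ^+ 2)) ger0_norm // (EFinM (3 * eps) C0).
  by apply: lee_wpmul2l; rewrite // lee_fin.
set B := fine (G g) + 3 * eps * C0 in Gb *.
have Gblt : (G (fun t => b (nu t)) < +oo)%E by exact: le_lt_trans Gb (ltry _).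
(* Indices that never occur belong to neither class and get the value 0, because no decomposition is
   at hand for them. *)
pose far n := `[< (exists2 t, I t & nu t = n) /\ (idx n).2 <> 0%N >].
pose near n := `[< (exists2 t, I t & nu t = n) /\ (idx n).2 = 0%N >].
pose ff n := if far n then f n else 0.
pose fn n := if near n then f n else 0.
have ffn t : I t -> f (nu t) = ff (nu t) + fn (nu t).
  move=> It; have ex : exists2 t', I t' & nu t' = nu t by exists t.
  rewrite /ff /fn; have [k0|k0] := pselect ((idx (nu t)).2 = 0%N).
    by rewrite /far asboolF ?add0r /near; [rewrite asboolT|case].
  by rewrite /far asboolT // /near asboolF ?addr0 // => -[].
have [xf rf] : exists y, represents I (fun t => ff (nu t)) y.
  apply: represents_exists; first exact: strong_index.
  apply: le_lt_trans (represents_integrable r0'); apply: le_integral_EFin.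
  - exact: measurable_I.
  - apply: measurable_funM; first exact: measurable_inv_I.
    exact: (measurable_index_fun (fun n => `|emb A (ff n)|)).
  - apply: measurable_funM; first exact: measurable_inv_I.
    exact: (measurable_index_fun (fun n => `|emb A (f n)|)).
  - move=> t It; have t0 : 0 <= t^-1 by rewrite invr_ge0 ltW // I_gt0.
    rewrite mulr_ge0 //= ler_wpM2l // /ff; case: ifP => // _.
    by rewrite linear0 normr0.
have rn : represents I (fun t => fn (nu t)) (x - xe - xf).
  have := represents_lin (-1) r0' rf; rewrite scaleN1r.
  by apply: represents_eq => t /set_mem It; rewrite ffn // scaleN1r addrC addKr.
have Jf : (J_norm A G xf <= (Kf * B)%:E)%E.
  apply: (le_trans (hKf _ _ _ b mnu rf b0 Gblt _)); last first.
    by rewrite EFinM lee_wpmul2l // lee_fin ltW.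
  move=> n; rewrite /ff; case: (boolP (far n)) => [/asboolP[ex k0]|_]; [right|by left].
  have [_ _ /(_ ex) [t [It nt D]]] := hb n.
  have /and3P[h1 h2 _] := hnu t It; rewrite nt in h1 h2.
  (* The exponent is the lower bound for [xi] from the left end of the cell, while [tau] is the
     right end. *)
  exists (2 * (1 + (idx n).2.+1%:R))^-1, (expR (- (idx n).2%:R)); split.
  - exact: expR_gt0.
  - by rewrite -[leRHS]expR0 ler_expR oppr_le0.
  - rewrite expR_powR /rho ler_expR mulrN lerN2.
    have k1 : (1 : R) <= (idx n).2%:R by rewrite ler1n lt0n; apply/eqP.
    rewrite -[(idx n).2.+1]addn1 natrD.
    set k : R := (idx n).2%:R in k1 *.
    rewrite mulrC ler_pdivlMr; last by lra.
    lra.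
  - by apply: (decomposition_mono _ (lexx _) D); apply: xi_ge => //; [exact: I_gt0|exact: I_le1].
  - by move=> t' It' nt'; have /and3P[_ h _] := hnu t' It'; rewrite nt' in h.
have Ib : (\int[mu]_(t in I) (t^-1 * b (nu t))%:E <= (c1 * B)%:E)%E.
  have := hc1 _ mb; under eq_integral do rewrite ger0_norm // mulrC.
  by move=> /le_trans; apply; rewrite EFinM lee_wpmul2l // lee_fin ltW.
have Jn : (J_norm A G (x - xe - xf)%R <= (Kn * (c1 * B))%:E)%E.
  apply: (le_trans (J_norm_index_sum mnu rn b0 (ltW Kn0) _ _)).
  - exact: le_lt_trans Ib (ltry _).
  - move=> n; rewrite /fn; case: (boolP (near n)) => [/asboolP[ex k0]|_]; last first.
      rewrite linear0; apply: (le_trans (J_norm0 A G)).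
      by rewrite lee_fin mulr_ge0 // ltW.
    apply: hKn; have [_ _ /(_ ex) [t [It nt D]]] := hb n.
    have /and3P[h1 _ _] := hnu t It; rewrite nt k0 in h1.
    apply: (decomposition_mono _ (lexx _) D).
    (* On the cell of 0 the exponent [xi] is at least 1/4, which exceeds the 1/6 required by
       [hKn]. *)
    have := xi_ge (I_gt0 It) (I_le1 It) h1; apply: le_trans.
    by rewrite lef_pV2 ?posrE //; lra.
  - by rewrite [leRHS]EFinM lee_wpmul2l // lee_fin ltW.
have Je := J_norm_small hC0 (ltW eps0) se he re.
have := J_normD_le (J_normD_le Jf Jn) Je.
rewrite [xf + _]addrC subrK subrK.
by congr (_ <= _%:E)%E; rewrite mulrDl mulrA.
Qed.

End Core.

(** * The norms with parameters theta and q *)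

Section WeightedNorm.
Context {R : realType}.
Local Notation mu := (@lebesgue_measure R).
Local Notation O := (`]0, 1[%classic : set R).
Local Notation I := (`]0, 1]%classic : set R).
Implicit Types (j : R -> R) (q : \bar R) (theta : R).

(** With a scalar function [j] in place of the J-functional, the comparison, the triangle inequality
    and the Hoelder estimate become statements about real functions. *)
Definition weighted_Lq q theta j : \bar R :=
  match q with
  | r%:E => ((\int[mu]_(s in `]0%R, 1%R[) ((s `^ (- theta) * j s) `^ r / s)%:E) `^ r^-1)%E
  | +oo%E => ereal_sup [set (s `^ (- theta) * j s)%:E | s in `]0, 1[]
  | -oo%E => 0%E
  end.

(** For q >= 1 this is 1/q', including q' = +oo at q = 1 and q' = 1 at q = +oo. *)
Definition conj_inv q : R := match q with r%:E => 1 - r^-1 | _ => 1 end.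

Lemma le_poweR (x y : \bar R) (r : R) : 0 <= r -> (0 <= x)%E -> (x <= y)%E ->
  (x `^ r <= y `^ r)%E.
Proof.
move=> r0 x0 xy; apply: gt0_ler_poweR => //.
  by rewrite in_itv /= x0 leey.
by rewrite in_itv /= leey andbT (le_trans x0).
Qed.

Lemma measurable_powR_mul (D : set R) theta j : measurable D -> measurable_fun D j ->
  measurable_fun D (fun s => s `^ (- theta) * j s).
Proof.
move=> mD mj; apply: measurable_funM => //.
apply: (@measurable_funS _ _ _ _ setT) => //; exact: measurable_powR.
Qed.

Lemma measurable_weight (D : set R) theta r j : measurable D -> D `<=` [set s | 0 < s] ->
  measurable_fun D j ->
  measurable_fun D (fun s => (s `^ (- theta) * j s) `^ r / s).
Proof.
move=> mD D0 mj; apply: measurable_funM; last exact: measurable_inv_sub.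
apply: (@measurableT_comp _ _ _ _ _ _ (@powR R ^~ r)); first exact: measurable_powR.
exact: measurable_powR_mul.
Qed.

Lemma measurable_if_lt (D : set R) (sigma : R) (f g : R -> R) : measurable D ->
  measurable_fun D f -> measurable_fun D g ->
  measurable_fun D (fun s => if s < sigma then f s else g s).
Proof.
move=> mD mf mg; apply: measurable_fun_if => //.
- exact: measurable_fun_ltr.
- exact: measurable_funS mf.
- exact: measurable_funS mg.
Qed.

Lemma O_gt0 : O `<=` [set s | 0 < s].
Proof. by move=> s; rewrite /= in_itv /= => /andP[]. Qed.

Lemma weight_ge0 (r s x : R) : 0 < s -> 0 <= x `^ r / s.
Proof. by move=> s0; rewrite divr_ge0 ?powR_ge0 // ltW. Qed.

Lemma weighted_Lq_ge0 q theta j : (forall s, O s -> 0 <= j s) -> (0 <= weighted_Lq q theta j)%E.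
Proof.
move=> j0; case: q => [r| |] //=; first exact: poweR_ge0.
apply: (@le_trans _ _ (2^-1 `^ (- theta) * j 2^-1)%:E).
  rewrite lee_fin mulr_ge0 ?powR_ge0 // j0 //= in_itv /=; apply/andP; lra.
by apply: ereal_sup_ubound; exists 2^-1 => //=; rewrite in_itv /=; apply/andP; lra.
Qed.

Lemma weighted_Lq_le q theta theta' j j' : (1 <= q)%E -> measurable_fun O j ->
  measurable_fun O j' -> (forall s, O s -> 0 <= j s) ->
  (forall s, O s -> s `^ (- theta) * j s <= s `^ (- theta') * j' s) ->
  (weighted_Lq q theta j <= weighted_Lq q theta' j')%E.
Proof.
move=> q1 mj mj' j0 jj'; case: q q1 => [r| |//] r1 /=.
  have r0 : 0 <= r by apply: (le_trans ler01); rewrite -lee_fin.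
  have mO : measurable O by [].
  have w0 th (f : R -> R) : (0 <= \int[mu]_(s in O) ((s `^ (- th) * f s) `^ r / s)%:E)%E.
    by apply: integral_ge0 => s /O_gt0 s0; rewrite lee_fin weight_ge0.
  apply: le_poweR; [by rewrite invr_ge0|exact: w0|].
  apply: le_integral_EFin => //; try by apply: measurable_weight => //; exact: O_gt0.
  move=> s Os; have s0 := O_gt0 Os; rewrite weight_ge0 //= ler_wpM2r ?invr_ge0 ?(ltW s0) //.
  have y0 : 0 <= s `^ (- theta) * j s by rewrite mulr_ge0 ?powR_ge0 ?j0.
  have h := jj' s Os.
  by apply: ge0_ler_powR => //; rewrite nnegrE // (le_trans y0).
apply: ge_ereal_sup => _ [s Os <-]; apply: (@le_trans _ _ (s `^ (- theta') * j' s)%:E).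
  by rewrite lee_fin jj'.
by apply: ereal_sup_ubound; exists s.
Qed.

Lemma integral_powR_le theta (sigma : R) : 0 < theta -> 0 < sigma ->
  (\int[mu]_(s in `]0%R, sigma[) (s `^ (theta - 1))%:E <= (theta^-1 * sigma `^ theta)%:E)%E.
Proof.
move=> th0 s0.
(* The antiderivative is used only away from 0, and the interval is exhausted from the right; n + 2
   keeps the left end strictly below [sigma] from the start. *)
pose F n : set R := `]sigma / n.+2%:R, sigma]%classic.
have F0 n s : F n s -> 0 < s.
  by rewrite /F /= in_itv /= => /andP[h _]; apply: lt_trans h; rewrite divr_gt0.
have mp (D : set R) : measurable D -> measurable_fun D (fun s : R => (s `^ (theta - 1))%:E).
  move=> mD; apply/measurable_EFinP.
  by apply: (measurable_funS measurableT) => //; exact: measurable_powR.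
have ndF : nondecreasing_seq F.
  move=> m n mn; apply/subsetPset => s; rewrite /F /= !in_itv /= => /andP[h ->].
  rewrite andbT; apply: le_lt_trans h.
  by rewrite ler_pM2l // lef_pV2 ?posrE // ler_nat !ltnS.
have h : (\int[mu]_(s in F n) (s `^ (theta - 1))%:E)%E @[n --> \oo] -->
    (\int[mu]_(s in \bigcup_n F n) (s `^ (theta - 1))%:E)%E.
  apply: ge0_nondecreasing_set_cvg_integral => //.
  - by move=> n; exact: measurable_itv.
  - by move=> n; apply: mp; exact: measurable_itv.
  - by move=> n s _; rewrite lee_fin powR_ge0.
apply: (@le_trans _ _ (\int[mu]_(s in \bigcup_n F n) (s `^ (theta - 1))%:E)%E).
  apply: ge0_subset_integral => //.
  - by apply: bigcup_measurable => n _; exact: measurable_itv.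
  - by apply: mp; apply: bigcup_measurable => n _; exact: measurable_itv.
  - by move=> s _; rewrite lee_fin powR_ge0.
  move=> s /=; rewrite in_itv /= => /andP[s0' ss].
  have [n hn] := ltr_add_invr (divr_gt0 s0' s0); rewrite add0r in hn.
  exists n => //; rewrite /F /= in_itv /= (ltW ss) andbT mulrC -ltr_pdivlMr //.
  by apply: lt_trans hn; rewrite ltf_pV2 ?posrE // ltr_nat.
apply: cvge_le h; apply: nearW => n.
have lt : sigma / n.+2%:R < sigma by rewrite gtr_pMr // invf_lt1 // ltr1n.
rewrite [leLHS](_ : _ = (theta^-1 * sigma `^ theta - theta^-1 * (sigma / n.+2%:R) `^ theta)%:E).
  by rewrite lee_fin lerBlDr lerDl mulr_ge0 ?powR_ge0 ?invr_ge0 // ltW.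
apply: (@integral_oc_derive _ (fun s => theta^-1 * s `^ theta)) => //.
  move=> s /andP[h _]; have sp : 0 < s by apply: lt_le_trans h; rewrite divr_gt0.
  have d := is_derive1_powR theta sp.
  apply: is_derive_eq; rewrite /GRing.scale /=.
  by rewrite mulrA mulVf ?mul1r ?gt_eqF.
move=> s /andP[h _]; have sp : 0 < s by apply: lt_le_trans h; rewrite divr_gt0.
apply: differentiable_continuous; apply/derivable1_diffP.
by apply: derivable_powR; rewrite in_itv /= andbT.
Qed.

(** A form of Young's inequality: if y > l, then y = l (y / l) <= l (y / l)^r. *)
Lemma le_add_powR (y l r : R) : 0 <= y -> 0 < l -> 1 <= r -> y <= l + l `^ (1 - r) * y `^ r.
Proof.
move=> y0 l0 r1; have [yl|ly] := leP y l.
  by apply: (le_trans yl); rewrite lerDl mulr_ge0 ?powR_ge0.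
apply: (@le_trans _ _ (l `^ (1 - r) * y `^ r)); last by rewrite lerDr ltW.
have yp : 0 < y by exact: lt_trans ly.
have {1}-> : y = y `^ (1 - r) * y `^ r.
  by rewrite -powRD ?subrK ?powRr1 ?(gt_eqF yp) ?implybT.
rewrite ler_wpM2r ?powR_ge0 // -opprB !powRN lef_pV2 ?posrE ?powR_gt0 //.
by rewrite ge0_ler_powR ?nnegrE ?subr_ge0 // ltW.
Qed.

(** Apart from [sigma^theta], the exponents enter only through theta^(-1/q'), the power that the
    normalising factor compensates. *)
Lemma weighted_Lq_tail q theta j (W sigma : R) : (1 <= q)%E -> 0 < theta ->
  measurable_fun O j -> (forall s, O s -> 0 <= j s) -> 0 < sigma <= 1 ->
  (weighted_Lq q theta j < W%:E)%E ->
  (\int[mu]_(s in `]0%R, sigma[) (s^-1 * j s)%:E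
    <= (2 * theta `^ (- conj_inv q) * sigma `^ theta * W)%:E)%E.
Proof.
move=> q1 th0 mj j0 /andP[s0 s1] jW.
have W0 : 0 < W by rewrite -lte_fin (le_lt_trans (weighted_Lq_ge0 q theta j0)).
have EO : `]0, sigma[ `<=` O.
  by move=> s; rewrite /= !in_itv /= => /andP[-> /lt_le_trans ->].
have mE : measurable (`]0, sigma[%classic : set R) by exact: measurable_itv.
have E0 (s : R) : `]0, sigma[%classic s -> 0 < s by move/EO/O_gt0.
have mjE : measurable_fun `]0, sigma[ j by apply: measurable_funS mj.
have mint : measurable_fun `]0, sigma[ (fun s => s^-1 * j s).
  by apply: measurable_funM => //; apply: measurable_inv_sub.
have mpow : measurable_fun `]0, sigma[ (fun s => s `^ (theta - 1)).
  by apply: (measurable_funS measurableT) => //; exact: measurable_powR.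
have spl (s : R) : 0 < s -> s^-1 * j s = (s `^ (- theta) * j s) * s `^ (theta - 1).
  move=> sp; rewrite mulrAC -powRD ?(gt_eqF sp) ?implybT //.
  by rewrite addrA addNr add0r powR_inv1 // ltW.
have ip := integral_powR_le th0 s0.
case: q q1 jW => [r| |//] r1 jW; last first.
  apply: (@le_trans _ _ (\int[mu]_(s in `]0%R, sigma[) (W * s `^ (theta - 1))%:E)%E).
    apply: le_integral_EFin => //; first exact: measurable_funM.
    move=> s Es; have sp := E0 s Es; rewrite mulr_ge0 ?invr_ge0 ?(ltW sp) ?(j0 _ (EO _ Es)) //=.
    rewrite spl // ler_wpM2r ?powR_ge0 // -lee_fin (le_trans _ (ltW jW)) //.
    by apply: ereal_sup_ubound; exists s => //; exact: EO.
  rewrite integralZ_EFin_ge0 ?(ltW W0) //; last by move=> s _; exact: powR_ge0.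
  apply: (@le_trans _ _ (W%:E * (theta^-1 * sigma `^ theta)%:E)%E).
    by apply: lee_wpmul2l ip; rewrite lee_fin ltW.
  rewrite /conj_inv powR_inv1 ?(ltW th0) // -EFinM lee_fin mulrC.
  rewrite ler_wpM2r ?(ltW W0) // -!mulrA ler_peMl ?ler1n //.
  by rewrite mulr_ge0 ?powR_ge0 // invr_ge0 ltW.
have r1' : 1 <= r by rewrite -lee_fin.
have rp : 0 < r by exact: lt_le_trans r1'.
(* [le_add_powR] replaces Hoelder's inequality; this [l] balances the two terms. *)
pose l := theta `^ r^-1 * W.
have l0 : 0 < l by rewrite mulr_gt0 // powR_gt0.
pose w s := (s `^ (- theta) * j s) `^ r / s.
have iw : (\int[mu]_(s in O) (w s)%:E <= (W `^ r)%:E)%E.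
  have i0 : (0 <= \int[mu]_(s in O) (w s)%:E)%E.
    by apply: integral_ge0 => s /O_gt0 sp; rewrite lee_fin weight_ge0.
  rewrite /= -/w in jW; set X := integral _ _ _ in i0 jW *.
  have -> : X = ((X `^ r^-1) `^ r)%E by rewrite -poweRrM mulVf ?poweRe1 // lt0r_neq0.
  rewrite -poweR_EFin.
  by apply: le_poweR; [exact: ltW|exact: poweR_ge0|exact: ltW].
have mw : measurable_fun `]0, sigma[ w by exact: measurable_weight.
have k0 : 0 <= l `^ (1 - r) * sigma `^ theta by rewrite mulr_ge0 ?powR_ge0.
apply: (@le_trans _ _ (\int[mu]_(s in `]0%R, sigma[)
   (l * s `^ (theta - 1) + (l `^ (1 - r) * sigma `^ theta) * w s)%:E)%E).
  apply: le_integral_EFin => //.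
    by apply: measurable_funD; exact: measurable_funM.
  move=> s Es; have sp := E0 s Es; have js := j0 s (EO s Es).
  rewrite mulr_ge0 ?invr_ge0 ?(ltW sp) //= spl //.
  have y0 : 0 <= s `^ (- theta) * j s by rewrite mulr_ge0 ?powR_ge0.
  apply: (le_trans (ler_wpM2r (powR_ge0 _ _) (le_add_powR y0 l0 r1'))).
  (* In the second term s^(theta - 1) = s^theta / s and s^theta <= sigma^theta, which leaves the
     weight [w]. *)
  rewrite mulrDl lerD2l -!mulrA ler_wpM2l ?powR_ge0 // /w mulrCA.
  rewrite ler_wpM2l ?powR_ge0 // powRB ?(gt_eqF sp) ?implybT // powRr1 ?(ltW sp) //.
  rewrite ler_wpM2r ?invr_ge0 ?(ltW sp) // ge0_ler_powR ?nnegrE ?(ltW th0) ?(ltW sp) ?(ltW s0) //.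
  by move: Es; rewrite /= in_itv /= => /andP[_ /ltW].
rewrite integralD_EFin_ge0 //; first last.
- by move=> s /E0 sp; rewrite mulr_ge0 // weight_ge0.
- by move=> s _; rewrite mulr_ge0 ?powR_ge0 // ltW.
- exact: measurable_funM.
- exact: measurable_funM.
rewrite !integralZ_EFin_ge0 ?(ltW l0) //; last 2 first.
- by move=> s /E0 sp; rewrite weight_ge0.
- by move=> s _; exact: powR_ge0.
apply: (@le_trans _ _ (l%:E * (theta^-1 * sigma `^ theta)%:E +
   (l `^ (1 - r) * sigma `^ theta)%:E * (W `^ r)%:E)%E).
  apply: leeD; first by apply: lee_wpmul2l ip; rewrite lee_fin ltW.
  apply: lee_wpmul2l; first by rewrite lee_fin.
  apply: le_trans iw; apply: ge0_subset_integral => //.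
    by apply/measurable_EFinP; apply: measurable_weight => //; exact: O_gt0.
  by move=> s /O_gt0 sp; rewrite lee_fin weight_ge0.
rewrite -!EFinM -EFinD lee_fin /l powRM ?powR_ge0 ?(ltW W0) //.
have e1 : theta `^ r^-1 * theta^-1 = theta `^ (- (1 - r^-1)).
  by rewrite -[theta^-1]powR_inv1 ?(ltW th0) // -powRD ?opprB // (gt_eqF th0) implybT.
have e2 : (theta `^ r^-1) `^ (1 - r) = theta `^ (- (1 - r^-1)).
  by rewrite -powRrM mulrBr mulr1 mulVf ?lt0r_neq0 // opprB.
have e3 : W `^ (1 - r) * W `^ r = W.
  by rewrite -powRD ?subrK ?powRr1 ?(ltW W0) // (gt_eqF W0) implybT.
rewrite e2 /conj_inv -e1 le_eqVlt; apply/orP; left; apply/eqP.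
set a := theta `^ r^-1; rewrite -[in RHS]e3 -[in X in X + _]e3; ring.
Qed.

(** Here p is the conjugate exponent. Since theta <= 1/2, the number p (1 - theta) lies between 1/2
    and p, hence its power 1/p lies between 1/2 and e, because p <= e^p. *)
Lemma conj_powR_bounds (p theta : R) : 1 <= p -> 0 < theta <= 2^-1 ->
  theta `^ (- p^-1) <= expR 1 * (p * theta * (1 - theta)) `^ (- p^-1) /\
  (p * theta * (1 - theta)) `^ (- p^-1) <= 2 * theta `^ (- p^-1).
Proof.
move=> p1 /andP[th0 th1]; have p0 : 0 < p by exact: lt_le_trans p1.
have pi1 : p^-1 <= 1 by rewrite invf_le1.
have pi0 : 0 <= p^-1 by rewrite invr_ge0 ltW.
have t0 : 0 < 1 - theta by lra.
rewrite mulrAC powRM ?(ltW th0) ?mulr_ge0 ?(ltW p0) ?(ltW t0) //.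
have w0 : 0 <= theta `^ (- p^-1) by exact: powR_ge0.
set y := p * (1 - theta).
have y0 : 0 < y by rewrite mulr_gt0.
have y1 : 2^-1 <= y by rewrite /y; nra.
have yp : y <= p by rewrite /y; nra.
split.
  rewrite mulrA ler_peMl // powRN -ler_pdivrMr ?invr_gt0 ?powR_gt0 // mul1r invrK.
  apply: (@le_trans _ _ (expR p `^ p^-1)); last by rewrite expR_powR mulVf ?gt_eqF.
  rewrite ge0_ler_powR ?nnegrE ?(ltW y0) ?expR_ge0 //.
  by rewrite (le_trans yp) // (le_trans _ (expR_ge1Dx p)) // lerDr.
rewrite ler_wpM2r // powRN -[leRHS]invrK lef_pV2 ?posrE ?powR_gt0 //.
apply: (@le_trans _ _ (2^-1 `^ p^-1)).
  rewrite -[leLHS]powRr1 ?invr_ge0 // ger_powR // invr_gt0 /= ltr0n /=.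
  by rewrite invf_le1 // ler1n.
by rewrite ge0_ler_powR ?nnegrE ?invr_ge0 // ltW.
Qed.

Lemma theta_factor_bounds q theta : (1 <= q)%E -> 0 < theta <= 2^-1 ->
  theta `^ (- conj_inv q) <= expR 1 * theta_factor q theta /\
  theta_factor q theta <= 2 * theta `^ (- conj_inv q).
Proof.
move=> q1 th; case: q q1 => [r| |//] r1; last first.
  by have := conj_powR_bounds (lexx 1) th; rewrite /theta_factor hoelder_conjugatey invr1.
move: r1; rewrite lee_fin le_eqVlt => /predU1P[<-|r1].
  rewrite /theta_factor hoelder_conjugate1 /conj_inv invr1 subrr oppr0 powRr0 !mulr1.
  by rewrite ler1n -[1 in leLHS]expR0 ler_expR.
have r0 : 0 < r by exact: lt_trans r1.
have rr : 0 < r - 1 by rewrite subr_gt0.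
have -> : theta_factor r%:E theta = (r / (r - 1) * theta * (1 - theta)) `^ (- (r / (r - 1))^-1).
  rewrite /theta_factor /hoelder_conjugate /= gt_eqF // -EFinD inver gt_eqF //.
have -> : conj_inv r%:E = (r / (r - 1))^-1.
  by rewrite /conj_inv invf_div mulrBl divff ?gt_eqF // mul1r.
apply: conj_powR_bounds => //; rewrite ler_pdivlMr //; lra.
Qed.

Lemma theta_factor_gt0 q theta : 0 < theta < 1 -> (1 <= q)%E -> 0 < theta_factor q theta.
Proof.
move=> /andP[th0 th1] q1; rewrite /theta_factor.
have := hoelder_conj_ge1 q1; case: hoelder_conjugate => // p p1.
rewrite powR_gt0 // !mulr_gt0 ?subr_gt0 //.
by apply: lt_le_trans ltr01 _; rewrite -lee_fin.
Qed.

Lemma integral_if_lt (sigma : R) (f : R -> R) : sigma <= 1 ->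
  (\int[mu]_(s in O) (if s < sigma then f s else 0)%:E =
   \int[mu]_(s in `]0%R, sigma[) (f s)%:E)%E.
Proof.
move=> s1; rewrite (_ : `]0, sigma[%classic = O `&` `]-oo, sigma[); last first.
  apply/seteqP; split => s /=; rewrite !in_itv /=.
    by move=> /andP[-> ss]; rewrite ss (lt_le_trans ss).
  by move=> [/andP[-> _] ->].
rewrite integral_mkcondr; apply: eq_integral => s _.
by rewrite patchE mem_setE in_itv /=; case: ifP.
Qed.

(** The measure ds/s is absorbed into the integrand as s^(-1/r), so that Minkowski's inequality for
    Lebesgue measure can be used. *)
Lemma weighted_LqE (r theta : R) j : 0 < r -> (forall s, O s -> 0 <= j s) ->
  weighted_Lq r%:E theta j =
  Lnorm mu r%:E (EFin \o ((fun s => s `^ (- theta) * j s * s `^ (- r^-1)) \_ O)).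
Proof.
move=> r0 j0; rewrite unlock /=; congr (_ `^ _)%E.
rewrite integral_mkcond; apply: eq_integral => s _ /=.
rewrite !patchE; case: ifPn => [/set_mem Os|_]; last first.
  by rewrite /point /= normr0 powR0 // gt_eqF.
have s0 := O_gt0 Os; have js := j0 s Os.
rewrite ger0_norm ?mulr_ge0 ?powR_ge0 //.
rewrite [in RHS]powRM ?mulr_ge0 ?powR_ge0 //.
by rewrite -[in RHS]powRrM mulNr mulVf ?gt_eqF // powR_inv1 // ltW.
Qed.

Lemma weighted_Lq_triangle q theta j1 j2 : (1 <= q)%E ->
  measurable_fun O j1 -> measurable_fun O j2 ->
  (forall s, O s -> 0 <= j1 s) -> (forall s, O s -> 0 <= j2 s) ->
  (weighted_Lq q theta (j1 \+ j2)%R <= weighted_Lq q theta j1 + weighted_Lq q theta j2)%E.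
Proof.
move=> q1 m1 m2 p1 p2; case: q q1 => [r| |//] r1; last first.
  apply: ge_ereal_sup => _ [s Os <-]; rewrite mulrDr EFinD.
  by apply: leeD; apply: ereal_sup_ubound; exists s.
have r1' : 1 <= r by rewrite -lee_fin.
have r0 : 0 < r by exact: lt_le_trans r1'.
rewrite !weighted_LqE //; last by move=> s Os; rewrite addr_ge0 ?p1 ?p2.
pose w j := (fun s => s `^ (- theta) * j s * s `^ (- r^-1)) \_ O.
have mw j : measurable_fun O j -> measurable_fun setT (w j).
  move=> mj; apply/(measurable_restrictT (fun s => s `^ (- theta) * j s * s `^ (- r^-1))) => //.
  apply: measurable_funM; first by apply: measurable_powR_mul => //; exact: measurable_itv.
  by apply: (measurable_funS measurableT) => //; exact: measurable_powR.
have := minkowski_EFin (lebesgue_measure : {measure set _ -> \bar R}) (mw _ m1) (mw _ m2) r1'.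
congr (_ <= _)%E; congr (Lnorm _ _ (EFin \o _)); apply/funext => s /=.
by rewrite /w !patchE; case: ifP => _; rewrite ?addr0 // mulrDr mulrDl.
Qed.

Lemma nondecreasing_measurable_I (f : R -> R) : (forall t, I t -> 0 <= f t) ->
  (forall s t, I s -> I t -> s <= t -> f s <= f t) -> measurable_fun I f.
Proof.
(* Extended by 0 on the left and by [f 1] on the right, the function stays monotone on the whole
   line. *)
move=> f0 ndf; pose g t := if t <= 0 then 0 else f (Num.min t 1).
have Imin t : 0 < t -> I (Num.min t 1).
  by move=> t0; rewrite /= in_itv /= lt_min t0 ltr01 ge_min lexx orbT.
apply: (@eq_measurable_fun _ _ _ _ _ g).
  move=> t; rewrite inE => It; rewrite /g leNgt (I_gt0 It) /=.
  by rewrite min_l // I_le1.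
apply: nondecreasing_measurable; first exact: measurable_itv.
move=> s t st; rewrite /g; case: (leP s 0) => s0.
  by case: (leP t 0) => // t0; exact/f0/Imin.
case: (leP t 0) => t0; first by have := lt_le_trans s0 (le_trans st t0); rewrite ltxx.
apply: ndf; [exact: Imin|exact: Imin|].
by rewrite le_min ge_min st /= ge_min lexx orbT.
Qed.

Lemma le_xi (s t : R) : I s -> I t -> s <= t -> xi s <= xi t.
Proof.
move=> Is It st; have s0 := I_gt0 Is; have t0 := I_gt0 It.
have hs := one_sub_ln_ge1 s0 (I_le1 Is); have ht := one_sub_ln_ge1 t0 (I_le1 It).
rewrite !xiE // lef_pV2 ?posrE ?mulr_gt0 ?(lt_le_trans _ hs) ?(lt_le_trans _ ht) //.
by rewrite ler_pM2l // lerD2l lerN2 ler_ln ?posrE.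
Qed.

Lemma measurable_xi : measurable_fun I (@xi R).
Proof.
apply: nondecreasing_measurable_I => [t It|]; last exact: le_xi.
by rewrite ltW // xi_gt0 ?I_gt0 ?I_le1.
Qed.

Lemma measurable_theta_factor q : measurable_fun I (fun t => theta_factor q (xi t)).
Proof.
rewrite /theta_factor; case: hoelder_conjugate => [p| |]; [|exact: measurable_cst..].
apply: (@measurableT_comp _ _ _ _ _ _ (@powR R ^~ (- p^-1))); first exact: measurable_powR.
apply: measurable_funM; first by apply: measurable_funM => //; exact: measurable_xi.
by apply: measurable_funB => //; exact: measurable_xi.
Qed.

End WeightedNorm.

(** * Decompositions from a bound on the norm with parameters theta and q *)

Section ThetaNorm.
Context {R : realType} {A : ordered_pair R}.
Local Notation mu := (@lebesgue_measure R).
Local Notation I := (`]0, 1]%classic : set R).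
Local Notation O := (`]0, 1[%classic : set R).
Implicit Types (q : \bar R) (theta : R).

Lemma Lq_thetaE q theta (v : R -> sp1 A) :
  Lq_theta q theta v = weighted_Lq q theta (fun s => Jfun (v s) s).
Proof. by case: q. Qed.

(** The tail estimate of the representation over (0, s) yields all the bounds: the J-functional
    dominates the A_0-norm, and on [r, s) it dominates r times the A_1-norm of the integrand. The
    factor 2 comes from [weighted_Lq_tail], the factor e from comparing theta^(-1/q') with the
    normalising factor. *)
Lemma decomposition_of_theta_norm q theta (a : sp1 A) (b : R) : (1 <= q)%E ->
  0 < theta <= 2^-1 -> (theta_norm q theta (emb A a) < b%:E)%E ->
  decomposition theta (2 * expR 1 * b) a.
Proof.
move=> q1 th nb; have /andP[th0 thh] := th.
have f0 : 0 < theta_factor q theta by apply: theta_factor_gt0 => //; lra.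
have [fb _] := theta_factor_bounds q1 th.
have [_ [v [sv bv] <-]] : exists2 y, [set Lq_theta q theta u |
    u in represents O ^~ (emb A a)] y & (y < ((theta_factor q theta)^-1 * b)%:E)%E.
  by apply: ereal_inf_lt; rewrite EFinM -lte_pdivrMl ?invr_gt0 // invrK.
rewrite Lq_thetaE; set j := fun s => Jfun (v s) s => jb.
have mO : measurable O by exact: measurable_itv.
have fO : (mu O < +oo)%E.
  by apply: le_lt_trans (measure_I_lty (R := R)); apply: le_measure;
    rewrite ?inE //; exact: subset_itvW.
have mj : measurable_fun O j by exact: measurable_Jfun.
have j0 s : 0 <= j s by exact: Jfun_ge0.
pose B := 2 * expR 1 * b.
have tail sigma : 0 < sigma <= 1 ->
    (\int[mu]_(s in O) (if s < sigma then s^-1 * j s else 0)%:E <=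
     (sigma `^ theta * B)%:E)%E.
  move=> sg; have /andP[s0 s1] := sg; rewrite integral_if_lt //.
  apply: (le_trans (weighted_Lq_tail q1 th0 mj (fun s _ => j0 s) sg jb)).
  have b0 : 0 <= b.
    have := le_lt_trans (weighted_Lq_ge0 q theta (fun s _ => j0 s)) jb.
    by rewrite lte_fin pmulr_rgt0 ?invr_gt0 // => /ltW.
  rewrite lee_fin /B mulrAC [leRHS]mulrC ler_wpM2r ?powR_ge0 //.
  rewrite -!mulrA ler_wpM2l // [leLHS]mulrA ler_wpM2r //.
  by rewrite ler_pdivrMr.
have mif (sigma : R) : measurable_fun O (fun s => if s < sigma then s^-1 * j s else 0).
  apply: measurable_if_lt => //.
  by apply: measurable_funM => //; apply: measurable_inv_sub => //; exact: O_gt0.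
(* [c sigma] is the integral in the smaller space over [sigma, 1[ of the
   representation [v] of [a]. *)
pose h (sigma s : R) : R := if s < sigma then 0 else s^-1.
have mh sigma : measurable_fun O (h sigma).
  apply: measurable_if_lt => //.
  by apply: measurable_inv_sub => //; exact: O_gt0.
have sh sigma : strongly_measurable O (fun s => h sigma s *: v s) by exact: strong_scale.
have /choice[c hc] : forall sigma, exists c, 0 < sigma <= 1 ->
    bochner_integral O (fun s => h sigma s *: v s) c.
  move=> sigma; have [sg|] := boolP (0 < sigma <= 1); last by exists 0.
  have /andP[s0 s1] := sg.
  have [|c hc] := bochner_exists mO fO (sh sigma); last by exists c.
  (* On [sigma, 1[ the A_1-norm of [v s] is at most the J-functional divided by [sigma], so the
     integral converges in A_1 and not only in A_0. *)
  apply: (@le_lt_trans _ _ (\int[mu]_(s in O)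
     (sigma^-1 * (if s < 1 then s^-1 * j s else 0))%:E)%E).
    apply: le_integral_EFin => //.
    - exact: measurable_norm_strong.
    - exact: measurable_funM.
    move=> s Os; have sp := O_gt0 Os; rewrite normr_ge0 /= normrZ /h.
    have -> : s < 1 by move: Os; rewrite /= in_itv /= => /andP[].
    case: ltP => [_|le]; first by rewrite normr0 mul0r !mulr_ge0 ?invr_ge0 ?(ltW s0) ?(ltW sp).
    rewrite ger0_norm ?invr_ge0 ?(ltW sp) // mulrCA ler_wpM2l ?invr_ge0 ?(ltW sp) //.
    rewrite ler_pdivlMl //; apply: (le_trans _ (norm_le_Jfun _ _)).
    by rewrite ler_wpM2r.
  rewrite integralZ_EFin_ge0 ?invr_ge0 ?(ltW s0) //; last first.
    by move=> s /O_gt0 sp; case: ifP => // _; rewrite mulr_ge0 ?invr_ge0 // ltW.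
  rewrite lte_mul_pinfty ?lee_fin ?invr_ge0 ?(ltW s0) //.
  by apply: le_lt_trans (tail 1 _) (ltry _); rewrite ltr01 lexx.
have hce sigma : 0 < sigma <= 1 ->
    bochner_integral O (fun s => emb A (h sigma s *: v s)) (emb A (c sigma)).
  by move=> /hc hcs; exact: (bochner_linear emb_lin emb_le1 mO fO hcs).
exists c; split.
- have b1 : bochner_integral O (fun s => h 1 s *: v s) (c 1) by apply: hc; rewrite ltr01 lexx.
  have := bochner_norm_le mO fO b1; rewrite (_ : (\int[mu]_(s in O) _ = 0)%E).
    by rewrite lee_fin normr_le0 => /eqP.
  rewrite -(integral0 mu O); apply: eq_integral => s; rewrite inE /= in_itv /= => /andP[_ s1].
  by rewrite /h s1 scale0r normr0.
- move=> s s0 s1; have sI : 0 < s <= 1 by rewrite s0.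
  rewrite linearB -lee_fin; apply: le_trans (tail s sI).
  have := bochner_dist_le mO fO bv (hce s sI); move=> /le_trans; apply.
  apply: le_integral_EFin => //.
    apply: measurable_norm_strong => //; apply: strong_sub; first by case: bv.
    exact: strong_emb.
  move=> x Ox; have x0 := O_gt0 Ox; rewrite normr_ge0 /= /h.
  case: ifP => xs; last by rewrite linearZ subrr normr0.
  rewrite scale0r linear0 subr0 normrZ ger0_norm ?invr_ge0 ?(ltW x0) //.
  by rewrite ler_wpM2l ?invr_ge0 ?(ltW x0) // emb_le_Jfun.
move=> r s r0 rs s1.
have sI : 0 < s <= 1 by rewrite (lt_le_trans r0).
have rI : 0 < r <= 1 by rewrite r0 (le_trans rs).
have st := tail s sI.
apply: Jfun_le.
- rewrite linearB -lee_fin; apply: le_trans st.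
  have := bochner_dist_le mO fO (hce r rI) (hce s sI); move=> /le_trans; apply.
  apply: le_integral_EFin => //.
    apply: measurable_norm_strong => //.
    by apply: strong_sub; exact: strong_emb.
  move=> x Ox; have x0 := O_gt0 Ox; rewrite normr_ge0 /= /h.
  case: (ltP x s) => xs; last first.
    by rewrite ltNge (le_trans rs xs) subrr normr0.
  rewrite scale0r linear0 subr0; case: ifP => _.
    by rewrite scale0r linear0 normr0 mulr_ge0 ?invr_ge0 // ltW.
  rewrite linearZ normrZ ger0_norm ?invr_ge0 ?(ltW x0) //.
  by rewrite ler_wpM2l ?invr_ge0 ?(ltW x0) // emb_le_Jfun.
rewrite -lee_fin; apply: le_trans st.
have /(lee_wpmul2l (x := r%:E)) := bochner_dist_le mO fO (hc r rI) (hc s sI).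
rewrite lee_fin (ltW r0) -EFinM => /(_ isT)/le_trans; apply.
rewrite -integralZ_EFin_ge0 ?(ltW r0) //; last first.
  by apply: measurable_norm_strong => //; exact: strong_sub.
apply: le_integral_EFin => //.
  by apply: measurable_funM => //; apply: measurable_norm_strong => //; exact: strong_sub.
move=> x Ox; have x0 := O_gt0 Ox; rewrite mulr_ge0 ?(ltW r0) //= /h.
case: (ltP x s) => xs; last first.
  by rewrite ltNge (le_trans rs xs) subrr normr0 mulr0.
rewrite scale0r subr0; case: (ltP x r) => xr.
  by rewrite scale0r normr0 mulr0 mulr_ge0 ?invr_ge0 // ltW.
rewrite normrZ ger0_norm ?invr_ge0 ?(ltW x0) // mulrCA.
rewrite ler_wpM2l ?invr_ge0 ?(ltW x0) // (le_trans _ (norm_le_Jfun _ _)) //.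
by rewrite ler_wpM2r.
Qed.

End ThetaNorm.

(** * Dependence of the norms on t and comparison of the two spaces *)

Section IntermediateNorm.
Context {R : realType} {A : ordered_pair R}.
Local Notation mu := (@lebesgue_measure R).
Local Notation I := (`]0, 1]%classic : set R).
Local Notation O := (`]0, 1[%classic : set R).
Implicit Types (q : \bar R) (theta : R) (x y : sp0 A).

(** This is [theta_norm] without the normalising factor; unlike the full norm it is shown to be
    monotone in theta, and measurability in [t] rests on that. *)
Definition inf_Lq q theta x : \bar R :=
  ereal_inf [set Lq_theta q theta u | u in represents O ^~ x].

Let sub_OI : O `<=` I.
Proof. by move=> t; rewrite /= !in_itv /= => /andP[-> /ltW ->]. Qed.

Let mO : measurable O. Proof. exact: measurable_itv. Qed.

Lemma inf_Lq_ge0 q theta x : (0 <= inf_Lq q theta x)%E.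
Proof.
apply: le_ereal_inf_tmp => _ [u _ <-]; rewrite Lq_thetaE.
by apply: weighted_Lq_ge0 => s _; exact: Jfun_ge0.
Qed.

Lemma inf_Lq_mono q theta theta' x : (1 <= q)%E -> theta <= theta' ->
  (inf_Lq q theta x <= inf_Lq q theta' x)%E.
Proof.
move=> q1 tt; apply: le_ereal_inf_tmp => _ [u ru <-].
apply: (@le_trans _ _ (Lq_theta q theta u)); first by apply: ereal_inf_lbound; exists u.
have mJ : measurable_fun O (fun s => Jfun (u s) s).
  by apply: measurable_Jfun => //; case: ru.
rewrite !Lq_thetaE; apply: weighted_Lq_le => // s; first by move=> _; exact: Jfun_ge0.
move=> Os; have s0 := O_gt0 Os; rewrite ler_wpM2r ?Jfun_ge0 // ger_powR ?lerN2 //.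
by rewrite s0 I_le1 //; exact: sub_OI.
Qed.

Lemma inf_LqD q theta x y (b c : R) : (1 <= q)%E -> (inf_Lq q theta x < b%:E)%E ->
  (inf_Lq q theta y < c%:E)%E -> (inf_Lq q theta (x + y)%R <= (b + c)%:E)%E.
Proof.
move=> q1 /ereal_inf_lt[_ [u ru <-] ub] /ereal_inf_lt[_ [v rv <-] vc].
have ruv : represents O (fun s => u s + 1 *: v s) (x + y).
  apply/represents_oo_oc; rewrite -[y]scale1r.
  by apply: represents_lin; exact/represents_oo_oc.
apply: (@le_trans _ _ (Lq_theta q theta (fun s => u s + 1 *: v s))).
  by apply: ereal_inf_lbound; exists (fun s => u s + 1 *: v s).
have mu' (w : R -> sp1 A) z : represents O w z -> measurable_fun O (fun s => Jfun (w s) s).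
  by case=> sw _; exact: measurable_Jfun.
have mj1 := mu' _ _ ru; have mj2 := mu' _ _ rv.
rewrite !Lq_thetaE in ub vc *; rewrite EFinD.
apply: le_trans (leeD (ltW ub) (ltW vc)).
apply: le_trans (weighted_Lq_triangle theta q1 mj1 mj2 _ _); try by move=> s _; exact: Jfun_ge0.
apply: weighted_Lq_le => //.
- exact: mu' ruv.
- exact: measurable_funD.
- by move=> s _; exact: Jfun_ge0.
- move=> s Os; rewrite ler_wpM2l ?powR_ge0 // scale1r JfunD // ltW //; exact: O_gt0.
Qed.

(** The choice of [xi] enters here: xi(t) log(1/t) stays below 1/2. *)
Lemma powRN_xi_le (t : R) : I t -> t `^ (- xi t) <= expR 1.
Proof.
move=> It; have t0 := I_gt0 It; have h := one_sub_ln_ge1 t0 (I_le1 It).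
rewrite /powR gt_eqF // ler_expR xiE // mulNr -mulrN mulrC ler_pdivrMr ?mul1r.
  by rewrite mulrDr mulr1; lra.
by rewrite mulr_gt0 // (lt_le_trans _ h).
Qed.

(** On the interval used, s^(-theta) is at most e t^(-theta), hence at most e^2. The density theta
    on a set of ds/s-measure 1/theta has L^q norm theta^(1/q'), which cancels the power in the
    normalising factor up to the constant 2. *)
Lemma theta_norm_le_Jfun q (t : R) (a : sp1 A) : (1 <= q)%E -> I t ->
  (theta_norm q (xi t) (emb A a) <= (2 * expR 2 * Jfun a t)%:E)%E.
Proof.
move=> q1 It; have t0 := I_gt0 It; have t1 := I_le1 It.
set theta := xi t; have th0 : 0 < theta by exact: xi_gt0.
have thh : theta <= 2^-1 by exact: xi_le_half.
have tt : t `^ (- theta) <= expR 1 by exact: powRN_xi_le.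
have th : 0 < theta <= 2^-1 by rewrite th0.
clearbody theta.
(* The interval ]z, t] has measure 1 / theta for ds/s. *)
pose z := t * expR (- theta^-1).
have z0 : 0 < z by rewrite mulr_gt0 // expR_gt0.
have zt : z < t by rewrite gtr_pMr // -[ltRHS]expR0 ltr_expR oppr_lt0 invr_gt0.
pose E : set R := `]z, t]%classic.
have mE : measurable E by exact: measurable_itv.
have E0 s : E s -> 0 < s by rewrite /E /= in_itv /= => /andP[/(lt_trans z0)].
have EI : I `&` E = E.
  apply/seteqP; split => [s []//|s Es]; split => //.
  by move: Es; rewrite /E /= !in_itv /= => /andP[zs st]; rewrite (lt_trans z0) ?(le_trans st).
have iE (k : R) : (\int[mu]_(s in E) (k * s^-1)%:E = (k * theta^-1)%:E)%E.
  rewrite (_ : k * theta^-1 = k * ln t - k * ln z); last first.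
    by rewrite /z lnM ?posrE ?expR_gt0 // expRK; ring.
  apply: (@integral_oc_derive _ (fun s => k * ln s)) => //.
    move=> s /andP[/(lt_le_trans z0) s0 _]; have d := is_derive1_ln s0.
    by apply: is_derive_eq; rewrite /GRing.scale /=.
  move=> s /andP[/(lt_le_trans z0) s0 _].
  by apply: cvgM; [exact: cvg_cst|exact/inv_continuous/lt0r_neq0].
pose e : R -> R := (fun=> theta) \_ E.
have eE s : e s = if s \in E then theta else 0 by rewrite /e patchE.
have e0 s : 0 <= e s by rewrite eE; case: ifP => // _; exact: ltW.
have me : measurable_fun setT e.
  by apply/(measurable_restrictT (fun=> theta)) => //; exact: measurable_cst.
pose h s := s^-1 * e s.
have mh : measurable_fun I h.
  by apply: measurable_funM; [exact: measurable_inv_I|exact: measurable_funS me].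
have h0 s : I s -> 0 <= h s by move=> /I_gt0 s0; rewrite mulr_ge0 ?invr_ge0 ?(ltW s0).
have ih : (\int[mu]_(s in I) (h s)%:E = 1)%E.
  rewrite (_ : 1 = (theta * theta^-1)%:E)%E; last by rewrite divff ?gt_eqF.
  rewrite -iE -EI integral_mkcondr; apply: eq_integral => s _.
  by rewrite patchE /h eE; case: ifP => _; rewrite ?mulr0 // mulrC.
have rv : represents O (fun s => e s *: a) (emb A a).
  apply/represents_oo_oc; split.
    by apply: strong_scale; [exact: measurable_I|exact: measurable_funS me|exact: strong_cst].
  have := bochner_scale_cst (emb A a) (@measurable_I R) (@measure_I_lty R) mh h0.
  rewrite ih => /(_ (ltry _)) /=; rewrite scale1r.
  by apply: bochner_eq => s _; rewrite linearZ scalerA.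
set M := Jfun a t; have M0 : 0 <= M by exact: Jfun_ge0.
pose k := expR 2 * (theta * M).
have k0 : 0 <= k by rewrite !mulr_ge0 ?expR_ge0 // ltW.
have jk s : O s -> s `^ (- theta) * Jfun (e s *: a) s <= if s \in E then k else 0.
  move=> Os; have s0 := O_gt0 Os; rewrite JfunZ eE; case: ifPn => [/set_mem Es|_]; last first.
    by rewrite normr0 mul0r mulr0.
  rewrite ger0_norm ?(ltW th0) // /k; apply: ler_pM;
    rewrite ?powR_ge0 ?mulr_ge0 ?Jfun_ge0 ?(ltW th0) //.
    have /andP[zs st] : z < s <= t by move: Es; rewrite /E /= in_itv.
    apply: (@le_trans _ _ (z `^ (- theta))).
      by rewrite !powRN lef_pV2 ?posrE ?powR_gt0 // ge0_ler_powR ?nnegrE ?(ltW th0) // ltW.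
    rewrite powRM ?(ltW t0) ?expR_ge0 // expR_powR mulrNN divff ?gt_eqF //.
    by rewrite (_ : 2 = 1 + 1 :> R) // expRD ler_wpM2r ?expR_ge0.
  rewrite ler_wpM2l ?(ltW th0) // Jfun_mono //.
  by move: Es; rewrite /E /= in_itv /= => /andP[].
have Lk : (Lq_theta q theta (fun s => e s *: a) <=
    (expR 2 * theta `^ conj_inv q * M)%:E)%E.
  rewrite Lq_thetaE; case: q q1 => [r| |//] r1; last first.
    apply: ge_ereal_sup => _ [s Os <-]; rewrite lee_fin (le_trans (jk s Os)) //.
    rewrite /conj_inv powRr1 ?(ltW th0) // -mulrA -/k; by case: ifP.
  have r1' : 1 <= r by rewrite -lee_fin.
  have r0 : 0 < r by exact: lt_le_trans r1'.
  apply: (@le_trans _ _ ((k `^ r * theta^-1)%:E `^ r^-1)%E).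
    apply: le_poweR; first by rewrite invr_ge0 ltW.
      by apply: integral_ge0 => s /O_gt0 s0; rewrite lee_fin weight_ge0.
    have kt0 : 0 <= k `^ r * theta^-1.
      by rewrite divr_ge0 ?powR_ge0 // ltW.
    have mhO : measurable_fun O h by exact: measurable_funS mh.
    apply: (@le_trans _ _ (\int[mu]_(s in O) (k `^ r * theta^-1 * h s)%:E)%E).
      apply: le_integral_EFin => //.
      - apply: measurable_weight => //; first exact: O_gt0.
        by apply: measurable_Jfun => //; case: rv.
      - exact: measurable_funM.
      move=> s Os; have s0 := O_gt0 Os; rewrite weight_ge0 //= /h.
      have := jk s Os; set y := _ * Jfun _ _ => yk.
      have y0 : 0 <= y by rewrite mulr_ge0 ?powR_ge0 ?Jfun_ge0.
      rewrite eE; case: ifP yk => _ yk.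
        rewrite [s^-1 * theta]mulrC mulrA divfK ?gt_eqF //.
        by rewrite ler_wpM2r ?invr_ge0 ?(ltW s0) // ge0_ler_powR ?nnegrE // ltW.
      rewrite (_ : y = 0) ?powR0 ?gt_eqF // ?mul0r ?mulr0 //.
      by apply/eqP; rewrite eq_le yk y0.
    rewrite integral_oo_oc; last exact: measurable_funM.
    by rewrite integralZ_EFin_ge0 ?ih ?mule1 //; exact: measurable_I.
  rewrite poweR_EFin lee_fin powRM ?powR_ge0 ?invr_ge0 ?(ltW th0) //.
  rewrite -powRrM mulfV ?gt_eqF // powRr1 // /k -powR_inv1 ?(ltW th0) // -powRrM.
  rewrite /conj_inv powRB ?(gt_eqF th0) ?implybT // powRr1 ?(ltW th0) //.
  rewrite mulN1r powRN le_eqVlt; apply/orP; left; apply/eqP; ring.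
have [_ fb] := theta_factor_bounds q1 th.
have f0 : 0 < theta_factor q theta by apply: theta_factor_gt0 => //; lra.
apply: (@le_trans _ _ ((theta_factor q theta)%:E * (expR 2 * theta `^ conj_inv q * M)%:E)%E).
  apply: lee_wpmul2l; first by rewrite lee_fin ltW.
  by apply: le_trans Lk; apply: ereal_inf_lbound; exists (fun s => e s *: a).
rewrite -EFinM lee_fin.
apply: (le_trans (ler_wpM2r _ fb)); first by rewrite !mulr_ge0 ?expR_ge0 ?powR_ge0.
rewrite powRN le_eqVlt; apply/orP; left; apply/eqP; field.
by rewrite gt_eqF // powR_gt0.
Qed.

Definition theta_real q (t : R) (a : sp1 A) : R := fine (theta_norm q (xi t) (emb A a)).

Let xi01 (t : R) : I t -> 0 < xi t < 1.
Proof.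
move=> It; rewrite xi_gt0 ?I_gt0 ?I_le1 //=.
by apply: le_lt_trans (xi_le_half (I_gt0 It) (I_le1 It)) _; lra.
Qed.

Lemma theta_real_fin q t a : (1 <= q)%E -> I t ->
  theta_norm q (xi t) (emb A a) = (theta_real q t a)%:E.
Proof.
move=> q1 It; rewrite /theta_real fineK // ge0_fin_numE.
  exact: le_lt_trans (theta_norm_le_Jfun a q1 It) (ltry _).
rewrite mule_ge0 ?inf_Lq_ge0 // lee_fin ltW //.
by apply: theta_factor_gt0; rewrite ?xi01.
Qed.

Lemma inf_Lq_fin q t a : (1 <= q)%E -> I t ->
  inf_Lq q (xi t) (emb A a) = ((theta_factor q (xi t))^-1 * theta_real q t a)%:E.
Proof.
move=> q1 It; have f0 := theta_factor_gt0 (xi01 It) q1.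
apply/eqP; rewrite EFinM -theta_real_fin // eq_le lee_pdivlMl // lee_pdivrMl //.
by rewrite !lexx.
Qed.

Lemma theta_real_ge0 q t a : (1 <= q)%E -> I t -> 0 <= theta_real q t a.
Proof.
move=> q1 It; rewrite -lee_fin -theta_real_fin // mule_ge0 ?inf_Lq_ge0 // lee_fin ltW //.
by apply: theta_factor_gt0; rewrite ?xi01.
Qed.

Lemma theta_real_le q t a : (1 <= q)%E -> I t -> theta_real q t a <= 2 * expR 2 * Jfun a t.
Proof. by move=> q1 It; rewrite -lee_fin -theta_real_fin // theta_norm_le_Jfun. Qed.

Lemma theta_realD q t a b : (1 <= q)%E -> I t ->
  theta_real q t (a + b) <= theta_real q t a + theta_real q t b.
Proof.
move=> q1 It; have f0 := theta_factor_gt0 (xi01 It) q1; apply/ler_addgt0Pr => e e0.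
pose d := (theta_factor q (xi t))^-1 * (e / 2).
have d0 : 0 < d by rewrite mulr_gt0 ?invr_gt0 // divr_gt0.
have h c : (inf_Lq q (xi t) (emb A c) <
    ((theta_factor q (xi t))^-1 * (theta_real q t c + e / 2))%:E)%E.
  by rewrite inf_Lq_fin // lte_fin mulrDr ltrDl.
have := inf_LqD q1 (h a) (h b).
rewrite -linearD inf_Lq_fin // lee_fin -mulrDr ler_pM2l ?invr_gt0 //.
by move=> /le_trans; apply; rewrite addrACA -splitr.
Qed.

(** Lipschitz continuity in the A_1-norm supplies the continuity needed to compose with a strongly
    measurable [u]. *)
Lemma theta_real_dist q t a b : (1 <= q)%E -> I t ->
  `|theta_real q t a - theta_real q t b| <= 2 * expR 2 * `|a - b|.
Proof.
move=> q1 It; have J c : theta_real q t c <= 2 * expR 2 * `|c|.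
  apply: (le_trans (theta_real_le c q1 It)); rewrite ler_wpM2l ?mulr_ge0 ?expR_ge0 //.
  by apply: Jfun_le_norm; rewrite ltW ?I_gt0 ?I_le1.
have h c d : theta_real q t c - theta_real q t d <= 2 * expR 2 * `|c - d|.
  apply: le_trans (J _); rewrite lerBlDr; have := theta_realD (c - d) d q1 It.
  by rewrite subrK.
by rewrite ler_norml h andbT lerNl opprB distrC.
Qed.

(** An infimum over all representations has no evident measurability in [t]. For a fixed element the
    unnormalised infimum is monotone in theta and [xi] is monotone in [t], so it is a monotone
    function of [t]; the normalising factor is measurable by its formula. *)
Lemma measurable_theta_real q (u : R -> sp1 A) : (1 <= q)%E -> strongly_measurable I u ->
  measurable_fun I (fun t => theta_real q t (u t)).
Proof.
move=> q1; apply: measurable_comp_strong; first exact: measurable_I.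
  move=> a; apply: (@eq_measurable_fun _ _ _ _ _
    (fun t => theta_factor q (xi t) * fine (inf_Lq q (xi t) (emb A a)))).
    move=> t; rewrite inE => It; rewrite inf_Lq_fin //= mulrA divff ?mul1r //.
    by rewrite gt_eqF // theta_factor_gt0 // xi01.
  apply: measurable_funM; first exact: measurable_theta_factor.
  apply: nondecreasing_measurable_I => [t It|s t Is It st].
    by rewrite fine_ge0 // inf_Lq_ge0.
  by apply: fine_le; [rewrite inf_Lq_fin|rewrite inf_Lq_fin|apply/inf_Lq_mono/le_xi].
move=> t It; apply/cvgrPdist_lt => e e0.
have k0 : 0 < 2 * expR 2 :> R by rewrite mulr_gt0 // expR_gt0.
near=> b; apply: le_lt_trans (theta_real_dist _ _ q1 It) _.
rewrite mulrC -ltr_pdivlMr //; near: b.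
by apply: cvgr_dist_lt; rewrite ?divr_gt0 //; exact: cvg_id.
Unshelve. all: by end_near. Qed.

Lemma xi_norm_le_J_norm (G : J_parameter R) q x : (1 <= q)%E ->
  (xi_norm A q G x <= (2 * expR 2)%:E * J_norm A G x)%E.
Proof.
move=> q1; have k0 : 0 < 2 * expR 2 :> R by rewrite mulr_gt0 // expR_gt0.
rewrite -lee_pdivrMl //; apply: le_ereal_inf_tmp => _ [u ru <-].
rewrite lee_pdivrMl //.
have rI : represents I u x by exact/represents_oo_oc.
apply: (@le_trans _ _ (G (fun t => theta_real q t (u t)))).
  apply: ereal_inf_lbound; exists u => //; split => // t t01.
  by rewrite theta_real_fin ?ltry //= in_itv.
rewrite -[X in (X%:E * _)%E]ger0_norm ?(ltW k0) // -pnormZ; apply: pnorm_le.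
  by apply: measurable_theta_real => //; case: rI.
move=> t It; rewrite !ger0_norm ?theta_real_ge0 ?theta_real_le //.
by rewrite mulr_ge0 ?Jfun_ge0 // ltW.
Qed.

Lemma J_norm_le_xi_norm (G : J_parameter R) q : (1 <= q)%E -> sqrt_bounded G ->
  exists2 K, 0 < K & forall x, (J_norm A G x <= K%:E * xi_norm A q G x)%E.
Proof.
move=> q1 sG; have [K K0 hK] := J_norm_core A sG.
have c0 : 0 < 2 * expR 1 :> R by rewrite mulr_gt0 // expR_gt0.
have Kc : 0 < K * (2 * expR 1) by rewrite mulr_gt0.
exists (K * (2 * expR 1)) => // x; rewrite -lee_pdivrMl //.
apply: le_ereal_inf_tmp => _ [u [ru fu] <-]; rewrite lee_pdivrMl //.
have [fin|] := ltP (G (fun t => theta_real q t (u t))) +oo%E; last first.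
  by rewrite leye_eq => /eqP ->; rewrite gt0_muley ?lte_fin // leey.
have Gc : G (fun t => 2 * expR 1 * theta_real q t (u t))%R =
    ((2 * expR 1)%:E * G (fun t => theta_real q t (u t)))%E.
  by rewrite pnormZ ger0_norm // ltW.
rewrite EFinM -muleA -Gc; apply: (hK u) => //.
- by rewrite Gc lte_mul_pinfty // lee_fin ltW.
- by move=> t It; rewrite mulr_ge0 ?theta_real_ge0 // ltW.
move=> t e It e0.
(* The slack [e] is moved inside the bound, because a decomposition is obtained only from a strict
   inequality for the norm. *)
have -> : 2 * expR 1 * theta_real q t (u t) + e =
    2 * expR 1 * (theta_real q t (u t) + (2 * expR 1)^-1 * e).
  by rewrite mulrDr mulrA divff ?mul1r // gt_eqF.
apply: (decomposition_of_theta_norm q1).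
  by rewrite xi_gt0 ?xi_le_half ?I_gt0 ?I_le1.
by rewrite theta_real_fin // lte_fin ltrDl mulr_gt0 // invr_gt0.
Qed.

End IntermediateNorm.

Theorem theorem4 (R : realType) (G : J_parameter R) (A : ordered_pair R)
  (A1_dense : dense (range (emb A))) (q : \bar R) :
  separable_parameter G ->
  sqrt_bounded G ->
  dense_in_K_space G (dual_pair A1_dense) ->
  (1%:E <= q)%E ->
  same_space (J_norm A G) (xi_norm A q G).
Proof.
move=> _ sG _ q1; have [K K0 JK] := J_norm_le_xi_norm (A := A) q1 sG.
have k0 : 0 < 2 * expR 2 :> R by rewrite mulr_gt0 // expR_gt0.
have Jxi (x : sp0 A) := xi_norm_le_J_norm G x q1.
have xi0 x : (0 <= xi_norm A q G x)%E by apply: le_ereal_inf_tmp => _ [u _ <-]; exact: pnorm_ge0.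
split.
  apply/seteqP; split => x /= fx.
    by apply: le_lt_trans (Jxi x) _; rewrite lte_mul_pinfty // lee_fin ltW.
  by apply: le_lt_trans (JK x) _; rewrite lte_mul_pinfty // lee_fin ltW.
exists (Num.max K (2 * expR 2)); first by rewrite lt_max K0.
move=> x; split.
  by apply: le_trans (JK x) _; rewrite lee_wpmul2r // lee_fin le_max lexx.
by apply: le_trans (Jxi x) _; rewrite lee_wpmul2r ?J_norm_ge0 // lee_fin le_max lexx orbT.
Qed.
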